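(* Let $p>3$ be prime and suppose $1\le\ell\le\frac12(p-1)$. Then for every $A\in\Gamma_0(p^2)\cap\Gamma_1(p)$, $$\mathcal F_1\left(\tfrac\ell p;z\right)\Big|[A]_1=\mathcal F_1\left(\tfrac\ell p;z\right)$$ and $$\mathcal G_1\left(\tfrac\ell p;z\right)\Big|[A]_{\frac12}=\frac1{\nu_\eta(A)}\,\mathcal G_1\left(\tfrac\ell p;z\right),$$ where $\nu_\eta(A)$ is the eta-multiplier, defined by $\eta(z)\big|[A]_{\frac12}=\nu_\eta(A)\,\eta(z)$.
   Context: Notation: $z$ is in the upper half plane, $q=\exp(2\pi iz)$, $(q;q)_\infty=\prod_{n\ge1}(1-q^n)$, $\eta(z)=q^{1/24}(q;q)_\infty$, and for $A=\begin{pmatrix}a&b\\c&d\end{pmatrix}\in \mathrm{SL}_2(\mathbb Z)$ and $k\in\frac12\mathbb Z$, $(F|[A]_k)(z)=(cz+d)^{-k}F\left(\frac{az+b}{cz+d}\right)$ with principal value of $(cz+d)^{-k}$. Square roots are principal. For integers $0<\ell<p$, $\mathcal F_1\left(\frac\ell p;z\right)=\eta(z)\,\mathcal G_1\left(\frac\ell p;z\right)$ and $\mathcal G_1\left(\tfrac\ell p;z\right)=\mathcal N\left(\tfrac\ell p;z\right)-T_1\left(\tfrac\ell p;z\right)$, where $$\mathcal N\left(\tfrac\ell p;z\right)=\csc\left(\tfrac{\ell\pi}p\right)\frac{q^{-1/24}}{(q;q)_\infty}\left(1+\sum_{n=1}^\infty\frac{(-1)^n(1+q^n)(2-2\cos(2\pi\ell/p))}{1-2\cos(2\pi\ell/p)q^n+q^{2n}}q^{\frac12n(3n+1)}\right),$$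 $$T_1\left(\tfrac\ell p;z\right)=-\frac i{\sqrt3}\int_{-\overline z}^{i\infty}\frac{\Theta_1(\frac\ell p;\tau)}{\sqrt{-i(\tau+z)}}\,d\tau,\qquad \Theta_1\left(\tfrac\ell p;\tau\right)=\sum_{n\in\mathbb Z}(-1)^n(6n+1)\sin\left(\tfrac{\pi\ell(6n+1)}p\right)\exp\left(3\pi i\tau\left(n+\tfrac16\right)^2\right).$$ *)

(* Defs.v *)
From Stdlib Require Import Reals ZArith Znumtheory.
From Coquelicot Require Import Coquelicot.

Local Open Scope C_scope.

Definition Cexp (w : C) : C := RtoC (exp (Re w)) * (cos (Im w), sin (Im w)).

(* Principal argument, with values in (-PI, PI]; the value at 0 is irrelevant. *)
Definition Carg (w : C) : R :=
  if Rle_dec 0 (Im w) then acos (Re w / Cmod w) else Ropp (acos (Re w / Cmod w)).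

Definition Clog (w : C) : C := (ln (Cmod w), Carg w).

Definition Cpower (w : C) (s : R) : C := Cexp (RtoC s * Clog w).

Definition Csqrt (w : C) : C := Cpower w (1 / 2).

(* Coquelicot's Series and Lim_seq are restricted to real sequences. *)
Definition CSeries (a : nat -> C) : C :=
  iota (T := C_CompleteNormedModule) (is_series (V := C_NormedModule) a).

Definition CLim_seq (u : nat -> C) : C :=
  iota (T := C_CompleteNormedModule)
    (fun l : C => filterlim u eventually (@locally C_UniformSpace l)).

Definition CSeriesZ (a : Z -> C) : C :=
  CSeries (fun n => a (Z.of_nat n)) + CSeries (fun n => a (- Z.of_nat (S n))%Z).

(* [qpow z r] is q^r for q = exp(2 pi i z); fractional powers of q depend on z
   and not only on q. *)
Definition qpow (z : C) (r : R) : C := Cexp (RtoC (2 * PI * r) * Ci * z).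

Fixpoint qpoch_partial (z : C) (N : nat) : C :=
  match N with
  | O => 1
  | S N' => qpoch_partial z N' * (1 - qpow z (INR N))
  end.

Definition qpoch (z : C) : C := CLim_seq (qpoch_partial z).

Definition eta (z : C) : C := qpow z (1 / 24) * qpoch z.

Record SL2Z := mkSL2Z {
  ma : Z; mb : Z; mc : Z; md : Z;
  SL2Z_det : (ma * md - mb * mc = 1)%Z
}.

Definition Gamma0 (N : Z) (A : SL2Z) : Prop := (N | mc A)%Z.

Definition Gamma1 (N : Z) (A : SL2Z) : Prop :=
  (N | mc A)%Z /\ (N | ma A - 1)%Z /\ (N | md A - 1)%Z.

Definition upper_half_plane (z : C) : Prop := (0 < Im z)%R.

Definition slash (k : R) (A : SL2Z) (F : C -> C) (z : C) : C :=
  let j := RtoC (IZR (mc A)) * z + RtoC (IZR (md A)) in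
  Cpower j (- k) * F ((RtoC (IZR (ma A)) * z + RtoC (IZR (mb A))) / j).

Definition nu_eta (A : SL2Z) : C :=
  iota (T := C_CompleteNormedModule)
    (fun nu : C => forall z : C, upper_half_plane z ->
       slash (1 / 2) A eta z = nu * eta z).

(* Below, the real parameter x stands for l / p. *)

Definition calN (x : R) (z : C) : C :=
  RtoC (/ sin (x * PI)) * (qpow z (- (1 / 24)) / qpoch z) *
  (1 + CSeries (fun m =>
         let n := INR (S m) in
         RtoC ((-1) ^ S m) * (1 + qpow z n) * RtoC (2 - 2 * cos (2 * PI * x))
         / (1 - RtoC (2 * cos (2 * PI * x)) * qpow z n + qpow z (2 * n))
         * qpow z (1 / 2 * n * (3 * n + 1)))).

Definition Theta1 (x : R) (tau : C) : C :=
  CSeriesZ (fun n =>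
    RtoC (powerRZ (-1) n * (6 * IZR n + 1) * sin (PI * x * (6 * IZR n + 1)))
    * Cexp (3 * RtoC PI * Ci * tau * RtoC ((IZR n + 1 / 6) ^ 2))).

(* Integral from w to i*infinity along the vertical half-line
   tau = w + i t, t >= 0, so that dtau = i dt. *)
Definition int_to_iinfty (w : C) (f : C -> C) : C :=
  RInt_gen (V := C_R_CompleteNormedModule)
    (fun t : R => f (w + Ci * RtoC t) * Ci)
    (at_point 0%R) (Rbar_locally p_infty).

Definition T1 (x : R) (z : C) : C :=
  - (Ci / RtoC (sqrt 3)) *
  int_to_iinfty (- Cconj z)
    (fun tau => Theta1 x tau / Csqrt (- Ci * (tau + z))).

Definition G1 (x : R) (z : C) : C := calN x z - T1 x z.

Definition F1 (x : R) (z : C) : C := eta z * G1 x z.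

(* Main.v *)
Require Import Defs.
From Stdlib Require Import Reals ZArith Znumtheory List Lra Lia FinFun Permutation.
From Stdlib Require Import Classical ClassicalEpsilon FunctionalExtensionality.
From Coquelicot Require Import Coquelicot.

(** The completed rank function is a lattice sum on which modularity is visible. With [y = Im z] and
    [W = x + m z + n], and for [0 < x < 1],

      [PI F1(x; z) = sum_(m, n) (-1)^(mn+m+n) exp (-3 PI i m x) exp (-3 PI |W|^2 / (2 y)) / W].

    This is [F1_lattice]. Replacing [z] by [A z] divides every [W] by [c z + d] once [(m, n)] is
    changed by [A] and, for [x = l/p], translated by [(l c / p, l (d - 1) / p)]; the quantity [|W|^2 / y]
    does not change. The congruences on [A] make the translation integral, and a parity check shows that
    the signs and the phase [exp (-3 PI i m x)] agree as well. Hence [F1] has weight one ([F1_modular]).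

    Why the lattice sum is [F1]: as the conjugate of [W] is [W - 2 i m y], its terms are
    [(-1)^m q^(3 m^2 / 2)] times [(-1)^n exp (-3 PI W^2 / (2 y)) / W]. The sum over [n] is evaluated by
    [damped_csc]: it is [PI csc (PI (x + m z))] plus a series of complementary error functions indexed by
    half-integers [rho]. The cosecants add up to [PI eta N] ([calN_csc]). In the error terms the sum
    over [m] only depends on the class of the odd number [2 rho] modulo 6 and is [+- eta] or zero
    ([eta_collapse]). What remains is [eta] times a single series of error functions, which is also what
    termwise integration makes of [T1] ([T1_series]).

    Everything above needs Poisson summation for Gaussians with complex parameters
    ([poisson_gauss]), obtained from pointwise Fourier inversion ([fourier_inversion]) by moving the line
    of integration in the complex plane ([gauss_contour]), and the pentagonal number theorem
    ([pentagonal]), which turns the product defining [eta] into a theta series.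

    The second claim follows from the first as soon as [eta (A z) = nu sqrt (c z + d) eta (z)] with a nonzero
    constant [nu] ([eta_modular]). The same method gives this: for [z] and [w] in opposite half-planes
    the product [eta (z) eta (-w)] is, up to the factor [2 sqrt ((z - w) / (3 i))], a Gaussian sum
    that is invariant when the modular group acts on [z] and [w] simultaneously ([eta_pair]). Freezing
    [w] yields the law for [eta]. *)

(** * Unconditional sums *)

Section Sums.
Local Open Scope C_scope.

Lemma choice_fun {X Y : Type} (P : X -> Y -> Prop) :
  (forall x, exists y, P x y) -> exists f, forall x, P x (f x).
Proof.
  intros H. exists (fun x => proj1_sig (constructive_indefinite_description _ (H x))).
  intros x. exact (proj2_sig (constructive_indefinite_description _ (H x))).
Qed.

Lemma Cmod_sub_sym (z w : C) : Cmod (z - w) = Cmod (w - z).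
Proof. rewrite <- Cmod_opp. f_equal. ring. Qed.

Lemma Cmod_le_Re_Im (z : C) : (Cmod z <= Rabs (Re z) + Rabs (Im z))%R.
Proof.
  replace z with (RtoC (Re z) + Ci * RtoC (Im z)) at 1.
  - eapply Rle_trans; [apply Cmod_triangle|].
    rewrite Cmod_mult, Cmod_Ci, !Cmod_R. lra.
  - destruct z as [a b]. unfold Ci, RtoC, Cplus, Cmult, Re, Im; simpl. f_equal; ring.
Qed.

Lemma Rabs_Re_le_Cmod (z : C) : (Rabs (Re z) <= Cmod z)%R.
Proof. eapply Rle_trans; [apply Rmax_l|apply Rmax_Cmod]. Qed.

Lemma Rabs_Im_le_Cmod (z : C) : (Rabs (Im z) <= Cmod z)%R.
Proof. eapply Rle_trans; [apply Rmax_r|apply Rmax_Cmod]. Qed.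

Fixpoint Csum {I : Type} (f : I -> C) (L : list I) : C :=
  match L with nil => 0 | i :: L' => f i + Csum f L' end.

Fixpoint Rsum {I : Type} (f : I -> R) (L : list I) : R :=
  match L with nil => 0%R | i :: L' => (f i + Rsum f L')%R end.

(** The limit is taken along the finite subsets of the index type, encoded as duplicate-free lists
    ordered by inclusion. No enumeration is chosen, so that a lattice sum can be reindexed by a modular
    substitution and its two summations exchanged without further estimates. *)
Definition hasSum {I : Type} (f : I -> C) (s : C) : Prop :=
  forall eps : R, (0 < eps)%R -> exists L0 : list I,
    forall L, NoDup L -> incl L0 L -> (Cmod (Csum f L - s) < eps)%R.

Definition summable {I : Type} (a : I -> R) : Prop :=
  exists M : R, forall L, NoDup L -> (Rsum a L <= M)%R.

Lemma NoDup_cover {I : Type} (L : list I) : exists L', NoDup L' /\ incl L L'.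
Proof.
  pose (dec := fun x y : I => excluded_middle_informative (x = y)).
  exists (nodup dec L). split; [apply NoDup_nodup|].
  intros x Hx. apply nodup_In; exact Hx.
Qed.

Lemma Csum_app {I} (f : I -> C) L1 L2 : Csum f (L1 ++ L2) = Csum f L1 + Csum f L2.
Proof. induction L1 as [|i L1 IH]; simpl; [ring|rewrite IH; ring]. Qed.

Lemma Rsum_app {I} (f : I -> R) L1 L2 : Rsum f (L1 ++ L2) = (Rsum f L1 + Rsum f L2)%R.
Proof. induction L1 as [|i L1 IH]; simpl; [ring|rewrite IH; ring]. Qed.

Lemma Csum_ext {I} (f g : I -> C) L : (forall i, In i L -> f i = g i) -> Csum f L = Csum g L.
Proof.
  induction L as [|i L IH]; simpl; intros H; [reflexivity|].
  rewrite (H i), IH; auto.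
Qed.

Lemma Csum_plus {I} (f g : I -> C) L : Csum (fun i => f i + g i) L = Csum f L + Csum g L.
Proof. induction L as [|i L IH]; simpl; [ring|rewrite IH; ring]. Qed.

Lemma Csum_scal {I} (c : C) (f : I -> C) L : Csum (fun i => c * f i) L = c * Csum f L.
Proof. induction L as [|i L IH]; simpl; [ring|rewrite IH; ring]. Qed.

Lemma Csum_map {I J} (f : I -> C) (h : J -> I) L : Csum f (map h L) = Csum (fun j => f (h j)) L.
Proof. induction L as [|i L IH]; simpl; [reflexivity|rewrite IH; reflexivity]. Qed.

Lemma Rsum_map {I J} (f : I -> R) (h : J -> I) L : Rsum f (map h L) = Rsum (fun j => f (h j)) L.
Proof. induction L as [|i L IH]; simpl; [reflexivity|rewrite IH; reflexivity]. Qed.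

Lemma Rsum_le {I} (f g : I -> R) L : (forall i, In i L -> (f i <= g i)%R) -> (Rsum f L <= Rsum g L)%R.
Proof.
  induction L as [|i L IH]; simpl; intros H; [lra|].
  apply Rplus_le_compat; auto.
Qed.

Lemma Rsum_nonneg {I} (f : I -> R) L : (forall i, (0 <= f i)%R) -> (0 <= Rsum f L)%R.
Proof. intros H; induction L as [|i L IH]; simpl; [lra|specialize (H i); lra]. Qed.

Lemma Rsum_scal {I} (c : R) (f : I -> R) L : Rsum (fun i => c * f i)%R L = (c * Rsum f L)%R.
Proof. induction L as [|i L IH]; simpl; [ring|rewrite IH; ring]. Qed.

Lemma Rsum_const {I} (c : R) (L : list I) : Rsum (fun _ => c) L = (INR (length L) * c)%R.
Proof. induction L as [|i L IH]; simpl length; [simpl; ring|rewrite S_INR; simpl; rewrite IH; ring]. Qed.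

Lemma Cmod_Csum_le {I} (f : I -> C) L : (Cmod (Csum f L) <= Rsum (fun i => Cmod (f i)) L)%R.
Proof.
  induction L as [|i L IH]; simpl; [rewrite Cmod_0; lra|].
  eapply Rle_trans; [apply Cmod_triangle|lra].
Qed.

Lemma Rsum_incl {I} (a : I -> R) L1 L2 : (forall i, (0 <= a i)%R) ->
  NoDup L1 -> incl L1 L2 -> (Rsum a L1 <= Rsum a L2)%R.
Proof.
  intros Ha N1. revert L2. induction N1 as [|x L1 Hx N1 IH]; intros L2 Hi; simpl.
  - apply Rsum_nonneg; exact Ha.
  - destruct (in_split x L2) as [l1 [l2 E]]; [apply Hi; left; reflexivity|].
    subst L2. rewrite Rsum_app. simpl.
    assert (H : (Rsum a L1 <= Rsum a (l1 ++ l2))%R).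
    { apply IH. intros y Hy.
      assert (Hy' : In y (l1 ++ x :: l2)) by (apply Hi; right; exact Hy).
      apply in_app_iff in Hy'. apply in_app_iff. destruct Hy' as [?|[?|?]]; auto.
      subst; contradiction. }
    rewrite Rsum_app in H. lra.
Qed.

Lemma hasSum_unique {I} (f : I -> C) s t : hasSum f s -> hasSum f t -> s = t.
Proof.
  intros Hs Ht.
  destruct (Req_dec (Cmod (s - t)) 0) as [E|E].
  - apply Cmod_eq_0 in E. replace s with ((s - t) + t) by ring. rewrite E. ring.
  - exfalso. assert (Hp : (0 < Cmod (s - t) / 2)%R) by (pose proof (Cmod_ge_0 (s - t)); lra).
    destruct (Hs _ Hp) as [L1 H1]. destruct (Ht _ Hp) as [L2 H2].
    destruct (NoDup_cover (L1 ++ L2)) as [L [N HL]].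
    specialize (H1 L N (fun x h => HL x (in_or_app _ _ _ (or_introl h)))).
    specialize (H2 L N (fun x h => HL x (in_or_app _ _ _ (or_intror h)))).
    rewrite Cmod_sub_sym in H1.
    pose proof (Cmod_triangle (s - Csum f L) (Csum f L - t)) as H.
    replace (s - Csum f L + (Csum f L - t)) with (s - t) in H by ring. lra.
Qed.

Lemma hasSum_ext {I} (f g : I -> C) s : (forall i, f i = g i) -> hasSum f s -> hasSum g s.
Proof.
  intros E H eps He. destruct (H eps He) as [L0 H0]. exists L0. intros L N HL.
  rewrite <- (Csum_ext f g) by auto. apply H0; assumption.
Qed.

Lemma hasSum_plus {I} (f g : I -> C) s t :
  hasSum f s -> hasSum g t -> hasSum (fun i => f i + g i) (s + t).
Proof.
  intros Hf Hg eps He.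
  destruct (Hf (eps / 2)%R ltac:(lra)) as [L1 H1]. destruct (Hg (eps / 2)%R ltac:(lra)) as [L2 H2].
  exists (L1 ++ L2). intros L N HL.
  specialize (H1 L N (fun x h => HL x (in_or_app _ _ _ (or_introl h)))).
  specialize (H2 L N (fun x h => HL x (in_or_app _ _ _ (or_intror h)))).
  rewrite Csum_plus.
  replace (Csum f L + Csum g L - (s + t)) with ((Csum f L - s) + (Csum g L - t)) by ring.
  eapply Rle_lt_trans; [apply Cmod_triangle|lra].
Qed.

Lemma hasSum_scal {I} (c : C) (f : I -> C) s : hasSum f s -> hasSum (fun i => c * f i) (c * s).
Proof.
  intros Hf eps He.
  assert (Hc : (0 < Cmod c + 1)%R) by (pose proof (Cmod_ge_0 c); lra).
  destruct (Hf (eps / (Cmod c + 1))%R) as [L0 H0]; [apply Rdiv_lt_0_compat; lra|].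
  exists L0. intros L N HL. specialize (H0 L N HL).
  rewrite Csum_scal. replace (c * Csum f L - c * s) with (c * (Csum f L - s)) by ring.
  rewrite Cmod_mult.
  apply Rle_lt_trans with ((Cmod c + 1) * Cmod (Csum f L - s))%R.
  - apply Rmult_le_compat_r; [apply Cmod_ge_0|lra].
  - apply Rlt_le_trans with ((Cmod c + 1) * (eps / (Cmod c + 1)))%R.
    + apply Rmult_lt_compat_l; assumption.
    + right. field. lra.
Qed.

Lemma hasSum_reindex {I J} (phi : J -> I) (psi : I -> J) (f : I -> C) s :
  (forall i, phi (psi i) = i) -> (forall j, psi (phi j) = j) ->
  hasSum f s -> hasSum (fun j => f (phi j)) s.
Proof.
  intros E1 E2 H eps He. destruct (H eps He) as [L0 H0].
  exists (map psi L0). intros L N HL. rewrite <- Csum_map. apply H0.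
  - apply Injective_map_NoDup; [|exact N].
    intros x y Hxy. rewrite <- (E2 x), <- (E2 y), Hxy. reflexivity.
  - intros i Hi. rewrite <- (E1 i). apply in_map, HL, in_map, Hi.
Qed.

Lemma hasSum_bound {I} (f : I -> C) s M :
  (forall L, NoDup L -> (Cmod (Csum f L) <= M)%R) -> hasSum f s -> (Cmod s <= M)%R.
Proof.
  intros HM H. apply Rnot_lt_le. intros Hlt.
  destruct (H (Cmod s - M)%R ltac:(lra)) as [L0 H0].
  destruct (NoDup_cover L0) as [L [N HL]]. specialize (H0 L N HL). specialize (HM L N).
  pose proof (Cmod_triangle (s - Csum f L) (Csum f L)) as T.
  replace (s - Csum f L + Csum f L) with s in T by ring.
  rewrite Cmod_sub_sym in H0. lra.
Qed.

Lemma hasSum_zero {I} : hasSum (fun _ : I => 0) 0.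
Proof.
  intros eps He. exists nil. intros L _ _.
  assert (E : Csum (fun _ : I => 0) L = 0)
    by (induction L as [|i L IH]; simpl; [reflexivity|]; rewrite IH; ring).
  rewrite E. replace (0 - 0) with (RtoC 0) by ring. rewrite Cmod_0; exact He.
Qed.

Lemma hasSum_single {I} (f : I -> C) (i0 : I) :
  (forall i, i <> i0 -> f i = 0) -> hasSum f (f i0).
Proof.
  intros Hz eps He. exists (i0 :: nil). intros L N HL.
  destruct (in_split i0 L) as [l1 [l2 E]]; [apply HL; left; reflexivity|]. subst L.
  assert (Z : forall l, ~ In i0 l -> Csum f l = 0).
  { induction l as [|x l IH]; simpl; intros Hn; [reflexivity|].
    rewrite IH by tauto. rewrite Hz by (intros E; apply Hn; left; exact E). ring. }
  apply NoDup_remove_2 in N. rewrite in_app_iff in N.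
  rewrite Csum_app; simpl. rewrite !Z by tauto.
  replace (0 + (f i0 + 0) - f i0) with (RtoC 0) by ring. rewrite Cmod_0; exact He.
Qed.

Lemma summable_le {I} (a b : I -> R) : (forall i, (a i <= b i)%R) -> summable b -> summable a.
Proof.
  intros H [M HM]. exists M. intros L N. eapply Rle_trans; [apply Rsum_le; intros i _; apply H|auto].
Qed.

Lemma summable_scal {I} (c : R) (a : I -> R) : (0 <= c)%R -> summable a -> summable (fun i => c * a i)%R.
Proof.
  intros Hc [M HM]. exists (c * M)%R. intros L N. rewrite Rsum_scal.
  apply Rmult_le_compat_l; auto.
Qed.

Lemma summable_inj {I J} (phi : J -> I) (a : I -> R) :
  (forall x y, phi x = phi y -> x = y) -> summable a -> summable (fun j => a (phi j)).
Proof.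
  intros Hi [M HM]. exists M. intros L N. rewrite <- Rsum_map. apply HM.
  apply Injective_map_NoDup; [exact Hi|exact N].
Qed.

Lemma summable_prod {I J} (a : I -> R) (b : J -> R) :
  (forall i, (0 <= a i)%R) -> (forall j, (0 <= b j)%R) -> summable a -> summable b ->
  summable (fun ij => a (fst ij) * b (snd ij))%R.
Proof.
  intros Ha Hb [A HA] [B HB]. exists (A * B)%R. intros L N.
  destruct (NoDup_cover (map fst L)) as [L1 [N1 H1]].
  destruct (NoDup_cover (map snd L)) as [L2 [N2 H2]].
  apply Rle_trans with (Rsum (fun ij => a (fst ij) * b (snd ij))%R (list_prod L1 L2)).
  - apply Rsum_incl; [intros i; apply Rmult_le_pos; auto|exact N|].
    intros [i j] Hij. apply in_prod.
    + apply H1. change i with (fst (i, j)). apply in_map, Hij.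
    + apply H2. change j with (snd (i, j)). apply in_map, Hij.
  - replace (Rsum _ (list_prod L1 L2)) with (Rsum a L1 * Rsum b L2)%R.
    + apply Rmult_le_compat; auto; apply Rsum_nonneg; auto.
    + clear. induction L1 as [|i L1 IH]; simpl; [ring|].
      rewrite Rsum_app, Rsum_map, <- IH. simpl. rewrite Rsum_scal. ring.
Qed.

Lemma Rsum_RtoC {I} (a : I -> R) L : Csum (fun i => RtoC (a i)) L = RtoC (Rsum a L).
Proof. induction L as [|i L IH]; simpl; [reflexivity|rewrite IH, RtoC_plus; reflexivity]. Qed.

Lemma hasSum_nonneg_ex {I} (a : I -> R) : (forall i, (0 <= a i)%R) -> summable a ->
  exists s : R, hasSum (fun i => RtoC (a i)) (RtoC s).
Proof.
  intros Ha [M HM].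
  destruct (completeness (fun v => exists L, NoDup L /\ v = Rsum a L)) as [s [U V]].
  - exists M. intros v [L [N E]]. subst. auto.
  - exists (Rsum a nil). exists nil. split; [constructor|reflexivity].
  - exists s. intros eps He.
    assert (H : exists L, NoDup L /\ (s - eps < Rsum a L)%R).
    { apply NNPP. intros Hn. apply (Rlt_irrefl s). apply Rle_lt_trans with (s - eps)%R; [|lra].
      apply V. intros v [L [N E]]. subst. apply Rnot_lt_le. intros H. apply Hn. exists L; auto. }
    destruct H as [L0 [N0 H0]]. exists L0. intros L N HL.
    rewrite Rsum_RtoC, <- RtoC_minus, Cmod_R. apply Rabs_def1.
    + assert (Rsum a L <= s)%R by (apply U; exists L; auto). lra.
    + pose proof (Rsum_incl a L0 L Ha N0 HL). lra.
Qed.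

Lemma hasSum_real_ex {I} (b a : I -> R) : (forall i, (Rabs (b i) <= a i)%R) -> summable a ->
  exists s : R, hasSum (fun i => RtoC (b i)) (RtoC s).
Proof.
  intros Hb Ha.
  destruct (hasSum_nonneg_ex (fun i => Rabs (b i))) as [s1 H1].
  { intros; apply Rabs_pos. } { eapply summable_le; [apply Hb|exact Ha]. }
  destruct (hasSum_nonneg_ex (fun i => Rabs (b i) + b i)%R) as [s2 H2].
  { intros i. pose proof (Rle_abs (- b i)). rewrite Rabs_Ropp in H. lra. }
  { apply summable_le with (fun i => 2 * a i)%R.
    - intros i. pose proof (Rle_abs (b i)). specialize (Hb i). lra.
    - apply summable_scal; [lra|exact Ha]. }
  exists (s2 + (-1) * s1)%R. rewrite RtoC_plus, RtoC_mult.
  apply hasSum_ext with (fun i => RtoC (Rabs (b i) + b i) + RtoC (-1) * RtoC (Rabs (b i))).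
  - intros i. rewrite RtoC_plus. ring.
  - apply hasSum_plus; [exact H2|apply hasSum_scal; exact H1].
Qed.

(** Absolute convergence: bounded nonnegative families sum to the supremum of their finite sums, and
    real and complex families are differences and combinations of such. *)
Lemma hasSum_ex {I} (f : I -> C) (a : I -> R) : (forall i, (Cmod (f i) <= a i)%R) -> summable a ->
  exists s : C, hasSum f s.
Proof.
  intros Hf Ha.
  destruct (hasSum_real_ex (fun i => Re (f i)) a) as [s1 H1]; auto.
  { intros i. eapply Rle_trans; [apply Rabs_Re_le_Cmod|apply Hf]. }
  destruct (hasSum_real_ex (fun i => Im (f i)) a) as [s2 H2]; auto.
  { intros i. eapply Rle_trans; [apply Rabs_Im_le_Cmod|apply Hf]. }
  exists (RtoC s1 + Ci * RtoC s2).
  apply hasSum_ext with (fun i => RtoC (Re (f i)) + Ci * RtoC (Im (f i))).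
  - intros i. destruct (f i) as [u v]. unfold Ci, RtoC, Cplus, Cmult; simpl. f_equal; ring.
  - apply hasSum_plus; [exact H1|apply hasSum_scal; exact H2].
Qed.

(** The finite set that controls the double sum is enlarged fibre by fibre until each of the finitely
    many inner sums in play is almost exact. *)
Lemma hasSum_fubini {I J} (f : I * J -> C) (g : I -> C) s :
  hasSum f s -> (forall i, hasSum (fun j => f (i, j)) (g i)) -> hasSum g s.
Proof.
  intros Hf Hg eps He.
  destruct (Hf (eps / 2)%R ltac:(lra)) as [K0 HK0].
  exists (map fst K0). intros L N HL.
  set (d := (eps / (2 * (INR (length L) + 1)))%R).
  assert (Hn : (0 <= INR (length L))%R) by apply pos_INR.
  assert (Hd : (0 < d)%R) by (apply Rdiv_lt_0_compat; lra).
  assert (HJ : forall i, exists Ji, NoDup Ji /\ incl (map snd K0) Ji /\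
             (Cmod (Csum (fun j => f (i, j)) Ji - g i) < d)%R).
  { intros i. destruct (Hg i d Hd) as [J0 H0].
    destruct (NoDup_cover (map snd K0 ++ J0)) as [J1 [N1 H1]].
    exists J1. split; [exact N1|]. split; [intros x Hx; apply H1, in_or_app; auto|].
    apply H0; [exact N1|intros x Hx; apply H1, in_or_app; auto]. }
  destruct (choice_fun _ HJ) as [Jf HJf]. clear HJ. rename HJf into HJ.
  set (K := flat_map (fun i => map (fun j => (i, j)) (Jf i)) L).
  assert (HsumK : Csum f K = Csum (fun i => Csum (fun j => f (i, j)) (Jf i)) L).
  { unfold K. clear. induction L as [|i L IH]; simpl; [reflexivity|].
    rewrite Csum_app, Csum_map, IH. reflexivity. }
  assert (HinK : forall i j, In (i, j) K <-> In i L /\ In j (Jf i)).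
  { intros i j. unfold K. rewrite in_flat_map. split.
    - intros [x [Hx Hy]]. apply in_map_iff in Hy. destruct Hy as [y [E Hy]].
      inversion E; subst. auto.
    - intros [H1 H2]. exists i. split; [exact H1|]. apply in_map; exact H2. }
  assert (NK : NoDup K).
  { assert (HJN : forall i, NoDup (Jf i)) by (intros i; apply HJ).
    unfold K. clear HsumK HinK K HL Hn HJ Hd d. induction N as [|i L Hi N IH]; simpl; [constructor|].
    apply NoDup_app; [|exact IH|].
    - apply Injective_map_NoDup; [|apply HJN]. intros x y E; inversion E; reflexivity.
    - intros [x y] H1 H2. apply in_map_iff in H1. destruct H1 as [z [E1 _]]. inversion E1; subst.
      apply in_flat_map in H2. destruct H2 as [w [Hw H2]].
      apply in_map_iff in H2. destruct H2 as [z' [E2 _]]. inversion E2; subst. contradiction. }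
  assert (HK : incl K0 K).
  { intros [i j] Hij. apply HinK. split.
    - apply HL. change i with (fst (i, j)). apply in_map, Hij.
    - apply (proj1 (proj2 (HJ i))). change j with (snd (i, j)). apply in_map, Hij. }
  specialize (HK0 K NK HK). rewrite HsumK in HK0.
  assert (Hdiff : (Cmod (Csum g L - Csum (fun i => Csum (fun j => f (i, j)) (Jf i)) L)
                  <= INR (length L) * d)%R).
  { replace (Csum g L - Csum (fun i => Csum (fun j => f (i, j)) (Jf i)) L)
      with (Csum (fun i => g i + (-1) * Csum (fun j => f (i, j)) (Jf i)) L)
      by (rewrite Csum_plus, Csum_scal; ring).
    eapply Rle_trans; [apply Cmod_Csum_le|]. rewrite <- (Rsum_const d L).
    apply Rsum_le. intros i _. apply Rlt_le. rewrite <- Cmod_opp.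
    replace (- (g i + (-1) * Csum (fun j => f (i, j)) (Jf i)))
      with (Csum (fun j => f (i, j)) (Jf i) - g i) by ring. apply HJ. }
  assert (Hd2 : (INR (length L) * d < eps / 2)%R).
  { unfold d. apply Rmult_lt_reg_r with (2 * (INR (length L) + 1))%R; [lra|].
    field_simplify; [|lra]. lra. }
  replace (Csum g L - s) with
    ((Csum g L - Csum (fun i => Csum (fun j => f (i, j)) (Jf i)) L) +
     (Csum (fun i => Csum (fun j => f (i, j)) (Jf i)) L - s)) by ring.
  eapply Rle_lt_trans; [apply Cmod_triangle|]. lra.
Qed.

Lemma hasSum_swap {I J} (f : I * J -> C) s : hasSum f s -> hasSum (fun ji => f (snd ji, fst ji)) s.
Proof.
  apply (hasSum_reindex (fun ji : J * I => (snd ji, fst ji)) (fun ij : I * J => (snd ij, fst ij)));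
  intros [? ?]; reflexivity.
Qed.

Lemma hasSum_union {I J} (f : I + J -> C) s t :
  hasSum (fun i => f (inl i)) s -> hasSum (fun j => f (inr j)) t -> hasSum f (s + t).
Proof.
  intros Hs Ht eps He.
  destruct (Hs (eps / 2)%R ltac:(lra)) as [L1 H1]. destruct (Ht (eps / 2)%R ltac:(lra)) as [L2 H2].
  exists (map inl L1 ++ map inr L2). intros L N HL.
  pose (l1 := flat_map (fun x : I + J => match x with inl i => i :: nil | inr _ => nil end) L).
  pose (l2 := flat_map (fun x : I + J => match x with inl _ => nil | inr j => j :: nil end) L).
  assert (E : Csum f L = Csum (fun i => f (inl i)) l1 + Csum (fun j => f (inr j)) l2).
  { unfold l1, l2. clear. induction L as [|[i|j] L IH]; simpl; [ring| |]; rewrite IH; ring. }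
  assert (I1 : forall i, In i l1 <-> In (inl i) L).
  { intros i. unfold l1. rewrite in_flat_map. split.
    - intros [[x|x] [Hx Hi]]; simpl in Hi; [|contradiction]. destruct Hi as [->|[]]. exact Hx.
    - intros H. exists (inl i). split; [exact H|left; reflexivity]. }
  assert (I2 : forall j, In j l2 <-> In (inr j) L).
  { intros i. unfold l2. rewrite in_flat_map. split.
    - intros [[x|x] [Hx Hi]]; simpl in Hi; [contradiction|]. destruct Hi as [->|[]]. exact Hx.
    - intros H. exists (inr i). split; [exact H|left; reflexivity]. }
  assert (NN : NoDup l1 /\ NoDup l2).
  { clear E HL. unfold l1, l2 in *. clear l1 l2. induction N as [|x L Hx N IH]; [split; constructor|].
    assert (HH : (forall i, In i (flat_map (fun x : I + J => match x with inl i => i :: nil | inr _ => nil end) L) <-> In (inl i) L)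
      /\ (forall j, In j (flat_map (fun x : I + J => match x with inl _ => nil | inr j => j :: nil end) L) <-> In (inr j) L)).
    { clear. split; intros i; rewrite in_flat_map; split.
      - intros [[y|y] [Hy Hi]]; simpl in Hi; [|contradiction]. destruct Hi as [->|[]]. exact Hy.
      - intros H. exists (inl i). split; [exact H|left; reflexivity].
      - intros [[y|y] [Hy Hi]]; simpl in Hi; [contradiction|]. destruct Hi as [->|[]]. exact Hy.
      - intros H. exists (inr i). split; [exact H|left; reflexivity]. }
    destruct HH as [G1 G2]. destruct IH as [A1 A2]; [exact G1|exact G2|].
    destruct x as [i|j]; simpl; split; try assumption; constructor; try assumption.
    - rewrite G1. exact Hx.
    - rewrite G2. exact Hx. }
  destruct NN as [N1 N2].
  assert (Q1 : (Cmod (Csum (fun i => f (inl i)) l1 - s) < eps / 2)%R).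
  { apply H1; [exact N1|]. intros i Hi. apply I1, HL, in_or_app. left. apply in_map, Hi. }
  assert (Q2 : (Cmod (Csum (fun j => f (inr j)) l2 - t) < eps / 2)%R).
  { apply H2; [exact N2|]. intros i Hi. apply I2, HL, in_or_app. right. apply in_map, Hi. }
  rewrite E.
  replace (Csum (fun i => f (inl i)) l1 + Csum (fun j => f (inr j)) l2 - (s + t)) with
   ((Csum (fun i => f (inl i)) l1 - s) + (Csum (fun j => f (inr j)) l2 - t)) by ring.
  eapply Rle_lt_trans; [apply Cmod_triangle|]. lra.
Qed.

End Sums.

(** * Sums over the integers and Gaussian majorants *)

Section SumsZ.
Local Open Scope C_scope.

Lemma filterlim_C_iff (u : nat -> C) (l : C) :
  filterlim u eventually (@locally C_UniformSpace l) <->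
  forall eps, (0 < eps)%R -> exists N, forall n, (N <= n)%nat -> (Cmod (u n - l) < eps)%R.
Proof.
  pose proof (@filterlim_locally_ball_norm C_AbsRing nat C_NormedModule eventually _ u l) as H.
  split.
  - intros Hu eps He. destruct (proj1 H Hu (mkposreal eps He)) as [N HN].
    exists N. intros n Hn. apply (HN n Hn).
  - intros Hu. apply (proj2 H). intros [eps He]. destruct (Hu eps He) as [N HN].
    exists N. intros n Hn. apply (HN n Hn).
Qed.

Lemma CLim_seq_eq (u : nat -> C) (l : C) :
  (forall eps, (0 < eps)%R -> exists N, forall n, (N <= n)%nat -> (Cmod (u n - l) < eps)%R) ->
  CLim_seq u = l.
Proof.
  intros H. apply filterlim_C_iff in H. unfold CLim_seq.
  apply (@iota_filterlim_locally C_AbsRing C_CompleteNormedModule nat eventually _ u l H).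
Qed.

Lemma sum_n_Csum (f : nat -> C) n : sum_n (G := C_AbelianMonoid) f n = Csum f (seq 0 (S n)).
Proof.
  induction n as [|n IH].
  - rewrite sum_O. simpl. ring.
  - rewrite sum_Sn, IH. rewrite (seq_S (S n) 0), Csum_app. simpl.
    change (plus ?x ?y) with (x + y). ring.
Qed.

Lemma In_seq_incl_bound (L : list nat) : exists N, forall n, In n L -> (n < N)%nat.
Proof.
  induction L as [|k L [N HN]]; [exists 0%nat; intros n []|].
  exists (Nat.max (S k) N). intros n [->|H]; [lia|specialize (HN n H); lia].
Qed.

Lemma hasSum_CSeries (f : nat -> C) s : hasSum f s -> CSeries f = s.
Proof.
  intros H. unfold CSeries, is_series.
  apply (@iota_filterlim_locally C_AbsRing C_CompleteNormedModule nat eventually _ (sum_n f) s).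
  apply filterlim_C_iff. intros eps He. destruct (H eps He) as [L0 H0].
  destruct (In_seq_incl_bound L0) as [N HN]. exists N. intros n Hn.
  rewrite sum_n_Csum. apply H0; [apply seq_NoDup|].
  intros k Hk. apply in_seq. specialize (HN k Hk). lia.
Qed.

(** The two halves into which [CSeriesZ] cuts the integers. *)
Definition Z_of_sum (x : nat + nat) : Z :=
  match x with inl n => Z.of_nat n | inr n => (- Z.of_nat (S n))%Z end.

Definition sum_of_Z (k : Z) : nat + nat :=
  if Z_le_dec 0 k then inl (Z.to_nat k) else inr (Z.to_nat (- k - 1)).

Lemma Z_of_sum_of_Z k : Z_of_sum (sum_of_Z k) = k.
Proof. unfold sum_of_Z. destruct (Z_le_dec 0 k); unfold Z_of_sum; lia. Qed.

Lemma sum_of_Z_of_sum x : sum_of_Z (Z_of_sum x) = x.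
Proof.
  unfold sum_of_Z, Z_of_sum.
  destruct x as [n|n]; destruct (Z_le_dec _ _); try lia; f_equal; lia.
Qed.

Lemma hasSum_Z_of_halves (f : Z -> C) s t :
  hasSum (fun n : nat => f (Z.of_nat n)) s -> hasSum (fun n : nat => f (- Z.of_nat (S n))%Z) t ->
  hasSum f (s + t).
Proof.
  intros Hs Ht.
  pose proof (hasSum_union (fun x => f (Z_of_sum x)) s t Hs Ht) as H.
  apply (hasSum_reindex sum_of_Z Z_of_sum) in H.
  - revert H. apply hasSum_ext. intros k. rewrite Z_of_sum_of_Z. reflexivity.
  - apply sum_of_Z_of_sum.
  - apply Z_of_sum_of_Z.
Qed.

Lemma hasSum_halves_of_Z (f : Z -> C) (a : Z -> R) s :
  (forall n, (Cmod (f n) <= a n)%R) -> summable a -> hasSum f s ->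
  hasSum (fun n : nat => f (Z.of_nat n)) (CSeries (fun n : nat => f (Z.of_nat n))) /\
  hasSum (fun n : nat => f (- Z.of_nat (S n))%Z) (CSeries (fun n : nat => f (- Z.of_nat (S n))%Z)).
Proof.
  intros Hf Ha H. split.
  - destruct (hasSum_ex (fun n : nat => f (Z.of_nat n)) (fun n => a (Z.of_nat n))) as [t Ht]; auto.
    { apply (summable_inj Z.of_nat); [intros; lia|exact Ha]. }
    rewrite (hasSum_CSeries _ _ Ht). exact Ht.
  - destruct (hasSum_ex (fun n : nat => f (- Z.of_nat (S n))%Z) (fun n => a (- Z.of_nat (S n))%Z)) as [t Ht]; auto.
    { apply (summable_inj (fun n => (- Z.of_nat (S n))%Z)); [intros; lia|exact Ha]. }
    rewrite (hasSum_CSeries _ _ Ht). exact Ht.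
Qed.

Lemma hasSum_CSeriesZ (f : Z -> C) (a : Z -> R) :
  (forall n, (Cmod (f n) <= a n)%R) -> summable a -> hasSum f (CSeriesZ f).
Proof.
  intros Hf Ha. destruct (hasSum_ex f a Hf Ha) as [s Hs].
  destruct (hasSum_halves_of_Z f a s Hf Ha Hs) as [H1 H2].
  exact (hasSum_Z_of_halves _ _ _ H1 H2).
Qed.

Definition Zint (N : nat) : list Z := map (fun k => (Z.of_nat k - Z.of_nat N)%Z) (seq 0 (2 * N + 1)).

Lemma Zint_NoDup N : NoDup (Zint N).
Proof. apply Injective_map_NoDup; [intros x y; lia|apply seq_NoDup]. Qed.

Lemma Zint_In N k : In k (Zint N) <-> (Z.abs k <= Z.of_nat N)%Z.
Proof.
  unfold Zint. rewrite in_map_iff. split.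
  - intros [x [E H]]. apply in_seq in H. lia.
  - intros H. exists (Z.to_nat (k + Z.of_nat N)). split; [lia|apply in_seq; lia].
Qed.

Lemma Zint_cover (L : list Z) : exists N, forall M, (N <= M)%nat -> incl L (Zint M).
Proof.
  induction L as [|k L [N HN]]; [exists 0%nat; intros M _ n []|].
  exists (Nat.max (Z.to_nat (Z.abs k)) N). intros M HM n [->|H].
  - apply Zint_In. lia.
  - apply (HN M); [lia|exact H].
Qed.

Lemma hasSum_Zint (f : Z -> C) s : hasSum f s ->
  forall eps, (0 < eps)%R -> exists N, forall n, (N <= n)%nat -> (Cmod (Csum f (Zint n) - s) < eps)%R.
Proof.
  intros H eps He. destruct (H eps He) as [L0 H0]. destruct (Zint_cover L0) as [N HN].
  exists N. intros n Hn. apply H0; [apply Zint_NoDup|apply HN, Hn].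
Qed.

Lemma Zint_S_split N : Zint (S N) =
  (- Z.of_nat (S N))%Z :: Zint N ++ (Z.of_nat (S N) :: nil).
Proof.
  unfold Zint. replace (2 * S N + 1)%nat with (S (2 * N + 1 + 1)) by lia.
  cbn [seq map]. f_equal.
  rewrite seq_app, map_app. f_equal.
  - rewrite <- seq_shift, map_map. apply map_ext. intros k; lia.
  - simpl seq. cbn [map]. f_equal. lia.
Qed.

Lemma Csum_Zint_S (f : Z -> C) N : Csum f (Zint (S N)) =
  Csum f (Zint N) + (f (Z.of_nat (S N)) + f (- Z.of_nat (S N))%Z).
Proof. rewrite (Zint_S_split N). cbn [Csum]. rewrite Csum_app. cbn [Csum]. ring. Qed.

Lemma hasSum_mod3 (f : Z -> C) a b c :
  hasSum (fun n => f (3 * n)%Z) a -> hasSum (fun n => f (3 * n + 1)%Z) b ->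
  hasSum (fun n => f (3 * n + 2)%Z) c -> hasSum f (a + (b + c)).
Proof.
  intros Ha Hb Hc.
  pose (g := fun x : Z + (Z + Z) => match x with
     inl n => (3 * n)%Z | inr (inl n) => (3 * n + 1)%Z | inr (inr n) => (3 * n + 2)%Z end).
  pose (h := fun k : Z => let n := (k / 3)%Z in
     if Z.eq_dec (k mod 3) 0 then @inl Z (Z + Z) n else
     if Z.eq_dec (k mod 3) 1 then inr (inl n) else inr (inr n)).
  pose proof (hasSum_union (fun x => f (g x)) a (b + c) Ha
    (hasSum_union (fun y => f (g (inr y))) b c Hb Hc)) as H.
  assert (E1 : forall k, g (h k) = k).
  { intros k. unfold h. pose proof (Z.div_mod k 3 ltac:(lia)). pose proof (Z.mod_pos_bound k 3 ltac:(lia)).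
    destruct (Z.eq_dec (k mod 3) 0); [unfold g; lia|].
    destruct (Z.eq_dec (k mod 3) 1); unfold g; lia. }
  assert (E2 : forall x, h (g x) = x).
  { intros [n|[n|n]]; unfold h, g.
    - rewrite (Z.mul_comm 3 n), Z_mod_mult, Z_div_mult by lia. reflexivity.
    - rewrite (Z.mul_comm 3 n), Z.add_comm, Z_mod_plus_full, Z_div_plus_full by lia. simpl. f_equal.
    - rewrite (Z.mul_comm 3 n), Z.add_comm, Z_mod_plus_full, Z_div_plus_full by lia. simpl. f_equal. }
  apply (hasSum_reindex h g) in H; auto.
  revert H. apply hasSum_ext. intros k. rewrite E1. reflexivity.
Qed.

(** The common majorant of all the theta-like series below. *)
Definition Zexp (n : Z) : R := exp (- Rabs (IZR n)).

Lemma Zexp_pos n : (0 <= Zexp n)%R.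
Proof. apply Rlt_le, exp_pos. Qed.

Lemma summable_Zexp : summable Zexp.
Proof.
  exists (4)%R. intros L N. destruct (Zint_cover L) as [M HM]. specialize (HM M (le_n M)).
  eapply Rle_trans; [apply (Rsum_incl Zexp L (Zint M) Zexp_pos N HM)|].
  assert (E1 : (exp (-1) <= 1/2)%R).
  { replace (exp (-1)) with (/ exp 1)%R by (rewrite <- exp_Ropp; f_equal; lra). assert (2 < exp 1)%R.
    { pose proof (exp_ineq1 1 ltac:(lra)). lra. }
    apply Rle_trans with (/ 2)%R; [apply Rinv_le_contravar; lra|lra]. }
  assert (H : (Rsum Zexp (Zint M) <= 4 - 2 * exp (- INR M))%R).
  { clear HM. induction M as [|M IH].
    - unfold Zint; simpl. unfold Zexp. simpl. rewrite Rabs_R0, Ropp_0, exp_0. lra.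
    - rewrite (Zint_S_split M). cbn [Rsum]. rewrite Rsum_app.
      cbn [Rsum]. unfold Zexp at 1 3. rewrite opp_IZR, Rabs_Ropp, <- INR_IZR_INZ.
      rewrite Rabs_pos_eq by apply pos_INR.
      rewrite S_INR. replace (- (INR M + 1))%R with (- INR M + -1)%R by ring.
      rewrite exp_plus. pose proof (exp_pos (- INR M)). nra. }
  pose proof (exp_pos (- INR M)). lra.
Qed.

(** A Gaussian beats any exponential: complete the square in the exponent. *)
Lemma gauss_le (a b t : R) : (0 < a)%R ->
  (exp (- a * t ^ 2 + b * Rabs t) <= exp ((b + 1) ^ 2 / (4 * a)) * exp (- Rabs t))%R.
Proof.
  intros Ha. rewrite <- exp_plus.
  assert (E : (- a * t ^ 2 + b * Rabs t <= (b + 1) ^ 2 / (4 * a) + - Rabs t)%R).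
  { replace (t ^ 2)%R with (Rabs t ^ 2)%R by apply pow2_abs.
    set (v := Rabs t).
    assert (0 <= (2 * a * v - (b + 1)) ^ 2 / (4 * a))%R.
    { apply Rdiv_le_0_compat; [apply pow2_ge_0|lra]. }
    replace ((2 * a * v - (b + 1)) ^ 2 / (4 * a))%R with
      (a * v ^ 2 - (b + 1) * v + (b + 1) ^ 2 / (4 * a))%R in H by (field; lra). lra. }
  destruct E as [E|E]; [left; apply exp_increasing, E|right; rewrite E; reflexivity].
Qed.

Lemma gauss_Zexp (a b : R) (n : Z) : (0 < a)%R ->
  (exp (- a * IZR n ^ 2 + b * Rabs (IZR n)) <= exp ((b + 1) ^ 2 / (4 * a)) * Zexp n)%R.
Proof. apply gauss_le. Qed.

Lemma exp_le x y : (x <= y)%R -> (exp x <= exp y)%R.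
Proof. intros [H|H]; [left; apply exp_increasing, H|right; rewrite H; reflexivity]. Qed.

(** In this form a bound on the exponent is all that has to be checked to dominate a theta series. *)
Lemma gauss_majorant (a b c : R) : (0 < a)%R -> exists K, (0 <= K)%R /\ forall n E,
  (E <= c - a * IZR n ^ 2 + b * Rabs (IZR n))%R -> (exp E <= K * Zexp n)%R.
Proof.
  intros Ha. exists (exp c * exp ((b + 1) ^ 2 / (4 * a)))%R.
  split; [apply Rmult_le_pos; apply Rlt_le, exp_pos|]. intros n E HE.
  apply Rle_trans with (exp (c + (- a * IZR n ^ 2 + b * Rabs (IZR n)))); [apply exp_le; lra|].
  rewrite exp_plus, (Rmult_assoc (exp c)). apply Rmult_le_compat_l; [apply Rlt_le, exp_pos|apply gauss_Zexp, Ha].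
Qed.

Lemma gauss_majorant2 (a c : R) : (0 < a)%R -> exists K, (0 <= K)%R /\ forall m n E,
  (E <= c - a * (IZR m ^ 2 + IZR n ^ 2))%R -> (exp E <= K * (Zexp m * Zexp n))%R.
Proof.
  intros Ha. destruct (gauss_majorant a 0 c Ha) as [K1 [H1 G1]]. destruct (gauss_majorant a 0 0 Ha) as [K2 [H2 G2]].
  exists (K1 * K2)%R. split; [apply Rmult_le_pos; assumption|]. intros m n E HE.
  apply Rle_trans with (exp ((c - a * IZR m ^ 2) + - (a * IZR n ^ 2))); [apply exp_le; lra|].
  rewrite exp_plus. replace (K1 * K2 * (Zexp m * Zexp n))%R with (K1 * Zexp m * (K2 * Zexp n))%R by ring.
  apply Rmult_le_compat; try (apply Rlt_le, exp_pos); [apply G1|apply G2]; lra.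
Qed.

Lemma summable_Zexp2 : summable (fun mn : Z * Z => Zexp (fst mn) * Zexp (snd mn))%R.
Proof. apply summable_prod; try apply Zexp_pos; apply summable_Zexp. Qed.

Lemma Rabs_le_exp t : (Rabs t <= exp (Rabs t))%R.
Proof.
  destruct (Req_dec (Rabs t) 0) as [->|H]; [rewrite exp_0; lra|].
  pose proof (exp_ineq1 (Rabs t) H). lra.
Qed.

End SumsZ.

(** * Dominated tails *)

Section Calculus.
Local Open Scope C_scope.

Lemma incl_Permutation {I} (L L' : list I) : NoDup L -> incl L L' -> exists K, Permutation L' (L ++ K).
Proof.
  intros N. revert L'. induction N as [|x L Hx N IH]; intros L' H.
  - exists L'. reflexivity.
  - destruct (in_split x L') as [l1 [l2 E]]; [apply H; left; reflexivity|]. subst.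
    destruct (IH (l1 ++ l2)) as [K HK].
    + intros y Hy. assert (Hy' : In y (l1 ++ x :: l2)) by (apply H; right; exact Hy).
      apply in_app_iff in Hy'. apply in_app_iff. destruct Hy' as [?|[?|?]]; auto. subst; contradiction.
    + exists K. rewrite <- Permutation_middle. simpl. apply perm_skip, HK.
Qed.

Lemma Csum_perm {I} (f : I -> C) L L' : Permutation L L' -> Csum f L = Csum f L'.
Proof.
  induction 1; simpl; [reflexivity|rewrite IHPermutation; reflexivity|ring|congruence].
Qed.

Lemma Rsum_perm {I} (f : I -> R) L L' : Permutation L L' -> Rsum f L = Rsum f L'.
Proof.
  induction 1; simpl; [reflexivity|rewrite IHPermutation; reflexivity|ring|congruence].
Qed.

(** One finite set serves all families below a given majorant; this uniformity is what permits
    termwise integration and differentiation. *)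
Lemma summable_tail {I} (a : I -> R) : summable a -> forall eps, (0 < eps)%R ->
  exists L0, forall L, NoDup L -> incl L0 L ->
  forall (f : I -> C) s, (forall i, (Cmod (f i) <= a i)%R) -> hasSum f s ->
  (Cmod (Csum f L - s) <= eps)%R.
Proof.
  intros [M HM] eps He.
  destruct (classic (forall i, (0 <= a i)%R)) as [Ha|Ha].
  2:{ exists nil. intros L N _ f s Hf _. exfalso. apply Ha. intros i.
      eapply Rle_trans; [apply Cmod_ge_0|apply (Hf i)]. }
  destruct (completeness (fun v => exists L, NoDup L /\ v = Rsum a L)) as [S [U V]].
  { exists M. intros v [L [N E]]. subst. auto. }
  { exists (Rsum a nil). exists nil. split; [constructor|reflexivity]. }
  assert (H : exists L, NoDup L /\ (S - eps < Rsum a L)%R).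
  { apply NNPP. intros Hn. apply (Rlt_irrefl S). apply Rle_lt_trans with (S - eps)%R; [|lra].
    apply V. intros v [L [N E]]. subst. apply Rnot_lt_le. intros H. apply Hn. exists L; auto. }
  destruct H as [L0 [N0 H0]]. exists L0. intros L N HL f s Hf Hs.
  apply le_epsilon. intros d Hd. destruct (Hs d Hd) as [L1 H1].
  destruct (NoDup_cover (L ++ L1)) as [L' [N' HL']].
  specialize (H1 L' N' (fun x h => HL' x (in_or_app _ _ _ (or_intror h)))).
  destruct (incl_Permutation L L' N (fun x h => HL' x (in_or_app _ _ _ (or_introl h)))) as [K HK].
  assert (E : Csum f L - s = (Csum f L' - s) - Csum f K).
  { rewrite (Csum_perm f _ _ HK), Csum_app. ring. }
  rewrite E. unfold Cminus at 1. eapply Rle_trans; [apply Cmod_triangle|]. rewrite Cmod_opp.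
  assert (HKb : (Cmod (Csum f K) <= eps)%R).
  { eapply Rle_trans; [apply Cmod_Csum_le|]. eapply Rle_trans; [apply Rsum_le; intros i _; apply Hf|].
    pose proof (Rsum_perm a _ _ HK) as E'. rewrite Rsum_app in E'.
    assert (Rsum a L' <= S)%R by (apply U; exists L'; auto).
    pose proof (Rsum_incl a L0 L Ha N0 HL). change (Rsum (fun i => a i) K) with (Rsum a K). lra. }
  lra.
Qed.

(** * The complex exponential *)

Lemma Cexp_plus z w : Cexp (z + w) = Cexp z * Cexp w.
Proof.
  unfold Cexp. destruct z as [a b], w as [c d].
  unfold Cplus, Cmult, RtoC, Re, Im; simpl. rewrite exp_plus, cos_plus, sin_plus. f_equal; ring.
Qed.

Lemma Cexp_0 : Cexp 0 = 1.
Proof. unfold Cexp, Cmult, RtoC, Re, Im; simpl. rewrite exp_0, cos_0, sin_0. f_equal; ring. Qed.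

Lemma Cmod_Cexp z : Cmod (Cexp z) = exp (Re z).
Proof.
  unfold Cexp. rewrite Cmod_mult, Cmod_R, Rabs_pos_eq by apply Rlt_le, exp_pos.
  replace (Cmod (cos (Im z), sin (Im z))) with 1%R; [ring|].
  transitivity (sqrt 1); [symmetry; apply sqrt_1|]. unfold Cmod; simpl fst; simpl snd. f_equal.
  rewrite <- (sin2_cos2 (Im z)). unfold Rsqr. ring.
Qed.

Lemma Cexp_neq_0 z : Cexp z <> 0.
Proof. apply Cmod_gt_0. rewrite Cmod_Cexp. apply exp_pos. Qed.

Lemma Cexp_opp z : Cexp (- z) = / Cexp z.
Proof.
  pose proof (Cexp_neq_0 z) as H. pose proof (Cexp_plus (- z) z) as E.
  replace (- z + z) with (RtoC 0) in E by ring. rewrite Cexp_0 in E.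
  replace (Cexp (- z)) with (Cexp (- z) * Cexp z * / Cexp z) by (field; exact H).
  rewrite <- E. ring.
Qed.

Lemma Cexp_Rmult_i t : Cexp (RtoC t * Ci) = (cos t, sin t).
Proof.
  unfold Cexp, Ci, Cmult, RtoC, Re, Im; simpl.
  replace (t * 0 - 0 * 1)%R with 0%R by ring. replace (t * 1 + 0 * 0)%R with t by ring.
  rewrite exp_0. f_equal; ring.
Qed.

Lemma Cexp_real t : Cexp (RtoC t) = RtoC (exp t).
Proof.
  unfold Cexp, Cmult, RtoC, Re, Im; simpl. rewrite cos_0, sin_0. f_equal; ring.
Qed.

Definition sgnZ (n : Z) : C := if Z.even n then 1 else -1.

Lemma sgnZ_plus m n : sgnZ (m + n) = sgnZ m * sgnZ n.
Proof.
  unfold sgnZ. rewrite Z.even_add. destruct (Z.even m), (Z.even n); simpl; ring.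
Qed.

Lemma sgnZ_opp n : sgnZ (- n) = sgnZ n.
Proof. unfold sgnZ. rewrite Z.even_opp. reflexivity. Qed.

Lemma sgnZ_sq n : sgnZ n * sgnZ n = 1.
Proof. unfold sgnZ; destruct (Z.even n); ring. Qed.

Lemma sgnZ_1 : sgnZ 1 = -1.
Proof. reflexivity. Qed.

Lemma Cmod_sgnZ n : Cmod (sgnZ n) = 1%R.
Proof. unfold sgnZ; destruct (Z.even n); [apply Cmod_1|]. rewrite <- Cmod_opp. replace (- -1) with (RtoC 1) by ring. apply Cmod_1. Qed.

Lemma Cexp_pi_i_nat (n : nat) : Cexp (RtoC PI * Ci * RtoC (INR n)) = sgnZ (Z.of_nat n).
Proof.
  induction n as [|n IH].
  - simpl. replace (RtoC PI * Ci * 0) with (RtoC 0) by ring. apply Cexp_0.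
  - rewrite S_INR, RtoC_plus, Nat2Z.inj_succ. unfold Z.succ. rewrite sgnZ_plus, <- IH, sgnZ_1.
    replace (RtoC PI * Ci * (RtoC (INR n) + 1)) with (RtoC PI * Ci * RtoC (INR n) + RtoC PI * Ci) by ring.
    rewrite Cexp_plus. f_equal. rewrite Cexp_Rmult_i, cos_PI, sin_PI. reflexivity.
Qed.

Lemma Cexp_pi_i (n : Z) : Cexp (RtoC PI * Ci * RtoC (IZR n)) = sgnZ n.
Proof.
  destruct (Z_le_dec 0 n) as [H|H].
  - rewrite <- (Z2Nat.id n H), <- INR_IZR_INZ. apply Cexp_pi_i_nat.
  - replace n with (- Z.of_nat (Z.to_nat (- n)))%Z by lia.
    rewrite sgnZ_opp, <- Cexp_pi_i_nat, opp_IZR, <- INR_IZR_INZ, RtoC_opp.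
    replace (RtoC PI * Ci * - RtoC (INR (Z.to_nat (- n)))) with
      (- (RtoC PI * Ci * RtoC (INR (Z.to_nat (- n))))) by ring.
    rewrite Cexp_opp, Cexp_pi_i_nat.
    pose proof (sgnZ_sq (Z.of_nat (Z.to_nat (- n)))) as E.
    unfold sgnZ in *. destruct (Z.even _); field; intros Hc; injection Hc; lra.
Qed.

Lemma Cexp_2pi_i (n : Z) : Cexp (2 * RtoC PI * Ci * RtoC (IZR n)) = 1.
Proof.
  replace (2 * RtoC PI * Ci * RtoC (IZR n)) with (RtoC PI * Ci * RtoC (IZR (2 * n))).
  - rewrite Cexp_pi_i. unfold sgnZ. rewrite Z.even_mul. reflexivity.
  - rewrite mult_IZR, RtoC_mult. ring.
Qed.

(** * Derivatives and integrals of complex functions of a real variable *)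

(** Derivatives, continuity and integrals are taken componentwise, which reduces them to the real
    theory. *)
Definition isD (f : R -> C) (t : R) (l : C) : Prop :=
  derivable_pt_lim (fun s => Re (f s)) t (Re l) /\ derivable_pt_lim (fun s => Im (f s)) t (Im l).

Definition contC (f : R -> C) (t : R) : Prop :=
  continuity_pt (fun s => Re (f s)) t /\ continuity_pt (fun s => Im (f s)) t.

Definition isInt (f : R -> C) (a b : R) (l : C) : Prop :=
  is_RInt (fun t => Re (f t)) a b (Re l) /\ is_RInt (fun t => Im (f t)) a b (Im l).

Lemma isD_contC f t l : isD f t l -> contC f t.
Proof.
  intros [H1 H2]. split; apply derivable_continuous_pt; [exists (Re l)|exists (Im l)]; assumption.
Qed.

Lemma isD_const c t : isD (fun _ => c) t 0.
Proof. split; apply derivable_pt_lim_const. Qed.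

Lemma isD_RtoC t : isD RtoC t 1.
Proof. split; [apply derivable_pt_lim_id|apply (derivable_pt_lim_const 0)]. Qed.

Lemma isD_plus f g t l m : isD f t l -> isD g t m -> isD (fun s => f s + g s) t (l + m).
Proof.
  intros [H1 H2] [H3 H4]. split.
  - apply (derivable_pt_lim_plus (fun s => Re (f s)) (fun s => Re (g s))); assumption.
  - apply (derivable_pt_lim_plus (fun s => Im (f s)) (fun s => Im (g s))); assumption.
Qed.

Lemma isD_mult f g t l m : isD f t l -> isD g t m -> isD (fun s => f s * g s) t (l * g t + f t * m).
Proof.
  intros [H1 H2] [H3 H4]. split.
  - replace (Re (l * g t + f t * m)) with
      ((Re l * Re (g t) + Re (f t) * Re m) - (Im l * Im (g t) + Im (f t) * Im m))%R
      by (unfold Cplus, Cmult, Re, Im; simpl; ring).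
    apply (derivable_pt_lim_minus (fun s => Re (f s) * Re (g s))%R (fun s => Im (f s) * Im (g s))%R).
    + apply (derivable_pt_lim_mult (fun s => Re (f s)) (fun s => Re (g s))); assumption.
    + apply (derivable_pt_lim_mult (fun s => Im (f s)) (fun s => Im (g s))); assumption.
  - replace (Im (l * g t + f t * m)) with
      ((Re l * Im (g t) + Re (f t) * Im m) + (Im l * Re (g t) + Im (f t) * Re m))%R
      by (unfold Cplus, Cmult, Re, Im; simpl; ring).
    apply (derivable_pt_lim_plus (fun s => Re (f s) * Im (g s))%R (fun s => Im (f s) * Re (g s))%R).
    + apply (derivable_pt_lim_mult (fun s => Re (f s)) (fun s => Im (g s))); assumption.
    + apply (derivable_pt_lim_mult (fun s => Im (f s)) (fun s => Re (g s))); assumption.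
Qed.

Lemma isD_eq f t l m : isD f t l -> l = m -> isD f t m.
Proof. intros H <-. exact H. Qed.

Lemma isD_ext f g t l : (forall s, f s = g s) -> isD f t l -> isD g t l.
Proof. intros E H. replace g with f; [exact H|]. apply functional_extensionality, E. Qed.

Lemma isD_scal c f t l : isD f t l -> isD (fun s => c * f s) t (c * l).
Proof.
  intros H. eapply isD_eq; [apply (isD_mult (fun _ => c) f t 0 l); [apply isD_const|exact H]|]. ring.
Qed.

Lemma isD_Cexp f t l : isD f t l -> isD (fun s => Cexp (f s)) t (l * Cexp (f t)).
Proof.
  intros [H1 H2].
  assert (E : derivable_pt_lim (fun s => exp (Re (f s))) t (exp (Re (f t)) * Re l)%R).
  { apply (derivable_pt_lim_comp (fun s => Re (f s)) exp); [exact H1|apply derivable_pt_lim_exp]. }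
  assert (Cs : derivable_pt_lim (fun s => cos (Im (f s))) t (- sin (Im (f t)) * Im l)%R).
  { apply (derivable_pt_lim_comp (fun s => Im (f s)) cos); [exact H2|apply derivable_pt_lim_cos]. }
  assert (Sn : derivable_pt_lim (fun s => sin (Im (f s))) t (cos (Im (f t)) * Im l)%R).
  { apply (derivable_pt_lim_comp (fun s => Im (f s)) sin); [exact H2|apply derivable_pt_lim_sin]. }
  split.
  - replace (fun s => Re (Cexp (f s))) with (fun s => exp (Re (f s)) * cos (Im (f s)))%R.
    2:{ apply functional_extensionality; intros s. unfold Cexp, Cmult, RtoC, Re, Im; simpl. ring. }
    replace (Re (l * Cexp (f t))) with
      (exp (Re (f t)) * Re l * cos (Im (f t)) + exp (Re (f t)) * (- sin (Im (f t)) * Im l))%R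
      by (unfold Cexp, Cmult, RtoC, Re, Im; simpl; ring).
    apply (derivable_pt_lim_mult (fun s => exp (Re (f s))) (fun s => cos (Im (f s)))); assumption.
  - replace (fun s => Im (Cexp (f s))) with (fun s => exp (Re (f s)) * sin (Im (f s)))%R.
    2:{ apply functional_extensionality; intros s. unfold Cexp, Cmult, RtoC, Re, Im; simpl. ring. }
    replace (Im (l * Cexp (f t))) with
      (exp (Re (f t)) * Re l * sin (Im (f t)) + exp (Re (f t)) * (cos (Im (f t)) * Im l))%R
      by (unfold Cexp, Cmult, RtoC, Re, Im; simpl; ring).
    apply (derivable_pt_lim_mult (fun s => exp (Re (f s))) (fun s => sin (Im (f s)))); assumption.
Qed.

Lemma contC_mult f g t : contC f t -> contC g t -> contC (fun s => f s * g s) t.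
Proof.
  intros [H1 H2] [H3 H4]. split.
  - apply (continuity_pt_minus (fun s => Re (f s) * Re (g s))%R (fun s => Im (f s) * Im (g s))%R).
    + apply (continuity_pt_mult (fun s => Re (f s)) (fun s => Re (g s))); assumption.
    + apply (continuity_pt_mult (fun s => Im (f s)) (fun s => Im (g s))); assumption.
  - apply (continuity_pt_plus (fun s => Re (f s) * Im (g s))%R (fun s => Im (f s) * Re (g s))%R).
    + apply (continuity_pt_mult (fun s => Re (f s)) (fun s => Im (g s))); assumption.
    + apply (continuity_pt_mult (fun s => Im (f s)) (fun s => Re (g s))); assumption.
Qed.

Lemma isInt_unique f a b l m : isInt f a b l -> isInt f a b m -> l = m.
Proof.
  intros [H1 H2] [H3 H4].
  pose proof (is_RInt_unique (V := R_CompleteNormedModule) _ _ _ _ H1) as E1.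
  pose proof (is_RInt_unique (V := R_CompleteNormedModule) _ _ _ _ H2) as E2.
  rewrite (is_RInt_unique (V := R_CompleteNormedModule) _ _ _ _ H3) in E1.
  rewrite (is_RInt_unique (V := R_CompleteNormedModule) _ _ _ _ H4) in E2.
  destruct l, m. unfold Re, Im in *; simpl in *. congruence.
Qed.

Lemma isInt_ex f a b : (a <= b)%R -> (forall t, (a <= t <= b)%R -> contC f t) -> exists l, isInt f a b l.
Proof.
  intros Hab H.
  destruct (ex_RInt_continuous (V := R_CompleteNormedModule) (fun t => Re (f t)) a b) as [l1 H1].
  { intros t Ht. rewrite Rmin_left, Rmax_right in Ht by lra. apply continuity_pt_filterlim, (H t Ht). }
  destruct (ex_RInt_continuous (V := R_CompleteNormedModule) (fun t => Im (f t)) a b) as [l2 H2].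
  { intros t Ht. rewrite Rmin_left, Rmax_right in Ht by lra. apply continuity_pt_filterlim, (H t Ht). }
  exists (l1, l2). split; assumption.
Qed.

Lemma isInt_ext f g a b l : (forall t, f t = g t) -> isInt f a b l -> isInt g a b l.
Proof. intros E H. replace g with f; [exact H|]. apply functional_extensionality, E. Qed.

Lemma isInt_ext_on f g a b l : (a <= b)%R -> (forall t, (a <= t <= b)%R -> f t = g t) -> isInt f a b l -> isInt g a b l.
Proof.
  intros Hab E [H1 H2]. split.
  - revert H1. apply is_RInt_ext. intros t Ht. rewrite Rmin_left, Rmax_right in Ht by lra. rewrite E by lra. reflexivity.
  - revert H2. apply is_RInt_ext. intros t Ht. rewrite Rmin_left, Rmax_right in Ht by lra. rewrite E by lra. reflexivity.
Qed.

Lemma isInt_plus f g a b l m : isInt f a b l -> isInt g a b m -> isInt (fun t => f t + g t) a b (l + m).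
Proof.
  intros [H1 H2] [H3 H4]. split.
  - apply (is_RInt_plus (V := R_NormedModule)); assumption.
  - apply (is_RInt_plus (V := R_NormedModule)); assumption.
Qed.

Lemma isInt_scal c f a b l : isInt f a b l -> isInt (fun t => c * f t) a b (c * l).
Proof.
  intros [H1 H2]. split.
  - apply (is_RInt_minus (V := R_NormedModule) (fun t => Re c * Re (f t))%R (fun t => Im c * Im (f t))%R);
    apply (is_RInt_scal (V := R_NormedModule)); assumption.
  - apply (is_RInt_plus (V := R_NormedModule) (fun t => Re c * Im (f t))%R (fun t => Im c * Re (f t))%R);
    apply (is_RInt_scal (V := R_NormedModule)); assumption.
Qed.

Lemma isInt_zero a b : isInt (fun _ => 0) a b 0.
Proof.
  assert (H : is_RInt (fun _ : R => 0%R) a b 0%R).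
  { pose proof (is_RInt_const (V := R_NormedModule) a b 0%R) as H.
    unfold scal in H; simpl in H; unfold mult in H; simpl in H. rewrite Rmult_0_r in H. exact H. }
  split; exact H.
Qed.

Lemma isInt_Csum {I} (f : I -> R -> C) (l : I -> C) a b L :
  (forall i, isInt (f i) a b (l i)) -> isInt (fun t => Csum (fun i => f i t) L) a b (Csum l L).
Proof.
  intros H. induction L as [|i L IH]; simpl; [apply isInt_zero|apply isInt_plus; auto].
Qed.

Lemma isInt_Chasles f a b c l m : isInt f a b l -> isInt f b c m -> isInt f a c (l + m).
Proof.
  intros [H1 H2] [H3 H4]. split.
  - apply (is_RInt_Chasles (V := R_NormedModule) _ a b c); assumption.
  - apply (is_RInt_Chasles (V := R_NormedModule) _ a b c); assumption.
Qed.

Lemma isInt_shift f a b c l : isInt f (a + c) (b + c) l -> isInt (fun t => f (t + c)%R) a b l.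
Proof.
  assert (G : forall (h : R -> R) l, is_RInt h (a + c) (b + c) l -> is_RInt (fun t => h (t + c)%R) a b l).
  { intros h l0 H.
    pose proof (is_RInt_comp_lin (V := R_NormedModule) h 1 c a b l0) as H'. rewrite !Rmult_1_l in H'.
    specialize (H' H). revert H'. apply is_RInt_ext. intros t _. unfold scal; simpl; unfold mult; simpl.
    rewrite !Rmult_1_l. reflexivity. }
  intros [H1 H2]. split; [apply (G (fun t => Re (f t)))|apply (G (fun t => Im (f t)))]; assumption.
Qed.

Lemma isInt_FTC F f a b : (a <= b)%R -> (forall t, (a <= t <= b)%R -> isD F t (f t)) ->
  (forall t, (a <= t <= b)%R -> contC f t) -> isInt f a b (F b - F a).
Proof.
  intros Hab HD HC. split.
  - apply (is_RInt_derive (V := R_CompleteNormedModule) (fun t => Re (F t)) (fun t => Re (f t)));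
    intros t Ht; rewrite Rmin_left, Rmax_right in Ht by lra.
    + apply is_derive_Reals, (HD t Ht).
    + apply continuity_pt_filterlim, (HC t Ht).
  - apply (is_RInt_derive (V := R_CompleteNormedModule) (fun t => Im (F t)) (fun t => Im (f t)));
    intros t Ht; rewrite Rmin_left, Rmax_right in Ht by lra.
    + apply is_derive_Reals, (HD t Ht).
    + apply continuity_pt_filterlim, (HC t Ht).
Qed.

(** The factor 2 comes from estimating the real and imaginary parts separately. *)
Lemma isInt_le f a b l M : (a <= b)%R -> (forall t, (a <= t <= b)%R -> (Cmod (f t) <= M)%R) ->
  isInt f a b l -> (Cmod l <= 2 * (b - a) * M)%R.
Proof.
  intros Hab HM [H1 H2].
  assert (A1 : (Rabs (Re l) <= (b - a) * M)%R).
  { rewrite <- (is_RInt_unique (V := R_CompleteNormedModule) _ _ _ _ H1). apply abs_RInt_le_const; [exact Hab|exists (Re l); exact H1|].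
    intros t Ht. eapply Rle_trans; [apply Rabs_Re_le_Cmod|auto]. }
  assert (A2 : (Rabs (Im l) <= (b - a) * M)%R).
  { rewrite <- (is_RInt_unique (V := R_CompleteNormedModule) _ _ _ _ H2). apply abs_RInt_le_const; [exact Hab|exists (Im l); exact H2|].
    intros t Ht. eapply Rle_trans; [apply Rabs_Im_le_Cmod|auto]. }
  pose proof (Cmod_le_Re_Im l). lra.
Qed.

(** * Dominated series of functions *)

Section Dominated.
Variables (f : Z -> R -> C) (F : R -> C) (a : Z -> R) (c : R) (r : posreal).
Hypothesis Hcont : forall n t, Boule c r t -> contC (f n) t.
Hypothesis Hdom : forall n t, Boule c r t -> (Cmod (f n t) <= a n)%R.
Hypothesis Hsum : summable a.
Hypothesis HF : forall t, Boule c r t -> hasSum (fun n => f n t) (F t).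

Lemma dominated_uniform eps : (0 < eps)%R -> exists N, forall n, (N <= n)%nat ->
  forall t, Boule c r t -> (Cmod (F t - Csum (fun k => f k t) (Zint n)) <= eps)%R.
Proof.
  intros He. destruct (summable_tail a Hsum eps He) as [L0 H0].
  destruct (Zint_cover L0) as [N HN]. exists N. intros n Hn t Ht.
  rewrite Cmod_sub_sym. apply H0; [apply Zint_NoDup|apply HN, Hn|intros i; apply Hdom, Ht|apply HF, Ht].
Qed.

Lemma contC_Csum L t : Boule c r t -> contC (fun s => Csum (fun k => f k s) L) t.
Proof.
  intros Ht. induction L as [|k L [I1 I2]].
  - split; apply continuity_pt_const; intros x y; reflexivity.
  - destruct (Hcont k t Ht) as [H1 H2]. split.
    + apply (continuity_pt_plus (fun s => Re (f k s)) (fun s => Re (Csum (fun k => f k s) L))); assumption.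
    + apply (continuity_pt_plus (fun s => Im (f k s)) (fun s => Im (Csum (fun k => f k s) L))); assumption.
Qed.

Lemma dominated_CVU :
  CVU (fun n t => Re (Csum (fun k => f k t) (Zint n))) (fun t => Re (F t)) c r /\
  CVU (fun n t => Im (Csum (fun k => f k t) (Zint n))) (fun t => Im (F t)) c r.
Proof.
  split; intros eps He; destruct (dominated_uniform (eps / 2)%R ltac:(lra)) as [N HN]; exists N;
  intros n t Hn Ht; specialize (HN n Hn t Ht).
  - pose proof (Rabs_Re_le_Cmod (F t - Csum (fun k => f k t) (Zint n))) as B.
    unfold Cminus, Cplus, Copp, Re in *; simpl in *. unfold Rminus. lra.
  - pose proof (Rabs_Im_le_Cmod (F t - Csum (fun k => f k t) (Zint n))) as B.
    unfold Cminus, Cplus, Copp, Im in *; simpl in *. unfold Rminus. lra.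
Qed.

Lemma dominated_contC t : Boule c r t -> contC F t.
Proof.
  destruct dominated_CVU as [H1 H2]. split.
  - apply (CVU_continuity _ _ _ _ H1); [|assumption]. intros n s Hs. apply contC_Csum, Hs.
  - apply (CVU_continuity _ _ _ _ H2); [|assumption]. intros n s Hs. apply contC_Csum, Hs.
Qed.

Lemma dominated_isInt (A B : R) (l : Z -> C) : (A <= B)%R ->
  (forall t, (A <= t <= B)%R -> Boule c r t) -> (forall n, isInt (f n) A B (l n)) ->
  exists S, isInt F A B S /\ hasSum l S.
Proof.
  intros HAB Hin Hl.
  destruct (isInt_ex F A B HAB) as [S HS]. { intros t Ht. apply dominated_contC, Hin, Ht. }
  exists S. split; [exact HS|].
  intros eps He.
  destruct (summable_tail a Hsum (eps / (4 * (B - A) + 4))%R) as [L0 H0].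
  { apply Rdiv_lt_0_compat; lra. }
  exists L0. intros L N HL.
  assert (E : isInt (fun t => Csum (fun n => f n t) L + (-1) * F t) A B (Csum l L + (-1) * S)).
  { apply isInt_plus; [apply isInt_Csum, Hl|apply isInt_scal, HS]. }
  replace (Csum l L - S) with (Csum l L + (-1) * S) by ring.
  eapply Rle_lt_trans.
  - eapply (isInt_le _ _ _ _ (eps / (4 * (B - A) + 4))%R HAB); [|exact E].
    intros t Ht. cbv beta. replace (Csum (fun n => f n t) L + (-1) * F t) with (Csum (fun n => f n t) L - F t) by ring.
    apply H0; [exact N|exact HL| |apply HF, Hin, Ht]. intros n; apply Hdom, Hin, Ht.
  - apply Rmult_lt_reg_r with (4 * (B - A) + 4)%R; [lra|].
    replace (2 * (B - A) * (eps / (4 * (B - A) + 4)) * (4 * (B - A) + 4))%R with (2 * (B - A) * eps)%R by (field; lra).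
    nra.
Qed.
End Dominated.

Lemma dominated_isD (f f' : Z -> R -> C) (F F' : R -> C) (a : Z -> R) (c : R) (r : posreal) t :
  (forall n s, Boule c r s -> isD (f n) s (f' n s)) ->
  (forall n s, Boule c r s -> (Cmod (f' n s) <= a n)%R) -> summable a ->
  (forall s, Boule c r s -> hasSum (fun n => f n s) (F s)) ->
  (forall s, Boule c r s -> hasSum (fun n => f' n s) (F' s)) ->
  Boule c r t -> isD F t (F' t).
Proof.
  intros HD Hdom Ha HF HF' Ht.
  destruct (dominated_CVU f' F' a c r Hdom Ha HF') as [U1 U2].
  assert (DS : forall L s, Boule c r s -> isD (fun s => Csum (fun k => f k s) L) s (Csum (fun k => f' k s) L)).
  { intros L s Hs. induction L as [|k L IH]; simpl; [apply isD_const|apply isD_plus; auto]. }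
  split.
  - apply (CVU_derivable (fun n s => Re (Csum (fun k => f k s) (Zint n))) _ (fun s => Re (F s)) (fun s => Re (F' s)) c r U1);
    [|intros n s Hs; apply (DS (Zint n) s Hs)|exact Ht].
    intros s Hs eps He. destruct (hasSum_Zint _ _ (HF s Hs) eps He) as [N HN].
    exists N. intros n Hn. eapply Rle_lt_trans; [|apply (HN n Hn)]. unfold Rdist.
    eapply Rle_trans; [|apply Rabs_Re_le_Cmod]. right. unfold Cminus, Cplus, Copp, Re; simpl. unfold Rminus. reflexivity.
  - apply (CVU_derivable (fun n s => Im (Csum (fun k => f k s) (Zint n))) _ (fun s => Im (F s)) (fun s => Im (F' s)) c r U2);
    [|intros n s Hs; apply (DS (Zint n) s Hs)|exact Ht].
    intros s Hs eps He. destruct (hasSum_Zint _ _ (HF s Hs) eps He) as [N HN].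
    exists N. intros n Hn. eapply Rle_lt_trans; [|apply (HN n Hn)]. unfold Rdist.
    eapply Rle_trans; [|apply Rabs_Im_le_Cmod]. right. unfold Cminus, Cplus, Copp, Im; simpl. unfold Rminus. reflexivity.
Qed.

End Calculus.

(** * Pointwise inversion of Fourier series *)

Section Fourier.
Local Open Scope R_scope.

(** The difference quotient at [0], completed by the value [l] of the derivative. *)
Definition dquot (g : R -> R) (l t : R) : R := if Req_EM_T t 0 then l else (g t - g 0) / t.

Lemma dquot_cont (g : R -> R) (l t : R) :
  derivable_pt_lim g 0 l -> continuity_pt g t -> continuity_pt (dquot g l) t.
Proof.
  intros Hl Hg. destruct (Req_dec t 0) as [->|Ht].
  - intros eps He. destruct (Hl eps He) as [d Hd]. exists d. split; [apply cond_pos|].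
    intros s [_ Hs]. simpl in *. unfold Rdist in *. unfold dquot.
    destruct (Req_EM_T 0 0) as [_|n]; [|exfalso; apply n; reflexivity].
    destruct (Req_EM_T s 0) as [->|n]; [rewrite Rminus_diag, Rabs_R0; exact He|].
    rewrite Rminus_0_r in Hs. specialize (Hd s n Hs). rewrite Rplus_0_l in Hd. exact Hd.
  - apply continuity_pt_ext_loc with (fun s => (g s - g 0) / s).
    + assert (Hp : 0 < Rabs t) by (apply Rabs_pos_lt, Ht). exists (mkposreal _ Hp).
      intros s Hs. unfold ball in Hs; simpl in Hs. unfold AbsRing_ball, abs, minus, plus, opp in Hs; simpl in Hs.
      unfold dquot. destruct (Req_EM_T s 0) as [->|n]; [|reflexivity].
      exfalso. rewrite Rplus_0_l, Rabs_Ropp in Hs. lra.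
    + apply (continuity_pt_div (fun s => g s - g 0) (fun s => s)); [|apply continuity_pt_id|exact Ht].
      apply (continuity_pt_minus g (fun _ => g 0)); [exact Hg|apply continuity_pt_const; intros x y; reflexivity].
Qed.

(** Riemann--Lebesgue. Translation by [h = 1 / (2 N + 1)], half a period, flips the sign of the
    oscillating factor; so twice the integral is the integral of [k t - k (t + h)] against it, small by uniform
    continuity, up to two end pieces of length [h]. *)
Lemma riemann_lebesgue (k : R -> R) : (forall t, Rabs t < 1 -> continuity_pt k t) ->
  forall eps, 0 < eps -> exists N0, forall N, (N0 <= N)%nat ->
  Rabs (RInt (fun t => k t * sin ((2 * INR N + 1) * PI * t)) (- (1/2)) (1/2)) < eps.
Proof.
  intros Hk eps He.
  assert (HkI : forall t, -1/2 <= t <= 5/6 -> continuity_pt k t).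
  { intros t Ht. apply Hk, Rabs_def1; lra. }
  destruct (Heine_cor2 HkI (mkposreal (eps / 2) ltac:(lra))) as [d Hd]. simpl in Hd.
  destruct (continuity_ab_maj (fun t => Rabs (k t)) (-1/2) (5/6)) as [tm [HM _]]; [lra| |].
  { intros c Hc. apply (continuity_pt_comp k Rabs); [apply HkI, Hc|apply Rcontinuity_abs]. }
  set (M := Rabs (k tm)) in *. assert (HM0 : 0 <= M) by apply Rabs_pos.
  destruct (INR_unbounded (1 / d + 4 * M / eps + 1)) as [N0 HN0].
  exists N0. intros N HN. apply le_INR in HN.
  assert (Hd0 : 0 < d) by apply cond_pos.
  assert (P1 : 0 < 1 / d) by (apply Rdiv_lt_0_compat; lra).
  assert (P2 : 0 <= 4 * M / eps) by (apply Rdiv_le_0_compat; lra).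
  set (Q := 2 * INR N + 1). assert (HQ : 0 < Q) by (unfold Q; lra).
  set (h := / Q). assert (Hh : 0 < h) by (apply Rinv_0_lt_compat, HQ).
  assert (HhQ : h * Q = 1) by (unfold h; field; lra).
  assert (Hh1 : h < d).
  { apply Rmult_lt_reg_r with Q; [exact HQ|]. rewrite HhQ.
    assert (d * (1 / d) = 1) by (field; lra). unfold Q. nra. }
  assert (Hh2 : h <= 1/3) by (unfold Q in *; nra).
  assert (Hh3 : 2 * (h * M) < eps / 2 * 2).
  { assert (eps * (4 * M / eps) = 4 * M) by (field; lra).
    apply Rmult_lt_reg_r with Q; [exact HQ|]. replace (2 * (h * M) * Q) with (2 * M * (h * Q)) by ring.
    rewrite HhQ. unfold Q. nra. }
  set (K := fun t => k t * sin (Q * PI * t)).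
  assert (HKc : forall t, -1/2 <= t <= 5/6 -> continuous K t).
  { intros t Ht. apply continuity_pt_filterlim.
    apply (continuity_pt_mult k (fun t => sin (Q * PI * t))); [apply HkI, Ht|].
    apply (continuity_pt_comp (fun t => Q * PI * t) sin); [|apply continuity_sin].
    apply derivable_continuous_pt. reg. }
  assert (EX : forall a b, -1/2 <= a -> a <= b -> b <= 5/6 -> ex_RInt K a b).
  { intros a b Ha Hab Hb. apply (ex_RInt_continuous (V := R_CompleteNormedModule)).
    intros t Ht. rewrite Rmin_left, Rmax_right in Ht by lra. apply HKc. lra. }
  assert (BK : forall a b, -1/2 <= a -> a <= b -> b <= 5/6 -> Rabs (RInt K a b) <= (b - a) * M).
  { intros a b Ha Hab Hb. apply abs_RInt_le_const; [exact Hab|apply EX; assumption|].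
    intros t Ht. unfold K. rewrite Rabs_mult. rewrite <- (Rmult_1_r M).
    apply Rmult_le_compat; try apply Rabs_pos; [apply HM; lra|].
    apply Rabs_le. pose proof (SIN_bound (Q * PI * t)). lra. }
  assert (SH : RInt K (-1/2 + h) (1/2 + h) = RInt (fun t => K (t + h)) (-1/2) (1/2)).
  { pose proof (RInt_comp_lin (V := R_CompleteNormedModule) K 1 h (-1/2) (1/2)) as E.
    rewrite !Rmult_1_l in E. rewrite <- E by (apply EX; lra).
    apply RInt_ext. intros t _. unfold scal; simpl; unfold mult; simpl. rewrite !Rmult_1_l. reflexivity. }
  assert (KH : forall t, K (t + h) = - (k (t + h) * sin (Q * PI * t))).
  { intros t. unfold K. replace (Q * PI * (t + h)) with (Q * PI * t + PI).
    - rewrite neg_sin. ring.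
    - replace PI with ((h * Q) * PI) at 2 by (rewrite HhQ; ring). ring. }
  assert (EXH : ex_RInt (fun t => K (t + h)) (-1/2) (1/2)).
  { pose proof (ex_RInt_comp_lin (V := R_NormedModule) K 1 h (-1/2) (1/2)) as E.
    rewrite !Rmult_1_l in E. eapply ex_RInt_ext; [|apply E, EX; lra].
    intros t _. unfold scal; simpl; unfold mult; simpl. rewrite !Rmult_1_l. reflexivity. }
  change (Rabs (RInt K (- (1/2)) (1/2)) < eps).
  replace (- (1/2)) with (-1/2) by lra.
  pose proof (RInt_Chasles (V := R_CompleteNormedModule) K (-1/2) (-1/2 + h) (1/2) ltac:(apply EX; lra) ltac:(apply EX; lra)) as C1.
  pose proof (RInt_Chasles (V := R_CompleteNormedModule) K (-1/2 + h) (1/2) (1/2 + h) ltac:(apply EX; lra) ltac:(apply EX; lra)) as C2.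
  unfold plus in C1, C2; simpl in C1, C2.
  pose proof (RInt_plus (V := R_CompleteNormedModule) K (fun t => K (t + h)) (-1/2) (1/2) ltac:(apply EX; lra) EXH) as C3.
  unfold plus in C3; simpl in C3.
  assert (B3 : Rabs (RInt (fun t => K t + K (t + h)) (-1/2) (1/2)) <= (1/2 - -1/2) * (eps / 2)).
  { apply abs_RInt_le_const; [lra|apply (ex_RInt_plus (V := R_NormedModule)); [apply EX; lra|exact EXH]|].
    intros t Ht. rewrite KH. unfold K.
    replace (k t * sin (Q * PI * t) + - (k (t + h) * sin (Q * PI * t))) with ((k t - k (t + h)) * sin (Q * PI * t)) by ring.
    rewrite Rabs_mult, <- (Rmult_1_r (eps / 2)). apply Rmult_le_compat; try apply Rabs_pos.
    - apply Rlt_le, Hd; try lra. apply Rabs_def1; lra.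
    - apply Rabs_le. pose proof (SIN_bound (Q * PI * t)). lra. }
  pose proof (BK (-1/2) (-1/2 + h) ltac:(lra) ltac:(lra) ltac:(lra)) as B1.
  pose proof (BK (1/2) (1/2 + h) ltac:(lra) ltac:(lra) ltac:(lra)) as B2.
  replace (-1/2 + h - -1/2) with h in B1 by ring. replace (1/2 + h - 1/2) with h in B2 by ring.
  apply Rabs_le_between in B1, B2, B3. rewrite SH in C2.
  apply Rabs_def1; lra.
Qed.

Fixpoint dirichlet (N : nat) (t : R) : R :=
  match N with O => 1 | S N' => dirichlet N' t + 2 * cos (2 * PI * INR N * t) end.

Lemma dirichlet_sin N t : sin (PI * t) * dirichlet N t = sin ((2 * INR N + 1) * PI * t).
Proof.
  induction N as [|N IH].
  - simpl dirichlet. rewrite INR_0. rewrite Rmult_1_r. f_equal. ring.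
  - simpl dirichlet. rewrite Rmult_plus_distr_l, IH. change (match N with O => 1 | S _ => INR N + 1 end) with (INR (S N)).
    rewrite S_INR.
    replace ((2 * INR N + 1) * PI * t) with (2 * PI * (INR N + 1) * t - PI * t) by ring.
    replace ((2 * (INR N + 1) + 1) * PI * t) with (2 * PI * (INR N + 1) * t + PI * t) by ring.
    rewrite sin_plus, sin_minus. ring.
Qed.

Lemma dirichlet_cont N t : continuity_pt (dirichlet N) t.
Proof.
  induction N as [|N IH].
  - apply continuity_pt_const. intros x y; reflexivity.
  - apply (continuity_pt_plus (dirichlet N) (fun t => 2 * cos (2 * PI * INR (S N) * t))); [exact IH|].
    apply derivable_continuous_pt. reg.
Qed.

Lemma dirichlet_int N : is_RInt (dirichlet N) (- (1/2)) (1/2) 1.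
Proof.
  induction N as [|N IH].
  - simpl. pose proof (is_RInt_const (V := R_NormedModule) (- (1/2)) (1/2) 1) as H.
    unfold scal in H; simpl in H; unfold mult in H; simpl in H.
    replace ((1/2 - - (1/2)) * 1) with 1 in H by lra. exact H.
  - set (n := INR (S N)). assert (Hn : 0 < n) by (apply lt_0_INR; lia).
    assert (H : is_RInt (fun t => 2 * cos (2 * PI * n * t)) (- (1/2)) (1/2) 0).
    { pose proof PI_RGT_0.
      pose proof (is_RInt_derive (V := R_CompleteNormedModule) (fun t => sin (2 * PI * n * t) / (PI * n))
        (fun t => 2 * cos (2 * PI * n * t)) (- (1/2)) (1/2)) as D.
      unfold minus, plus, opp in D; simpl in D.
      replace (sin (2 * PI * n * (1/2)) / (PI * n) + - (sin (2 * PI * n * (- (1/2))) / (PI * n))) with 0 in D.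
      - apply D; intros t _.
        + auto_derive; [exact I|]. field. split; lra.
        + apply continuity_pt_filterlim. apply derivable_continuous_pt. reg.
      - replace (2 * PI * n * (1/2)) with (0 + INR (S N) * PI) by (unfold n; field).
        replace (2 * PI * n * - (1/2)) with (- (0 + INR (S N) * PI)) by (unfold n; field).
        rewrite sin_neg. assert (Z : sin (0 + INR (S N) * PI) = 0).
        { rewrite Rplus_0_l. apply sin_eq_0_1. exists (Z.of_nat (S N)). rewrite <- INR_IZR_INZ. reflexivity. }
        rewrite Z. field. split; lra. }
    replace 1 with (1 + 0) at 3 by ring.
    apply (is_RInt_plus (V := R_NormedModule) (dirichlet N) (fun t => 2 * cos (2 * PI * n * t))); assumption.
Qed.

(** Subtracting [g 0] and dividing by [sin (PI t)] leaves a continuous function, because [g] is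
    differentiable at [0]; the Dirichlet integral is then one to which [riemann_lebesgue] applies. *)
Lemma dirichlet_limit (g : R -> R) (l : R) : (forall t, Rabs t < 1 -> continuity_pt g t) ->
  derivable_pt_lim g 0 l -> forall eps, 0 < eps -> exists N0, forall N, (N0 <= N)%nat ->
  Rabs (RInt (fun t => g t * dirichlet N t) (- (1/2)) (1/2) - g 0) < eps.
Proof.
  intros Hg Hl eps He. pose proof PI_RGT_0 as Hpi.
  set (b := dquot (fun t => sin (PI * t)) PI).
  assert (Hb : forall t, continuity_pt b t).
  { intros t. apply dquot_cont.
    - apply is_derive_Reals. auto_derive; [exact I|]. rewrite Rmult_0_r, cos_0. ring.
    - apply derivable_continuous_pt. reg. }
  assert (Hb0 : forall t, Rabs t < 1 -> b t <> 0).
  { intros t Ht. apply Rabs_def2 in Ht. unfold b, dquot. destruct (Req_EM_T t 0) as [E|E]; [lra|].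
    rewrite Rmult_0_r, sin_0, Rminus_0_r. intros H.
    assert (sin (PI * t) = 0).
    { replace (sin (PI * t)) with (sin (PI * t) / t * t) by (field; exact E). rewrite H. ring. }
    destruct (Rlt_dec 0 t) as [Hp|Hp].
    - pose proof (sin_gt_0 (PI * t) ltac:(nra) ltac:(nra)). lra.
    - pose proof (sin_gt_0 (PI * - t) ltac:(nra) ltac:(nra)) as S.
      replace (PI * - t) with (- (PI * t)) in S by ring. rewrite sin_neg in S. lra. }
  set (k := fun t => dquot g l t / b t).
  destruct (riemann_lebesgue k) with (eps := eps) as [N0 HN0]; [|exact He|].
  { intros t Ht. apply (continuity_pt_div (dquot g l) b); [|apply Hb|apply Hb0, Ht].
    apply dquot_cont; [exact Hl|apply Hg, Ht]. }
  exists N0. intros N HN. specialize (HN0 N HN).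
  assert (E : forall t, Rabs t < 1 -> (g t - g 0) * dirichlet N t = k t * sin ((2 * INR N + 1) * PI * t)).
  { intros t Ht. rewrite <- dirichlet_sin. specialize (Hb0 t Ht). unfold k, b, dquot in *.
    destruct (Req_EM_T t 0) as [->|n].
    - rewrite Rmult_0_r, sin_0. ring.
    - rewrite Rmult_0_r, sin_0, Rminus_0_r in *. field. split; [exact n|].
      intros Z. apply Hb0. rewrite Z. field. exact n. }
  assert (EX : ex_RInt (fun t => g t * dirichlet N t) (- (1/2)) (1/2)).
  { apply (ex_RInt_continuous (V := R_CompleteNormedModule)). intros t Ht.
    rewrite Rmin_left, Rmax_right in Ht by lra.
    apply continuity_pt_filterlim. apply (continuity_pt_mult g (dirichlet N)); [|apply dirichlet_cont].
    apply Hg, Rabs_def1; lra. }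
  assert (E2 : RInt (fun t => g t * dirichlet N t) (- (1/2)) (1/2) - g 0 =
     RInt (fun t => k t * sin ((2 * INR N + 1) * PI * t)) (- (1/2)) (1/2)).
  { symmetry. apply is_RInt_unique.
    replace (RInt (fun t => g t * dirichlet N t) (- (1/2)) (1/2) - g 0) with
      (minus (RInt (fun t => g t * dirichlet N t) (- (1/2)) (1/2)) (scal (g 0) 1))
      by (unfold minus, plus, opp, scal; simpl; unfold mult; simpl; ring).
    eapply is_RInt_ext.
    2:{ apply (is_RInt_minus (V := R_NormedModule) (fun t => g t * dirichlet N t) (fun t => scal (g 0) (dirichlet N t))).
        - apply (RInt_correct (V := R_CompleteNormedModule)), EX.
        - apply (is_RInt_scal (V := R_NormedModule)), dirichlet_int. }
    intros t Ht. rewrite Rmin_left, Rmax_right in Ht by lra. rewrite <- E by (apply Rabs_def1; lra).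
    unfold minus, plus, opp, scal; simpl; unfold mult; simpl. ring. }
  rewrite E2. exact HN0.
Qed.

Local Open Scope C_scope.

Lemma Cexp_add_opp t : Cexp (RtoC t * Ci) + Cexp (- (RtoC t * Ci)) = RtoC (2 * cos t).
Proof.
  rewrite Cexp_Rmult_i. replace (- (RtoC t * Ci)) with (RtoC (- t) * Ci) by (rewrite RtoC_opp; ring).
  rewrite Cexp_Rmult_i, cos_neg, sin_neg. unfold Cplus, RtoC; simpl. f_equal; ring.
Qed.

Lemma Csum_dirichlet N t :
  Csum (fun r : Z => Cexp (-2 * RtoC PI * Ci * RtoC (IZR r) * RtoC t)) (Zint N) = RtoC (dirichlet N t).
Proof.
  induction N as [|N IH].
  - unfold Zint. simpl. replace (-2 * RtoC PI * Ci * 0 * RtoC t) with (RtoC 0) by ring. rewrite Cexp_0. ring.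
  - rewrite Csum_Zint_S, IH. simpl dirichlet.
    change (match N with O => 1%R | S _ => (INR N + 1)%R end) with (INR (S N)).
    rewrite RtoC_plus. f_equal. rewrite <- Cexp_add_opp, Cplus_comm.
    rewrite opp_IZR, <- INR_IZR_INZ, !RtoC_mult, RtoC_opp. f_equal; f_equal; ring.
Qed.

(** The partial sums of the Fourier series at [0] are Dirichlet integrals, so they tend to [f 0], and
    an unconditional sum agrees with the limit of its symmetric partial sums. *)
Theorem fourier_inversion (f : R -> C) (l : C) (fhat : Z -> C) (s : C) :
  (forall t, (Rabs t < 1)%R -> contC f t) -> isD f 0 l ->
  (forall r : Z, isInt (fun t => f t * Cexp (-2 * RtoC PI * Ci * RtoC (IZR r) * RtoC t)) (- (1/2)) (1/2) (fhat r)) ->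
  hasSum fhat s -> s = f 0%R.
Proof.
  intros Hc [Hl1 Hl2] Hf Hs.
  assert (HI : forall N, isInt (fun t => RtoC (dirichlet N t) * f t) (- (1/2)) (1/2) (Csum fhat (Zint N))).
  { intros N. eapply isInt_ext; [|apply (isInt_Csum _ fhat _ _ (Zint N) Hf)].
    intros t. cbv beta. rewrite Csum_scal, Csum_dirichlet. ring. }
  assert (H0 : forall eps, (0 < eps)%R -> (Cmod (s - f 0%R) <= 3 * eps)%R).
  { intros eps He.
    destruct (dirichlet_limit (fun t => Re (f t)) (Re l) (fun t Ht => proj1 (Hc t Ht)) Hl1 eps He) as [N1 H1].
    destruct (dirichlet_limit (fun t => Im (f t)) (Im l) (fun t Ht => proj2 (Hc t Ht)) Hl2 eps He) as [N2 H2].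
    destruct (hasSum_Zint _ _ Hs eps He) as [N3 H3].
    set (N := Nat.max N1 (Nat.max N2 N3)).
    specialize (H1 N ltac:(lia)). specialize (H2 N ltac:(lia)). specialize (H3 N ltac:(lia)).
    destruct (HI N) as [I1 I2].
    assert (E1 : RInt (fun t => (Re (f t) * dirichlet N t)%R) (- (1/2)) (1/2) = Re (Csum fhat (Zint N))).
    { apply is_RInt_unique. revert I1. apply is_RInt_ext. intros t _.
      unfold Cmult, RtoC, Re, Im; simpl. ring. }
    assert (E2 : RInt (fun t => (Im (f t) * dirichlet N t)%R) (- (1/2)) (1/2) = Im (Csum fhat (Zint N))).
    { apply is_RInt_unique. revert I2. apply is_RInt_ext. intros t _.
      unfold Cmult, RtoC, Re, Im; simpl. ring. }
    rewrite E1 in H1. rewrite E2 in H2.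
    replace (s - f 0%R) with ((s - Csum fhat (Zint N)) + (Csum fhat (Zint N) - f 0%R)) by ring.
    eapply Rle_trans; [apply Cmod_triangle|]. rewrite Cmod_sub_sym in H3.
    pose proof (Cmod_le_Re_Im (Csum fhat (Zint N) - f 0%R)) as B.
    unfold Cminus, Cplus, Copp, Re, Im in *; simpl in *. unfold Rminus in *. lra. }
  assert (Z : Cmod (s - f 0%R) = 0%R).
  { apply Rle_antisym; [|apply Cmod_ge_0]. apply le_epsilon. intros eps He.
    specialize (H0 (eps / 3)%R ltac:(lra)). lra. }
  apply Cmod_eq_0 in Z. replace s with ((s - f 0%R) + f 0%R) by ring. rewrite Z. ring.
Qed.

End Fourier.

(** * Gaussian integrals on tilted lines *)

Section Gauss.
Local Open Scope C_scope.

(** Joint continuity, as required for differentiation under the integral sign. *)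
Definition contC2 (f : R -> R -> C) (x y : R) : Prop :=
  continuity_2d_pt (fun u v => Re (f u v)) x y /\ continuity_2d_pt (fun u v => Im (f u v)) x y.

Lemma contC2_const c x y : contC2 (fun _ _ => c) x y.
Proof. split; apply continuity_2d_pt_const. Qed.

Lemma contC2_id1 x y : contC2 (fun u _ => RtoC u) x y.
Proof. split; [apply continuity_2d_pt_id1|apply (continuity_2d_pt_const x y 0)]. Qed.

Lemma contC2_id2 x y : contC2 (fun _ v => RtoC v) x y.
Proof. split; [apply continuity_2d_pt_id2|apply (continuity_2d_pt_const x y 0)]. Qed.

Lemma contC2_plus f g x y : contC2 f x y -> contC2 g x y -> contC2 (fun u v => f u v + g u v) x y.
Proof.
  intros [A B] [A' B']. split.
  - apply (continuity_2d_pt_plus (fun u v => Re (f u v)) (fun u v => Re (g u v))); assumption.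
  - apply (continuity_2d_pt_plus (fun u v => Im (f u v)) (fun u v => Im (g u v))); assumption.
Qed.

Lemma contC2_mult f g x y : contC2 f x y -> contC2 g x y -> contC2 (fun u v => f u v * g u v) x y.
Proof.
  intros [A B] [A' B']. split.
  - apply (continuity_2d_pt_minus (fun u v => Re (f u v) * Re (g u v))%R (fun u v => Im (f u v) * Im (g u v))%R);
    apply continuity_2d_pt_mult; assumption.
  - apply (continuity_2d_pt_plus (fun u v => Re (f u v) * Im (g u v))%R (fun u v => Im (f u v) * Re (g u v))%R);
    apply continuity_2d_pt_mult; assumption.
Qed.

Lemma contC2_Cexp f x y : contC2 f x y -> contC2 (fun u v => Cexp (f u v)) x y.
Proof.
  intros [A B].
  assert (E : continuity_2d_pt (fun u v => exp (Re (f u v))) x y).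
  { apply continuity_1d_2d_pt_comp; [|exact A]. apply derivable_continuous_pt, derivable_pt_exp. }
  assert (Cs : continuity_2d_pt (fun u v => cos (Im (f u v))) x y).
  { apply continuity_1d_2d_pt_comp; [|exact B]. apply continuity_cos. }
  assert (Sn : continuity_2d_pt (fun u v => sin (Im (f u v))) x y).
  { apply continuity_1d_2d_pt_comp; [|exact B]. apply continuity_sin. }
  split.
  - eapply continuity_2d_pt_ext; [|apply (continuity_2d_pt_mult _ _ _ _ E Cs)].
    intros u v. unfold Cexp, Cmult, RtoC, Re, Im; simpl. ring.
  - eapply continuity_2d_pt_ext; [|apply (continuity_2d_pt_mult _ _ _ _ E Sn)].
    intros u v. unfold Cexp, Cmult, RtoC, Re, Im; simpl. ring.
Qed.

(** When the parameter derivative of [G] is also the derivative of [H] in the integration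
    variable, differentiating under the integral sign leaves only boundary terms. *)
Lemma isD_param_exact (G D H : R -> R -> C) (a b : R) (IG : R -> C) (x : R) : (a <= b)%R ->
  (forall u w, isD (fun s => G s w) u (D u w)) ->
  (forall u w, isD (fun s => H u s) w (D u w)) ->
  (forall u w, contC (fun s => G u s) w) -> (forall u w, contC (fun s => D u s) w) ->
  (forall u w, contC2 D u w) ->
  (forall u, isInt (G u) a b (IG u)) ->
  isD IG x (H x b - H x a).
Proof.
  intros Hab HG HH cG cD c2 HI.
  pose proof (isInt_FTC (H x) (D x) a b Hab (fun t _ => HH x t) (fun t _ => cD x t)) as [F1 F2].
  split.
  - assert (E : (fun s => Re (IG s)) = (fun s => RInt (fun t => Re (G s t)) a b)).
    { apply functional_extensionality. intros s. symmetry. apply is_RInt_unique. apply (HI s). }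
    rewrite E. apply is_derive_Reals.
    assert (ED : forall u w, Derive (fun z => Re (G z w)) u = Re (D u w)).
    { intros u w. apply is_derive_unique, is_derive_Reals, (HG u w). }
    rewrite <- (is_RInt_unique (V := R_CompleteNormedModule) _ _ _ _ F1).
    replace (RInt (fun t => Re (D x t)) a b) with (RInt (fun t => Derive (fun u => Re (G u t)) x) a b)
      by (apply RInt_ext; intros t _; apply ED).
    apply (is_derive_RInt_param (fun s t => Re (G s t))).
    + exists (mkposreal 1 Rlt_0_1). intros u _ t _. exists (Re (D u t)). apply is_derive_Reals, (HG u t).
    + intros t _. eapply continuity_2d_pt_ext; [|apply (proj1 (c2 x t))]. intros u w. cbv beta. symmetry. apply ED.
    + exists (mkposreal 1 Rlt_0_1). intros u _. exists (Re (IG u)). apply (HI u).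
  - assert (E : (fun s => Im (IG s)) = (fun s => RInt (fun t => Im (G s t)) a b)).
    { apply functional_extensionality. intros s. symmetry. apply is_RInt_unique. apply (HI s). }
    rewrite E. apply is_derive_Reals.
    assert (ED : forall u w, Derive (fun z => Im (G z w)) u = Im (D u w)).
    { intros u w. apply is_derive_unique, is_derive_Reals, (HG u w). }
    rewrite <- (is_RInt_unique (V := R_CompleteNormedModule) _ _ _ _ F2).
    replace (RInt (fun t => Im (D x t)) a b) with (RInt (fun t => Derive (fun u => Im (G u t)) x) a b)
      by (apply RInt_ext; intros t _; apply ED).
    apply (is_derive_RInt_param (fun s t => Im (G s t))).
    + exists (mkposreal 1 Rlt_0_1). intros u _ t _. exists (Im (D u t)). apply is_derive_Reals, (HG u t).
    + intros t _. eapply continuity_2d_pt_ext; [|apply (proj2 (c2 x t))]. intros u w. cbv beta. symmetry. apply ED.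
    + exists (mkposreal 1 Rlt_0_1). intros u _. exists (Im (IG u)). apply (HI u).
Qed.

Lemma Re_mult z w : Re (z * w) = (Re z * Re w - Im z * Im w)%R.
Proof. reflexivity. Qed.

Lemma Im_mult z w : Im (z * w) = (Re z * Im w + Im z * Re w)%R.
Proof. reflexivity. Qed.

Lemma Re_plus z w : Re (z + w) = (Re z + Re w)%R.
Proof. reflexivity. Qed.

Lemma Im_plus z w : Im (z + w) = (Im z + Im w)%R.
Proof. reflexivity. Qed.

Lemma Re_RtoC x : Re (RtoC x) = x.
Proof. reflexivity. Qed.

Lemma Im_RtoC x : Im (RtoC x) = 0%R.
Proof. reflexivity. Qed.

Lemma Re_scal_r x z : Re (RtoC x * z) = (x * Re z)%R.
Proof. rewrite Re_mult, Re_RtoC, Im_RtoC. ring. Qed.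

(** A substitute for Cauchy's theorem. Deform [zeta = w] into [zeta = b w + v] linearly in a parameter
    [u]. The integrand [B(u) exp (- PI zeta^2)] with [B = d zeta / d w] satisfies
    [d/du (B exp (- PI zeta^2)) = d/dw ((d zeta / d u) exp (- PI zeta^2))], so that the integral
    over [-M, M] only varies through its end points. These lie deep in the sector where
    [exp (- PI zeta^2)] decays, because [B(u)] stays in the sector [|Im B| < Re B]. *)
Lemma gauss_contour (b v : C) : (Rabs (Im b) < Re b)%R ->
  forall eps, (0 < eps)%R -> exists M0 : R, forall M l0 l1, (M0 <= M)%R ->
  isInt (fun w => Cexp (- RtoC PI * (RtoC w * RtoC w))) (- M) M l0 ->
  isInt (fun w => b * Cexp (- RtoC PI * ((b * RtoC w + v) * (b * RtoC w + v)))) (- M) M l1 ->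
  (Cmod (l1 - l0) < eps)%R.
Proof.
  intros Hb eps He. pose proof PI_RGT_0 as Hpi.
  set (B := fun u : R => 1 + RtoC u * (b - 1)).
  set (z := fun u w : R => B u * RtoC w + RtoC u * v).
  set (E := fun u w : R => Cexp (- RtoC PI * (z u w * z u w))).
  set (G := fun u w : R => B u * E u w).
  set (dz := fun w : R => (b - 1) * RtoC w + v).
  set (H := fun u w : R => dz w * E u w).
  set (D := fun u w : R => (b - 1) * E u w + B u * (- RtoC PI * (2 * z u w * dz w) * E u w)).
  assert (DB : forall u, isD B u (b - 1)).
  { intros u. eapply isD_eq; [apply isD_plus; [apply isD_const|apply isD_mult; [apply isD_RtoC|apply isD_const]]|cbv beta; ring]. }
  assert (Dzu : forall u w, isD (fun s => z s w) u (dz w)).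
  { intros u w. eapply isD_eq; [apply isD_plus; [apply isD_mult; [apply DB|apply isD_const]|apply isD_mult; [apply isD_RtoC|apply isD_const]]|].
    unfold dz; cbv beta; ring. }
  assert (Dzw : forall u w, isD (fun s => z u s) w (B u)).
  { intros u w. eapply isD_eq; [apply isD_plus; [apply isD_mult; [apply isD_const|apply isD_RtoC]|apply isD_const]|].
    cbv beta; ring. }
  assert (DEu : forall u w, isD (fun s => E s w) u (- RtoC PI * (2 * z u w * dz w) * E u w)).
  { intros u w. eapply isD_eq; [apply isD_Cexp, isD_scal, isD_mult; apply Dzu|]. unfold E; cbv beta; ring. }
  assert (DEw : forall u w, isD (fun s => E u s) w (- RtoC PI * (2 * z u w * B u) * E u w)).
  { intros u w. eapply isD_eq; [apply isD_Cexp, isD_scal, isD_mult; apply Dzw|]. unfold E; cbv beta; ring. }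
  assert (DGu : forall u w, isD (fun s => G s w) u (D u w)).
  { intros u w. eapply isD_eq; [apply isD_mult; [apply DB|apply DEu]|]. unfold D; cbv beta; ring. }
  assert (Ddz : forall w, isD dz w (b - 1)).
  { intros w. eapply isD_eq; [apply isD_plus; [apply isD_scal, isD_RtoC|apply isD_const]|cbv beta; ring]. }
  assert (DHw : forall u w, isD (fun s => H u s) w (D u w)).
  { intros u w. eapply isD_eq; [apply isD_mult; [apply Ddz|apply DEw]|]. unfold D; cbv beta; ring. }
  assert (cG : forall u w, contC (fun s => G u s) w).
  { intros u w. eapply isD_contC, isD_mult; [apply isD_const|apply DEw]. }
  assert (cD : forall u w, contC (fun s => D u s) w).
  { intros u w. eapply isD_contC. apply isD_plus; [apply isD_scal, DEw|].
    apply isD_scal. apply isD_mult; [|apply DEw]. apply isD_scal.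
    apply isD_mult; [apply isD_scal, Dzw|apply Ddz]. }
  assert (c2z : forall u w, contC2 z u w).
  { intros u w. repeat (apply contC2_plus || apply contC2_mult); try apply contC2_const; try apply contC2_id1; apply contC2_id2. }
  assert (c2B : forall u w, contC2 (fun u _ => B u) u w).
  { intros u w. repeat (apply contC2_plus || apply contC2_mult); try apply contC2_const; apply contC2_id1. }
  assert (c2dz : forall u w, contC2 (fun _ w => dz w) u w).
  { intros u w. repeat (apply contC2_plus || apply contC2_mult); try apply contC2_const; apply contC2_id2. }
  assert (c2E : forall u w, contC2 E u w).
  { intros u w. apply contC2_Cexp, contC2_mult; [apply contC2_const|apply contC2_mult; apply c2z]. }
  assert (c2D : forall u w, contC2 D u w).
  { intros u w. apply contC2_plus; [apply contC2_mult; [apply contC2_const|apply c2E]|].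
    apply (contC2_mult (fun u _ => B u)); [apply c2B|].
    apply contC2_mult; [|apply c2E]. apply contC2_mult; [apply contC2_const|].
    apply (contC2_mult _ (fun _ w => dz w)); [|apply c2dz].
    apply contC2_mult; [apply contC2_const|apply c2z]. }
  (* [de ^ 2] bounds [Re (B u ^ 2)] from below along the whole deformation. *)
  set (de := Rmin 1 (Re b - Rabs (Im b))).
  assert (Hde : (0 < de)%R) by (apply Rmin_pos; lra).
  set (be := (1 + Cmod (b - 1))%R). set (nu := Cmod v).
  assert (Hbe : (1 <= be)%R) by (unfold be; pose proof (Cmod_ge_0 (b - 1)); lra).
  assert (Hnu : (0 <= nu)%R) by apply Cmod_ge_0.
  set (K := ((be + nu) * (exp (PI * nu ^ 2) * exp ((2 * PI * be * nu + 1 + 1) ^ 2 / (4 * (PI * de ^ 2)))))%R).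
  assert (HB : forall u, (0 <= u <= 1)%R -> (Cmod (B u) <= be)%R /\ (de ^ 2 <= Re (B u * B u))%R).
  { intros u Hu. split.
    - unfold B. eapply Rle_trans; [apply Cmod_triangle|]. rewrite Cmod_1, Cmod_mult, Cmod_R, Rabs_pos_eq by lra.
      unfold be. pose proof (Cmod_ge_0 (b - 1)). nra.
    - rewrite Re_mult. replace (Re (B u)) with (1 - u + u * Re b)%R by (unfold B, Re, Im; simpl; ring).
      replace (Im (B u)) with (u * Im b)%R by (unfold B, Re, Im; simpl; ring).
      assert (D1 : (de <= 1)%R) by apply Rmin_l.
      assert (D2 : (de <= Re b - Rabs (Im b))%R) by apply Rmin_r.
      assert (I2 : (u * Im b * (u * Im b) = (u * Rabs (Im b)) * (u * Rabs (Im b)))%R).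
      { replace (u * Rabs (Im b) * (u * Rabs (Im b)))%R with (u * u * (Rabs (Im b) ^ 2))%R by ring.
        rewrite pow2_abs. ring. }
      rewrite I2. pose proof (Rabs_pos (Im b)) as I0. set (q := Rabs (Im b)) in *.
      assert (A1 : (de <= (1 - u + u * Re b) - u * q)%R) by nra.
      assert (A2 : (de <= (1 - u + u * Re b) + u * q)%R) by nra.
      replace ((1 - u + u * Re b) * (1 - u + u * Re b) - u * q * (u * q))%R
        with (((1 - u + u * Re b) - u * q) * ((1 - u + u * Re b) + u * q))%R by ring.
      replace (de ^ 2)%R with (de * de)%R by ring. apply Rmult_le_compat; lra. }
  assert (HH : forall u w, (0 <= u <= 1)%R -> (Cmod (H u w) <= K * exp (- Rabs w))%R).
  { intros u w Hu. destruct (HB u Hu) as [B1 B2]. unfold H, E. rewrite Cmod_mult, Cmod_Cexp.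
    assert (T1 : (Cmod (dz w) <= (be + nu) * exp (Rabs w))%R).
    { unfold dz. eapply Rle_trans; [apply Cmod_triangle|]. rewrite Cmod_mult, Cmod_R. fold nu.
      pose proof (Rabs_le_exp w). pose proof (Rabs_pos w).
      assert (1 <= exp (Rabs w))%R by (rewrite <- exp_0; apply exp_le; lra).
      pose proof (Cmod_ge_0 (b - 1)). unfold be. nra. }
    assert (T2 : (Re (- RtoC PI * (z u w * z u w)) <= PI * nu ^ 2 + (- (PI * de ^ 2) * w ^ 2 + (2 * PI * be * nu) * Rabs w))%R).
    { replace (- RtoC PI * (z u w * z u w)) with (RtoC (- PI) * (z u w * z u w)) by (rewrite RtoC_opp; ring).
      rewrite Re_scal_r.
      replace (z u w * z u w) with (RtoC (w * w) * (B u * B u) + (RtoC (2 * w * u) * (B u * v) + RtoC (u * u) * (v * v)))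
        by (unfold z; rewrite !RtoC_mult; ring).
      rewrite !Re_plus, !Re_scal_r.
      assert (X1 : (- (be * nu) <= Re (B u * v))%R /\ (Re (B u * v) <= be * nu)%R).
      { pose proof (Rabs_Re_le_Cmod (B u * v)) as X. rewrite Cmod_mult in X. fold nu in X.
        apply Rabs_le_between in X. assert (Cmod (B u) * nu <= be * nu)%R by (apply Rmult_le_compat_r; lra). lra. }
      assert (X2 : (- (nu ^ 2) <= Re (v * v))%R).
      { pose proof (Rabs_Re_le_Cmod (v * v)) as X. rewrite Cmod_mult in X. fold nu in X.
        apply Rabs_le_between in X. replace (nu ^ 2)%R with (nu * nu)%R by ring. lra. }
      assert (X3 : (w * w * de ^ 2 <= w * w * Re (B u * B u))%R) by (apply Rmult_le_compat_l; [nra|exact B2]).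
      assert (X4 : (- (2 * (be * nu) * Rabs w) <= 2 * w * u * Re (B u * v))%R).
      { assert (Y : (Rabs (w * u * Re (B u * v)) <= Rabs w * (be * nu))%R).
        { rewrite !Rabs_mult. rewrite (Rabs_pos_eq u) by lra. pose proof (Rabs_pos w).
          assert (Rabs (Re (B u * v)) <= be * nu)%R by (apply Rabs_le; lra).
          pose proof (Rabs_pos (Re (B u * v))).
          replace (Rabs w * (be * nu))%R with (Rabs w * 1 * (be * nu))%R by ring.
          apply Rmult_le_compat; try assumption; [apply Rmult_le_pos; lra|]. apply Rmult_le_compat_l; lra. }
        apply Rabs_le_between in Y. lra. }
      assert (X5 : (- nu ^ 2 <= u * u * Re (v * v))%R).
      { assert (Y1 : (0 <= u * u * (Re (v * v) + nu ^ 2))%R) by (apply Rmult_le_pos; [nra|lra]).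
        assert (Y2 : (0 <= (1 - u * u) * nu ^ 2)%R) by (apply Rmult_le_pos; [nra|apply pow2_ge_0]).
        lra. }
      set (X := (w * w * Re (B u * B u) + (2 * w * u * Re (B u * v) + u * u * Re (v * v)))%R).
      assert (HX : (w * w * de ^ 2 - 2 * (be * nu) * Rabs w - nu ^ 2 <= X)%R) by (unfold X; lra).
      apply Rmult_le_compat_l with (r := PI) in HX; [|lra]. lra. }
    eapply Rle_trans; [apply Rmult_le_compat; [apply Cmod_ge_0|apply Rlt_le, exp_pos|exact T1|apply exp_le, T2]|].
    rewrite exp_plus. unfold K.
    pose proof (gauss_le (PI * de ^ 2) (2 * PI * be * nu + 1) w ltac:(apply Rmult_lt_0_compat; [lra|apply pow_lt; exact Hde])) as T3.
    replace (- (PI * de ^ 2) * w ^ 2 + (2 * PI * be * nu + 1) * Rabs w)%R with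
      (Rabs w + (- (PI * de ^ 2) * w ^ 2 + 2 * PI * be * nu * Rabs w))%R in T3 by ring.
    rewrite exp_plus in T3.
    apply Rle_trans with ((be + nu) * exp (PI * nu ^ 2) * (exp (Rabs w) * exp (- (PI * de ^ 2) * w ^ 2 + 2 * PI * be * nu * Rabs w)))%R; [right; ring|].
    apply Rle_trans with ((be + nu) * exp (PI * nu ^ 2) * (exp ((2 * PI * be * nu + 1 + 1) ^ 2 / (4 * (PI * de ^ 2))) * exp (- Rabs w)))%R; [|right; ring].
    apply Rmult_le_compat_l; [|exact T3]. apply Rmult_le_pos; [lra|apply Rlt_le, exp_pos]. }
  assert (HK : (0 < K)%R).
  { unfold K. repeat apply Rmult_lt_0_compat; try apply exp_pos. lra. }
  exists (4 * K / eps + 1)%R. intros M l0 l1 HM I0 I1.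
  assert (HM1 : (1 <= M)%R).
  { assert (0 <= 4 * K / eps)%R by (apply Rdiv_le_0_compat; lra). lra. }
  assert (IGex : exists IG : R -> C, forall u, isInt (G u) (- M) M (IG u)).
  { apply (choice_fun (fun u l => isInt (G u) (- M) M l)). intros u. apply isInt_ex; [lra|]. intros t _. apply cG. }
  destruct IGex as [IG HIG].
  assert (DI : forall u, isD IG u (H u M - H u (- M)%R)).
  { intros u. apply (isD_param_exact G D H (- M) M IG u); try assumption. lra. }
  assert (HI : isInt (fun u => H u M - H u (- M)%R) 0 1 (IG 1%R - IG 0%R)).
  { apply isInt_FTC; [lra|intros; apply DI|]. intros t _.
    assert (Q : forall w, isD (fun s => H s w) t (dz w * (- RtoC PI * (2 * z t w * dz w) * E t w))).
    { intros w. eapply isD_scal, DEu. }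
    eapply isD_contC. apply (isD_ext (fun s => H s M + (-1) * H s (- M)%R)); [intros s; ring|].
    apply isD_plus; [apply Q|apply isD_scal, Q]. }
  assert (E1 : IG 1%R = l1).
  { apply (isInt_unique (G 1%R) (- M) M); [apply HIG|].
    revert I1. apply isInt_ext. intros t. unfold G, E, z, B. replace (1 + 1 * (b - 1)) with b by ring.
    replace (1 * v) with v by ring. reflexivity. }
  assert (E0 : IG 0%R = l0).
  { apply (isInt_unique (G 0%R) (- M) M); [apply HIG|].
    revert I0. apply isInt_ext. intros t. unfold G, E, z, B. replace (1 + 0 * (b - 1)) with (RtoC 1) by ring.
    replace (1 * t + 0 * v) with (RtoC t) by ring. ring. }
  rewrite E1, E0 in HI.
  eapply Rle_lt_trans.
  - eapply (isInt_le _ 0 1 _ (2 * K * exp (- M))%R ltac:(lra)); [|exact HI].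
    intros t Ht. cbv beta. unfold Cminus. eapply Rle_trans; [apply Cmod_triangle|]. rewrite Cmod_opp.
    pose proof (HH t M Ht) as X1. pose proof (HH t (- M)%R Ht) as X2.
    rewrite Rabs_Ropp in X2. rewrite Rabs_pos_eq in X1, X2 by lra. lra.
  - rewrite exp_Ropp.
    assert (XM : (4 * K / eps < exp M)%R).
    { pose proof (exp_ineq1 M ltac:(lra)). lra. }
    pose proof (exp_pos M). apply Rmult_lt_reg_r with (exp M); [lra|].
    replace (2 * (1 - 0) * (2 * K * / exp M) * exp M)%R with (4 * K)%R by (field; lra).
    assert (XE : (eps * (4 * K / eps) = 4 * K)%R) by (field; lra). nra.
Qed.

(** The exponent has real part [- PI Re A n^2 + O(|n|)], uniformly for bounded [p]; the factor
    [1 + |n|] leaves room for a derivative in [p]. *)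
Lemma gauss_term_bound (A : C) (P : R) : (0 < Re A)%R -> exists K, (0 <= K)%R /\
  forall n p, (Cmod p <= P)%R ->
  ((1 + Rabs (IZR n)) * Cmod (Cexp (- RtoC PI * A * ((RtoC (IZR n) + p) * (RtoC (IZR n) + p)))) <= K * Zexp n)%R.
Proof.
  intros HA. pose proof PI_RGT_0 as Hpi. pose proof (Cmod_ge_0 A) as HA0.
  set (a := (PI * Re A)%R). assert (Ha : (0 < a)%R) by (apply Rmult_lt_0_compat; lra).
  set (Q := Rmax P 0). set (b := (2 * PI * Cmod A * Q)%R).
  exists (exp (PI * Cmod A * Q ^ 2) * exp ((b + 1 + 1) ^ 2 / (4 * a)))%R.
  split; [apply Rmult_le_pos; apply Rlt_le, exp_pos|].
  intros n p Hp. rewrite Cmod_Cexp. set (t := IZR n).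
  assert (HQ : (Cmod p <= Q)%R) by (unfold Q; eapply Rle_trans; [exact Hp|apply Rmax_l]).
  assert (HQ0 : (0 <= Q)%R) by (unfold Q; apply Rmax_r).
  assert (T : (Re (- RtoC PI * A * ((RtoC t + p) * (RtoC t + p))) <= PI * Cmod A * Q ^ 2 + (- a * t ^ 2 + b * Rabs t))%R).
  { replace (- RtoC PI * A * ((RtoC t + p) * (RtoC t + p))) with
      (RtoC (- PI) * (RtoC (t * t) * A + (RtoC (2 * t) * (A * p) + A * (p * p)))) by (rewrite RtoC_opp, !RtoC_mult; ring).
    rewrite Re_scal_r, !Re_plus, !Re_scal_r.
    pose proof (Rabs_Re_le_Cmod (A * p)) as X1. rewrite Cmod_mult in X1.
    pose proof (Rabs_Re_le_Cmod (A * (p * p))) as X2. rewrite !Cmod_mult in X2.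
    pose proof (Cmod_ge_0 p) as Hp0.
    assert (Y1 : (Cmod A * Cmod p <= Cmod A * Q)%R) by (apply Rmult_le_compat_l; assumption).
    assert (Y2 : (Cmod A * (Cmod p * Cmod p) <= Cmod A * Q ^ 2)%R).
    { apply Rmult_le_compat_l; [assumption|]. simpl. rewrite Rmult_1_r. apply Rmult_le_compat; assumption. }
    assert (Z1 : (- (Rabs t * (Cmod A * Q)) <= t * Re (A * p))%R).
    { assert (Y : (Rabs (t * Re (A * p)) <= Rabs t * (Cmod A * Q))%R).
      { rewrite Rabs_mult. apply Rmult_le_compat_l; [apply Rabs_pos|lra]. }
      apply Rabs_le_between in Y. lra. }
    apply Rabs_le_between in X2.
    set (X := (t * t * Re A + (2 * t * Re (A * p) + Re (A * (p * p))))%R).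
    assert (HX : (t * t * Re A - 2 * (Rabs t * (Cmod A * Q)) - Cmod A * Q ^ 2 <= X)%R) by (unfold X; lra).
    apply Rmult_le_compat_l with (r := PI) in HX; [|lra]. unfold a, b. lra. }
  assert (T1 : (1 + Rabs t <= exp (Rabs t))%R) by apply exp_ineq1_le.
  pose proof (gauss_le a (b + 1) t Ha) as T3.
  eapply Rle_trans; [apply Rmult_le_compat; [pose proof (Rabs_pos t); lra|apply Rlt_le, exp_pos|exact T1|apply exp_le, T]|].
  rewrite <- exp_plus.
  replace (Rabs t + (PI * Cmod A * Q ^ 2 + (- a * t ^ 2 + b * Rabs t)))%R with
    (PI * Cmod A * Q ^ 2 + (- a * t ^ 2 + (b + 1) * Rabs t))%R by ring.
  rewrite exp_plus, (Rmult_assoc (exp _)). apply Rmult_le_compat_l; [apply Rlt_le, exp_pos|]. exact T3.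
Qed.

Lemma gauss_term_bound1 (A : C) (P : R) : (0 < Re A)%R -> exists K, (0 <= K)%R /\
  forall n p, (Cmod p <= P)%R ->
  (Cmod (Cexp (- RtoC PI * A * ((RtoC (IZR n) + p) * (RtoC (IZR n) + p)))) <= K * Zexp n)%R.
Proof.
  intros HA. destruct (gauss_term_bound A P HA) as [K [HK H]]. exists K. split; [exact HK|].
  intros n p Hp. eapply Rle_trans; [|apply (H n p Hp)].
  rewrite <- (Rmult_1_l (Cmod _)) at 1. apply Rmult_le_compat_r; [apply Cmod_ge_0|].
  pose proof (Rabs_pos (IZR n)). lra.
Qed.

End Gauss.

(** * Poisson summation for Gaussians *)

Section Poisson.
Local Open Scope C_scope.

Lemma Re_sq_pos (b : C) : (Rabs (Im b) < Re b)%R -> (0 < Re (b * b))%R.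
Proof.
  intros Hb. rewrite Re_mult. pose proof (Rabs_pos (Im b)) as I0.
  replace (Im b * Im b)%R with (Rabs (Im b) * Rabs (Im b))%R; [nra|].
  rewrite <- Rabs_mult, Rabs_pos_eq; [reflexivity|nra].
Qed.

Lemma Re_pos_neq_0 (z : C) : (0 < Re z)%R -> z <> 0.
Proof. intros H E. rewrite E in H. simpl in H. lra. Qed.

Lemma Re_inv_pos (z : C) : (0 < Re z)%R -> (0 < Re (/ z))%R.
Proof.
  intros H. unfold Cinv, Re in *; simpl in *. apply Rdiv_lt_0_compat; [exact H|]. nra.
Qed.

(** Limits are taken along half-integral end points because [[-(N+1/2), N+1/2]] is tiled by the unit
    intervals centred at [-N, ..., N], on which the periodisation of a Gaussian is unfolded. *)
Definition is_lim_half (h : R -> C) (S : C) : Prop :=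
  forall eps, (0 < eps)%R -> exists N0, forall N l, (N0 <= N)%nat ->
  isInt h (- (INR N + 1/2)) (INR N + 1/2) l -> (Cmod (l - S) < eps)%R.

Lemma isInt_Zint (h : R -> C) (l : Z -> C) :
  (forall n, isInt h (IZR n - 1/2) (IZR n + 1/2) (l n)) ->
  forall N, isInt h (- (INR N + 1/2)) (INR N + 1/2) (Csum l (Zint N)).
Proof.
  intros H. induction N as [|N IH].
  - unfold Zint. simpl. replace (l 0%Z + 0) with (l 0%Z) by ring. specialize (H 0%Z).
    replace (0 - 1/2)%R with (- (0 + 1/2))%R in H by ring. exact H.
  - rewrite Csum_Zint_S.
    pose proof (H (Z.of_nat (S N))) as H1. pose proof (H (- Z.of_nat (S N))%Z) as H2.
    rewrite opp_IZR in H2. rewrite <- INR_IZR_INZ, S_INR in H1, H2. rewrite S_INR.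
    replace (INR N + 1 - 1/2)%R with (INR N + 1/2)%R in H1 by lra.
    replace (- (INR N + 1) + 1/2)%R with (- (INR N + 1/2))%R in H2 by lra.
    replace (- (INR N + 1) - 1/2)%R with (- (INR N + 1 + 1/2))%R in H2 by lra.
    replace (Csum l (Zint N) + (l (Z.of_nat (S N)) + l (- Z.of_nat (S N))%Z)) with
      (l (- Z.of_nat (S N))%Z + (Csum l (Zint N) + l (Z.of_nat (S N)))) by ring.
    eapply isInt_Chasles; [exact H2|]. eapply isInt_Chasles; [exact IH|exact H1].
Qed.

Section Theta.
Variables (b u : C).
Hypothesis Hb : (Rabs (Im b) < Re b)%R.

Let A := b * b.
Let g (n : Z) (t : R) : C := Cexp (- RtoC PI * A * ((RtoC (IZR n) + (u + RtoC t)) * (RtoC (IZR n) + (u + RtoC t)))).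
Let g' (n : Z) (t : R) : C := (- RtoC PI * A * (2 * (RtoC (IZR n) + (u + RtoC t)))) * g n t.
Let F (t : R) : C := CSeriesZ (fun n => g n t).
Let F' (t : R) : C := CSeriesZ (fun n => g' n t).

Lemma theta_g_isD n t : isD (g n) t (g' n t).
Proof.
  assert (D : isD (fun t => RtoC (IZR n) + (u + RtoC t)) t 1).
  { eapply isD_eq; [apply isD_plus; [apply isD_const|apply isD_plus; [apply isD_const|apply isD_RtoC]]|ring]. }
  eapply isD_eq; [apply isD_Cexp, isD_scal, isD_mult; exact D|]. unfold g', g. cbv beta. ring.
Qed.

Lemma theta_bounds : exists K, (0 <= K)%R /\ forall n t, Boule 0 (mkposreal 1 Rlt_0_1) t ->
  (Cmod (g n t) <= K * Zexp n)%R /\ (Cmod (g' n t) <= K * Zexp n)%R.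
Proof.
  destruct (gauss_term_bound A (Cmod u + 1) (Re_sq_pos b Hb)) as [K [HK H]].
  set (K2 := (2 * PI * Cmod A * (1 + (Cmod u + 1)))%R).
  pose proof PI_RGT_0. pose proof (Cmod_ge_0 A). pose proof (Cmod_ge_0 u).
  assert (HK2 : (0 <= K2)%R) by (unfold K2; apply Rmult_le_pos; [apply Rmult_le_pos|]; lra).
  exists ((1 + K2) * K)%R. split; [apply Rmult_le_pos; lra|].
  intros n t Ht. unfold Boule in Ht. simpl in Ht. rewrite Rminus_0_r in Ht.
  assert (Hp : (Cmod (u + RtoC t) <= Cmod u + 1)%R).
  { eapply Rle_trans; [apply Cmod_triangle|]. rewrite Cmod_R. lra. }
  specialize (H n (u + RtoC t) Hp). fold (g n t) in H.
  pose proof (Cmod_ge_0 (g n t)) as G0. pose proof (Rabs_pos (IZR n)) as N0.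
  assert (Z0 : (0 <= K * Zexp n)%R) by (apply Rmult_le_pos; [exact HK|apply Zexp_pos]).
  assert (G2 : (0 <= Rabs (IZR n) * Cmod (g n t))%R) by (apply Rmult_le_pos; assumption).
  assert (Z2 : (0 <= K2 * (K * Zexp n))%R) by (apply Rmult_le_pos; assumption).
  rewrite Rmult_plus_distr_r, Rmult_1_l in H.
  assert (G1 : (Cmod (g n t) <= K * Zexp n)%R) by lra.
  split; [replace ((1 + K2) * K * Zexp n)%R with (K2 * (K * Zexp n) + K * Zexp n)%R by ring; lra|].
  unfold g'. rewrite !Cmod_mult, Cmod_opp, !Cmod_R, (Rabs_pos_eq PI), (Rabs_pos_eq 2) by lra.
  assert (T : (Cmod (RtoC (IZR n) + (u + RtoC t)) <= (1 + (Cmod u + 1)) * (1 + Rabs (IZR n)))%R).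
  { eapply Rle_trans; [apply Cmod_triangle|]. rewrite Cmod_R. nra. }
  apply Rle_trans with (K2 * ((1 + Rabs (IZR n)) * Cmod (g n t)))%R.
  - unfold K2. replace (2 * PI * Cmod A * (1 + (Cmod u + 1)) * ((1 + Rabs (IZR n)) * Cmod (g n t)))%R
      with (PI * Cmod A * (2 * ((1 + (Cmod u + 1)) * (1 + Rabs (IZR n)))) * Cmod (g n t))%R by ring.
    apply Rmult_le_compat_r; [exact G0|]. apply Rmult_le_compat_l; [apply Rmult_le_pos; lra|lra].
  - rewrite (Rmult_plus_distr_r 1), Rmult_1_l. replace ((1 + K2) * K * Zexp n)%R with (K2 * (K * Zexp n) + K * Zexp n)%R by ring.
    apply Rmult_le_compat_l with (r := K2) in H; [lra|exact HK2].
Qed.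

Lemma theta_hasSum t : (Rabs t < 1)%R -> hasSum (fun n => g n t) (F t) /\ hasSum (fun n => g' n t) (F' t).
Proof.
  intros Ht. destruct theta_bounds as [K [HK H]].
  assert (HB : Boule 0 (mkposreal 1 Rlt_0_1) t) by (unfold Boule; simpl; rewrite Rminus_0_r; exact Ht).
  split; apply (hasSum_CSeriesZ _ (fun n => K * Zexp n)%R); try (intros n; apply (H n t HB));
  apply summable_scal; try exact HK; apply summable_Zexp.
Qed.

Lemma Boule01 t : Boule 0 (mkposreal 1 Rlt_0_1) t <-> (Rabs t < 1)%R.
Proof. unfold Boule; simpl. rewrite Rminus_0_r. reflexivity. Qed.

Lemma theta_C1 : (forall t, (Rabs t < 1)%R -> contC F t) /\ isD F 0 (F' 0%R).
Proof.
  destruct theta_bounds as [K [HK H]].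
  assert (HS : summable (fun n => K * Zexp n)%R) by (apply summable_scal; [exact HK|apply summable_Zexp]).
  split.
  - intros t Ht. apply (dominated_contC g F (fun n => K * Zexp n)%R 0 (mkposreal 1 Rlt_0_1)).
    + intros n s _. eapply isD_contC, theta_g_isD.
    + intros n s Hs. apply (H n s Hs).
    + exact HS.
    + intros s Hs. apply theta_hasSum, Boule01, Hs.
    + apply Boule01, Ht.
  - apply (dominated_isD g g' F F' (fun n => K * Zexp n)%R 0 (mkposreal 1 Rlt_0_1)).
    + intros n s _. apply theta_g_isD.
    + intros n s Hs. apply (H n s Hs).
    + exact HS.
    + intros s Hs. apply theta_hasSum, Boule01, Hs.
    + intros s Hs. apply theta_hasSum, Boule01, Hs.
    + apply Boule01. rewrite Rabs_R0. lra.
Qed.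

Let e (r : Z) (t : R) : C := Cexp (-2 * RtoC PI * Ci * RtoC (IZR r) * RtoC t).

Lemma e_isD r t : isD (e r) t (-2 * RtoC PI * Ci * RtoC (IZR r) * e r t).
Proof.
  eapply isD_eq; [apply isD_Cexp, isD_scal, isD_RtoC|]. unfold e. ring.
Qed.

Lemma Cmod_e r t : Cmod (e r t) = 1%R.
Proof.
  unfold e. rewrite Cmod_Cexp.
  replace (Re (-2 * RtoC PI * Ci * RtoC (IZR r) * RtoC t)) with 0%R; [apply exp_0|].
  unfold Ci, Cmult, RtoC, Re, Im; simpl. ring.
Qed.

Let h (r : Z) (w : R) : C := Cexp (- RtoC PI * A * ((RtoC w + u) * (RtoC w + u))) * e r w.

(** Unfolding: the Fourier coefficient of the periodised Gaussian on one period is the Fourier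
    integral of the Gaussian over the line. *)
Lemma theta_fourier_unfold r : exists S,
  isInt (fun t => F t * e r t) (- (1/2)) (1/2) S /\ is_lim_half (h r) S.
Proof.
  destruct theta_bounds as [K [HK H]].
  assert (HS : summable (fun n => K * Zexp n)%R) by (apply summable_scal; [exact HK|apply summable_Zexp]).
  assert (cg : forall n t, contC (fun t => g n t * e r t) t).
  { intros n t. apply contC_mult; [eapply isD_contC, theta_g_isD|eapply isD_contC, e_isD]. }
  destruct (choice_fun (fun n l => isInt (fun t => g n t * e r t) (- (1/2)) (1/2) l)) as [l Hl].
  { intros n. apply isInt_ex; [lra|]. intros t _. apply cg. }
  destruct (dominated_isInt (fun n t => g n t * e r t) (fun t => F t * e r t) (fun n => K * Zexp n)%R
    0 (mkposreal 1 Rlt_0_1)) with (A := (- (1/2))%R) (B := (1/2)%R) (l := l) as [S [HI HsS]].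
  - intros n t _. apply cg.
  - intros n t Ht. rewrite Cmod_mult, Cmod_e, Rmult_1_r. apply (H n t Ht).
  - exact HS.
  - intros t Ht. pose proof (proj1 (Boule01 t) Ht) as Ht'. replace (F t * e r t) with (e r t * F t) by ring.
    apply (hasSum_ext (fun n => e r t * g n t)); [intros n; ring|].
    apply hasSum_scal, (proj1 (theta_hasSum t Ht')).
  - lra.
  - intros t Ht. apply Boule01, Rabs_def1; lra.
  - exact Hl.
  - exists S. split; [exact HI|].
    assert (ch : forall w, contC (h r) w).
    { intros w. eapply isD_contC. apply isD_mult; [|apply e_isD].
      apply isD_Cexp, isD_scal, isD_mult; (apply isD_plus; [apply isD_RtoC|apply isD_const]). }
    assert (Hh : forall n, isInt (h r) (IZR n - 1/2) (IZR n + 1/2) (l n)).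
    { intros n. destruct (isInt_ex (h r) (IZR n - 1/2) (IZR n + 1/2)) as [m Hm]; [lra|intros; apply ch|].
      assert (Em : m = l n); [|rewrite <- Em; exact Hm].
      apply (isInt_unique (fun t => g n t * e r t) (- (1/2)) (1/2)); [|apply Hl].
      replace (IZR n - 1/2)%R with (- (1/2) + IZR n)%R in Hm by ring.
      replace (IZR n + 1/2)%R with (1/2 + IZR n)%R in Hm by ring.
      apply isInt_shift in Hm. revert Hm. apply isInt_ext. intros t.
      unfold h, g, e. rewrite RtoC_plus. f_equal; [f_equal; ring|].
      replace (-2 * RtoC PI * Ci * RtoC (IZR r) * (RtoC t + RtoC (IZR n))) with
        (-2 * RtoC PI * Ci * RtoC (IZR r) * RtoC t + 2 * RtoC PI * Ci * RtoC (IZR (- (r * n)))).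
      - rewrite Cexp_plus, Cexp_2pi_i. ring.
      - rewrite opp_IZR, mult_IZR, RtoC_opp, RtoC_mult. ring. }
    intros eps He. destruct (hasSum_Zint l S HsS eps He) as [N0 HN0].
    exists N0. intros N l' HN Hl'.
    rewrite (isInt_unique _ _ _ _ _ Hl' (isInt_Zint (h r) l Hh N)). apply HN0, HN.
Qed.

Lemma theta_inversion (c : C) (s : C) :
  (forall r, exists S, isInt (fun t => F t * e r t) (- (1/2)) (1/2) S /\ S = c * Cexp (- RtoC PI / A * (RtoC (IZR r) * RtoC (IZR r)) + 2 * RtoC PI * Ci * RtoC (IZR r) * u)) ->
  hasSum (fun r => c * Cexp (- RtoC PI / A * (RtoC (IZR r) * RtoC (IZR r)) + 2 * RtoC PI * Ci * RtoC (IZR r) * u)) s ->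
  s = F 0%R.
Proof.
  intros HF Hs. destruct theta_C1 as [C1 C2].
  refine (fourier_inversion F (F' 0%R) _ s C1 C2 _ Hs).
  intros r. destruct (HF r) as [S [H1 H2]]. rewrite <- H2. exact H1.
Qed.

End Theta.

Lemma dual_theta_bound (b u : C) : (Rabs (Im b) < Re b)%R ->
  exists K, (0 <= K)%R /\ forall r,
  (Cmod (Cexp (- RtoC PI / (b * b) * (RtoC (IZR r) * RtoC (IZR r)) + 2 * RtoC PI * Ci * RtoC (IZR r) * u)) <= K * Zexp r)%R.
Proof.
  intros Hb. set (A := b * b). pose proof (Re_sq_pos b Hb) as HA. fold A in HA.
  pose proof (Re_pos_neq_0 A HA) as HA0.
  destruct (gauss_term_bound1 (/ A) (Cmod (- Ci * u * A)) (Re_inv_pos A HA)) as [K [HK H]].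
  exists (Cmod (Cexp (- RtoC PI * A * u * u)) * K)%R. split; [apply Rmult_le_pos; [apply Cmod_ge_0|exact HK]|].
  intros r. specialize (H r (- Ci * u * A) (Rle_refl _)).
  replace (- RtoC PI / A * (RtoC (IZR r) * RtoC (IZR r)) + 2 * RtoC PI * Ci * RtoC (IZR r) * u) with
    (- RtoC PI * A * u * u + - RtoC PI * / A * ((RtoC (IZR r) + - Ci * u * A) * (RtoC (IZR r) + - Ci * u * A))).
  - rewrite Cexp_plus, Cmod_mult, Rmult_assoc. apply Rmult_le_compat_l; [apply Cmod_ge_0|exact H].
  - assert (E : Ci * Ci = - (1)) by (unfold Ci, Cmult, Copp, RtoC; simpl; f_equal; ring).
    assert (Ex : forall x : C, (x + - Ci * u * A) * (x + - Ci * u * A) = x * x + (Ci * Ci) * u * u * A * A - 2 * Ci * u * A * x) by (intros x; ring).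
    rewrite Ex, E. field. exact HA0.
Qed.

Lemma is_lim_half_unique h S T : (forall w, contC h w) -> is_lim_half h S -> is_lim_half h T -> S = T.
Proof.
  intros hc H1 H2.
  destruct (Req_dec (Cmod (S - T)) 0) as [E|E].
  - apply Cmod_eq_0 in E. replace S with ((S - T) + T) by ring. rewrite E. ring.
  - exfalso. assert (Hp : (0 < Cmod (S - T) / 2)%R) by (pose proof (Cmod_ge_0 (S - T)); lra).
    destruct (H1 _ Hp) as [N1 G1]. destruct (H2 _ Hp) as [N2 G2]. set (N := Nat.max N1 N2).
    destruct (isInt_ex h (- (INR N + 1/2)) (INR N + 1/2)) as [l Hl].
    { pose proof (pos_INR N). lra. } { intros; apply hc. }
    specialize (G1 N l ltac:(lia) Hl). specialize (G2 N l ltac:(lia) Hl).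
    rewrite Cmod_sub_sym in G1.
    pose proof (Cmod_triangle (S - l) (l - T)) as H. replace (S - l + (l - T)) with (S - T) in H by ring. lra.
Qed.

Lemma is_lim_half_scal (c : C) h S : (forall w, contC h w) -> is_lim_half h S -> is_lim_half (fun w => c * h w) (c * S).
Proof.
  intros hc H eps He. pose proof (Cmod_ge_0 c) as Hc.
  destruct (H (eps / (Cmod c + 1))%R) as [N0 HN]; [apply Rdiv_lt_0_compat; lra|].
  exists N0. intros N l HNN Hl.
  destruct (isInt_ex h (- (INR N + 1/2)) (INR N + 1/2)) as [m Hm].
  { pose proof (pos_INR N). lra. } { intros; apply hc. }
  rewrite (isInt_unique _ _ _ _ _ Hl (isInt_scal c _ _ _ _ Hm)).
  replace (c * m - c * S) with (c * (m - S)) by ring. rewrite Cmod_mult.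
  specialize (HN N m HNN Hm). pose proof (Cmod_ge_0 (m - S)).
  apply Rle_lt_trans with ((Cmod c + 1) * Cmod (m - S))%R; [nra|].
  apply Rlt_le_trans with ((Cmod c + 1) * (eps / (Cmod c + 1)))%R; [apply Rmult_lt_compat_l; lra|right; field; lra].
Qed.

Let gauss (w : R) : C := Cexp (- RtoC PI * (RtoC w * RtoC w)).

Lemma is_lim_half_contour (b v c : C) : (Rabs (Im b) < Re b)%R -> is_lim_half gauss c ->
  is_lim_half (fun w => b * Cexp (- RtoC PI * ((b * RtoC w + v) * (b * RtoC w + v)))) c.
Proof.
  intros Hb Hc eps He.
  destruct (gauss_contour b v Hb (eps / 2)%R ltac:(lra)) as [M0 HM0].
  destruct (Hc (eps / 2)%R ltac:(lra)) as [N1 HN1].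
  destruct (INR_unbounded M0) as [N2 HN2].
  exists (Nat.max N1 N2). intros N l HN Hl.
  destruct (isInt_ex gauss (- (INR N + 1/2)) (INR N + 1/2)) as [m Hm].
  { pose proof (pos_INR N). lra. }
  { intros w _. eapply isD_contC, isD_Cexp, isD_scal, isD_mult; apply isD_RtoC. }
  specialize (HN1 N m ltac:(lia) Hm).
  assert (HM : (M0 <= INR N + 1/2)%R).
  { assert (INR N2 <= INR N)%R by (apply le_INR; lia). lra. }
  specialize (HM0 _ m l HM Hm Hl).
  replace (l - c) with ((l - m) + (m - c)) by ring. eapply Rle_lt_trans; [apply Cmod_triangle|lra].
Qed.

(** Completing the square turns the Fourier integral into a Gaussian integral along the tilted line
    [zeta = b w + b u + i r / b], whose value is the same constant [c] for all parameters. *)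
Lemma poisson_up_to_constant (c : C) : is_lim_half gauss c -> forall b u : C, (Rabs (Im b) < Re b)%R ->
  exists s, hasSum (fun n => Cexp (- RtoC PI * (b * b) * ((RtoC (IZR n) + u) * (RtoC (IZR n) + u)))) s /\
  hasSum (fun r => c / b * Cexp (- RtoC PI / (b * b) * (RtoC (IZR r) * RtoC (IZR r)) + 2 * RtoC PI * Ci * RtoC (IZR r) * u)) s.
Proof.
  intros Hc b u Hb.
  pose proof (Re_pos_neq_0 (b * b) (Re_sq_pos b Hb)) as HA0.
  assert (Hb0 : b <> 0).
  { apply Re_pos_neq_0. pose proof (Rabs_pos (Im b)). lra. }
  destruct (dual_theta_bound b u Hb) as [K [HK HKb]].
  destruct (hasSum_ex _ (fun r => K * Zexp r)%R HKb) as [t Ht].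
  { apply summable_scal; [exact HK|apply summable_Zexp]. }
  exists (c / b * t). assert (Hs := hasSum_scal (c / b) _ t Ht). split; [|exact Hs].
  assert (E := theta_inversion b u Hb (c / b) (c / b * t)).
  rewrite E; [|clear E|exact Hs].
  - destruct (theta_hasSum b u Hb 0%R) as [T _]; [rewrite Rabs_R0; lra|].
    revert T. apply hasSum_ext. intros n. f_equal. ring.
  - intros r. destruct (theta_fourier_unfold b u Hb r) as [S [HS1 HS2]].
    exists S. split; [exact HS1|].
    set (v := b * u + Ci * RtoC (IZR r) / b).
    set (k := Cexp (- RtoC PI / (b * b) * (RtoC (IZR r) * RtoC (IZR r)) + 2 * RtoC PI * Ci * RtoC (IZR r) * u)).
    pose proof (is_lim_half_contour b v c Hb Hc) as L1.
    assert (cw : forall w, contC (fun w => b * Cexp (- RtoC PI * ((b * RtoC w + v) * (b * RtoC w + v)))) w).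
    { intros w. eapply isD_contC, isD_scal, isD_Cexp, isD_scal, isD_mult; (apply isD_plus; [apply isD_scal, isD_RtoC|apply isD_const]). }
    apply (is_lim_half_scal (k / b)) in L1; [|exact cw].
    replace (c / b * k) with (k / b * c) by (field; exact Hb0).
    eapply is_lim_half_unique; [|exact HS2|].
    + intros w. eapply isD_contC. apply isD_mult; [|apply isD_Cexp, isD_scal, isD_RtoC].
      apply isD_Cexp, isD_scal, isD_mult; (apply isD_plus; [apply isD_RtoC|apply isD_const]).
    + intros eps He. destruct (L1 eps He) as [N0 HN0]. exists N0. intros N l HN Hl. apply (HN0 N l HN).
      revert Hl. apply isInt_ext. intros w.
      replace (k / b * (b * Cexp (- RtoC PI * ((b * RtoC w + v) * (b * RtoC w + v))))) with
        (k * Cexp (- RtoC PI * ((b * RtoC w + v) * (b * RtoC w + v)))) by (field; exact Hb0).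
      unfold k. rewrite <- !Cexp_plus. f_equal. unfold v.
      assert (Ei : Ci * Ci = - (1)) by (unfold Ci, Cmult, Copp, RtoC; simpl; f_equal; ring).
      replace ((b * RtoC w + (b * u + Ci * RtoC (IZR r) / b)) * (b * RtoC w + (b * u + Ci * RtoC (IZR r) / b)))
       with (b * b * ((RtoC w + u) * (RtoC w + u)) + 2 * Ci * RtoC (IZR r) * (RtoC w + u) + (Ci * Ci) * RtoC (IZR r) * RtoC (IZR r) / (b * b))
       by (field; exact Hb0).
      rewrite Ei. field. exact Hb0.
Qed.

Lemma gauss_limit : exists c, is_lim_half gauss c.
Proof.
  assert (H1 : (Rabs (Im 1) < Re 1)%R) by (simpl; rewrite Rabs_R0; lra).
  destruct (theta_fourier_unfold 1 0 H1 0%Z) as [S [_ HS]]. exists S.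
  intros eps He. destruct (HS eps He) as [N0 HN]. exists N0. intros N l HNN Hl. apply (HN N l HNN).
  revert Hl. apply isInt_ext. intros w. unfold gauss.
  replace (-2 * RtoC PI * Ci * 0 * RtoC w) with (RtoC 0) by ring. rewrite Cexp_0, Cmult_1_r.
  f_equal. ring.
Qed.

(** The value of the Gaussian integral is forced by Poisson summation itself: at [b = 1], [u = 0] both sides
    are multiples, by [1] and by [c], of the same positive sum. *)
Lemma gauss_limit_1 : is_lim_half gauss 1.
Proof.
  destruct gauss_limit as [c Hc].
  assert (H1 : (Rabs (Im 1) < Re 1)%R) by (simpl; rewrite Rabs_R0; lra).
  destruct (poisson_up_to_constant c Hc 1 0 H1) as [s [S1 S2]].
  assert (E1 : hasSum (fun n => RtoC (exp (- PI * (IZR n * IZR n)))) s).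
  { revert S1. apply hasSum_ext. intros n. rewrite <- Cexp_real. f_equal. rewrite !RtoC_mult, RtoC_opp. ring. }
  assert (E2 : s = c * s).
  { apply (hasSum_unique _ _ _ S2). apply (hasSum_scal c) in E1. revert E1. apply hasSum_ext.
    intros n. rewrite <- Cexp_real. replace (c / 1) with c by field. f_equal. f_equal.
    rewrite !RtoC_mult, RtoC_opp. field. }
  assert (Hs : s <> 0).
  { intros E. subst s. destruct (E1 1%R Rlt_0_1) as [L0 HL0].
    destruct (NoDup_cover (0%Z :: L0)) as [L [N HL]].
    specialize (HL0 L N (fun x h => HL x (or_intror h))).
    rewrite Rsum_RtoC in HL0. replace (RtoC (Rsum (fun n => exp (- PI * (IZR n * IZR n))) L) - 0) with
      (RtoC (Rsum (fun n => exp (- PI * (IZR n * IZR n))) L)) in HL0 by ring.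
    rewrite Cmod_R in HL0.
    assert (X : (Rsum (fun n => exp (- PI * (IZR n * IZR n))) (0%Z :: nil) <= Rsum (fun n => exp (- PI * (IZR n * IZR n))) L)%R).
    { apply Rsum_incl; [intros i; apply Rlt_le, exp_pos|constructor; [intros []|constructor]|].
      intros i [<-|[]]. apply HL. left; reflexivity. }
    simpl Rsum in X at 1. rewrite !Rmult_0_r, exp_0 in X.
    pose proof (Rle_abs (Rsum (fun n => exp (- PI * (IZR n * IZR n))) L)). lra. }
  replace (RtoC 1) with c; [exact Hc|].
  replace c with (c * s / s) by (field; exact Hs). rewrite <- E2. field. exact Hs.
Qed.

(** The inversion formula of the Jacobi theta function. Carrying along the square root [b] of the
    modulus [b * b] avoids every choice of branch. *)
Theorem poisson_gauss (b u : C) : (Rabs (Im b) < Re b)%R ->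
  exists s, hasSum (fun n => Cexp (- RtoC PI * (b * b) * ((RtoC (IZR n) + u) * (RtoC (IZR n) + u)))) s /\
  hasSum (fun r => / b * Cexp (- RtoC PI / (b * b) * (RtoC (IZR r) * RtoC (IZR r)) + 2 * RtoC PI * Ci * RtoC (IZR r) * u)) s.
Proof.
  intros Hb. destruct (poisson_up_to_constant 1 gauss_limit_1 b u Hb) as [s [H1 H2]].
  exists s. split; [exact H1|]. revert H2. apply hasSum_ext. intros r.
  replace (1 / b) with (/ b); [reflexivity|]. unfold Cdiv. ring.
Qed.

End Poisson.

(** * The error function *)

Section ErrorFunction.
Local Open Scope R_scope.

Definition gaussR (v : R) : R := exp (- PI * (v * v)).

(** In this normalisation of the error function the limit at infinity is [1/2]. *)
Definition erfG (x : R) : R := RInt gaussR 0 x.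

Lemma gaussR_cont v : continuity_pt gaussR v.
Proof. apply derivable_continuous_pt. unfold gaussR. reg. Qed.

Lemma gaussR_ex a b : ex_RInt gaussR a b.
Proof.
  apply (ex_RInt_continuous (V := R_CompleteNormedModule)). intros v _.
  apply continuity_pt_filterlim, gaussR_cont.
Qed.

Lemma erfG_derive x : derivable_pt_lim erfG x (gaussR x).
Proof.
  apply is_derive_Reals. apply (is_derive_RInt gaussR erfG 0 x).
  - exists (mkposreal 1 Rlt_0_1). intros y _. apply (RInt_correct (V := R_CompleteNormedModule)), gaussR_ex.
  - apply continuity_pt_filterlim, gaussR_cont.
Qed.

Lemma erfG_sub a b : erfG b - erfG a = RInt gaussR a b.
Proof.
  unfold erfG. pose proof (RInt_Chasles (V := R_CompleteNormedModule) gaussR 0 a b (gaussR_ex 0 a) (gaussR_ex a b)) as H.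
  unfold plus in H; simpl in H. rewrite <- H. ring.
Qed.

Lemma erfG_opp x : erfG (- x) = - erfG x.
Proof.
  unfold erfG.
  pose proof (RInt_comp_lin (V := R_CompleteNormedModule) gaussR (-1) 0 0 x) as H.
  replace (-1 * 0 + 0) with 0 in H by ring. replace (-1 * x + 0) with (- x) in H by ring.
  rewrite <- H by apply gaussR_ex.
  rewrite (RInt_ext _ (fun y => scal (-1) (gaussR y))).
  - rewrite (RInt_scal (V := R_CompleteNormedModule)) by apply gaussR_ex.
    unfold scal; simpl; unfold mult; simpl. ring.
  - intros y _. unfold gaussR. do 2 f_equal. ring.
Qed.

Lemma erfG_incr a b : a <= b -> erfG a <= erfG b.
Proof.
  intros H. assert (0 <= erfG b - erfG a); [|lra]. rewrite erfG_sub.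
  apply RInt_ge_0; [exact H|apply gaussR_ex|]. intros; apply Rlt_le, exp_pos.
Qed.

Lemma erfG_lim eps : 0 < eps -> exists N0, forall N, (N0 <= N)%nat -> Rabs (erfG (INR N + 1/2) - 1/2) < eps.
Proof.
  intros He. destruct (gauss_limit_1 eps He) as [N0 H]. exists N0. intros N HN.
  specialize (H N (RtoC (erfG (INR N + 1/2) - erfG (- (INR N + 1/2)))) HN).
  assert (E : Rabs (2 * erfG (INR N + 1/2) - 1) < eps).
  { replace (2 * erfG (INR N + 1/2) - 1) with (erfG (INR N + 1/2) - erfG (- (INR N + 1/2)) - 1)
      by (rewrite erfG_opp; ring).
    rewrite <- Cmod_R, (RtoC_minus _ 1). apply H.
    apply (isInt_ext (fun w => RtoC (gaussR w))).
    { intros w. unfold gaussR. rewrite <- Cexp_real. f_equal. rewrite !RtoC_mult, RtoC_opp. reflexivity. }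
    rewrite erfG_sub. split; simpl.
    - apply (RInt_correct (V := R_CompleteNormedModule)), gaussR_ex.
    - apply (isInt_zero). }
  apply Rabs_def2 in E. apply Rabs_def1; lra.
Qed.

Lemma erfG_le_half x : erfG x <= 1/2.
Proof.
  apply le_epsilon. intros eps He. destruct (erfG_lim eps He) as [N0 H].
  destruct (INR_unbounded x) as [N1 H1]. set (N := Nat.max N0 N1).
  specialize (H N ltac:(lia)). apply Rabs_def2 in H.
  assert (INR N1 <= INR N) by (apply le_INR; lia).
  pose proof (erfG_incr x (INR N + 1/2) ltac:(lra)). lra.
Qed.

(** Substituting [v = x + w] in the tail integral and dropping [exp (- 2 PI x w) <= 1]. *)
Lemma erfG_tail x : 0 <= x -> 1/2 - erfG x <= 1/2 * gaussR x.
Proof.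
  intros Hx. apply le_epsilon. intros eps He. destruct (erfG_lim eps He) as [N0 H].
  destruct (INR_unbounded x) as [N1 H1]. set (N := Nat.max N0 N1).
  specialize (H N ltac:(lia)). apply Rabs_def2 in H.
  assert (INR N1 <= INR N) by (apply le_INR; lia).
  set (M := INR N + 1/2) in *.
  assert (E : erfG M - erfG x <= gaussR x * erfG (M - x)).
  { rewrite erfG_sub. unfold erfG.
    pose proof (RInt_comp_lin (V := R_CompleteNormedModule) gaussR 1 x 0 (M - x)) as H3.
    replace (1 * 0 + x) with x in H3 by ring. replace (1 * (M - x) + x) with M in H3 by ring.
    rewrite <- H3 by apply gaussR_ex.
    replace (gaussR x * RInt gaussR 0 (M - x)) with (scal (gaussR x) (RInt gaussR 0 (M - x))) by reflexivity.
    rewrite <- (RInt_scal (V := R_CompleteNormedModule)) by apply gaussR_ex.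
    apply RInt_le; [unfold M; lra| | |].
    - apply (ex_RInt_comp_lin (V := R_NormedModule)). apply gaussR_ex.
    - apply (ex_RInt_scal (V := R_NormedModule)), gaussR_ex.
    - intros w Hw. unfold scal; simpl; unfold mult; simpl. rewrite Rmult_1_l. unfold gaussR.
      rewrite <- exp_plus. apply exp_le. pose proof PI_RGT_0.
      replace (- PI * ((1 * w + x) * (1 * w + x))) with (- PI * (x * x) + - PI * (w * w) - 2 * (PI * (w * x))) by ring.
      assert (0 <= PI * (w * x)) by (apply Rmult_le_pos; [lra|apply Rmult_le_pos; lra]). lra. }
  pose proof (erfG_le_half (M - x)) as E2.
  assert (gaussR x * erfG (M - x) <= gaussR x * (1/2)) by (apply Rmult_le_compat_l; [apply Rlt_le, exp_pos|exact E2]).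
  lra.
Qed.

(** The odd complementary error function [sgn (rho) / 2 - erfG (kap rho)] at the half-integer
    [rho = r + 1/2]: the non-holomorphic part of the rank function is a series of these. *)
Definition betaZ (kap : R) (r : Z) : R :=
  (if Z_le_dec 0 r then 1/2 else -1/2) - erfG (kap * (IZR r + 1/2)).

Lemma betaZ_bound kap r : 0 < kap -> Rabs (betaZ kap r) <= gaussR (kap * (IZR r + 1/2)).
Proof.
  intros Hk. unfold betaZ. set (x := kap * (IZR r + 1/2)).
  assert (G : 0 < gaussR x) by apply exp_pos.
  destruct (Z_le_dec 0 r) as [Hr|Hr].
  - apply IZR_le in Hr. assert (Hx : 0 <= x) by (apply Rmult_le_pos; lra).
    pose proof (erfG_tail x Hx). pose proof (erfG_le_half x). rewrite Rabs_pos_eq by lra. lra.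
  - assert (Hr' : (r <= -1)%Z) by lia. apply IZR_le in Hr'.
    assert (Hx : 0 <= - x).
    { replace (- x) with (kap * - (IZR r + 1/2)) by (unfold x; ring). apply Rmult_le_pos; lra. }
    pose proof (erfG_tail (- x) Hx) as T. pose proof (erfG_le_half (- x)) as U.
    rewrite erfG_opp in T, U. unfold gaussR in *. replace (- x * - x) with (x * x) in T by ring.
    rewrite <- Rabs_Ropp, Rabs_pos_eq by lra. lra.
Qed.

Lemma betaZ_opp kap r : betaZ kap (- r - 1) = - betaZ kap r.
Proof.
  unfold betaZ.
  replace (kap * (IZR (- r - 1) + 1/2)) with (- (kap * (IZR r + 1/2))) by (rewrite minus_IZR, opp_IZR; field).
  rewrite erfG_opp. destruct (Z_le_dec 0 r), (Z_le_dec 0 (- r - 1)); try lia; lra.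
Qed.

End ErrorFunction.

(** * A damped Mittag-Leffler expansion of the cosecant *)

Section MordellSum.
Local Open Scope C_scope.

Lemma Ci_sq : Ci * Ci = - (1).
Proof. unfold Ci, Cmult, Copp, RtoC; simpl; f_equal; ring. Qed.

Lemma betaZ_term_bound (kap : R) (u : C) : (0 < kap)%R -> exists K, (0 <= K)%R /\
  forall r, (Cmod (RtoC (betaZ kap r) * Cexp (2 * RtoC PI * Ci * RtoC (IZR r + 1/2) * u)) <= K * Zexp r)%R.
Proof.
  intros Hk. pose proof PI_RGT_0 as Hpi.
  set (a := (PI * kap ^ 2 / 2)%R). assert (Ha : (0 < a)%R).
  { unfold a. assert (0 < kap ^ 2)%R by (apply pow_lt, Hk). nra. }
  set (q := Rabs (Im u)). assert (Hq : (0 <= q)%R) by apply Rabs_pos.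
  set (c := (a / 2 + PI * q)%R).
  destruct (gauss_majorant a (2 * PI * q) c Ha) as [K [HK HG]]. exists K. split; [exact HK|]. intros r.
  rewrite Cmod_mult, Cmod_R, Cmod_Cexp. set (t := IZR r).
  eapply Rle_trans; [apply Rmult_le_compat_r; [apply Rlt_le, exp_pos|apply betaZ_bound, Hk]|].
  unfold gaussR. rewrite <- exp_plus. fold t.
  replace (Re (2 * RtoC PI * Ci * RtoC (t + 1/2) * u)) with (- (2 * PI) * (t * Im u + Im u / 2))%R
    by (unfold Ci, Cmult, RtoC, Re, Im; simpl; field).
  apply HG. fold t.
  assert (X1 : (- (Rabs t * q) <= t * Im u)%R).
  { pose proof (Rle_abs (- (t * Im u))) as X. rewrite Rabs_Ropp, Rabs_mult in X. unfold q. lra. }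
  assert (X2 : (- q <= Im u)%R).
  { pose proof (Rle_abs (- Im u)) as X. rewrite Rabs_Ropp in X. unfold q. lra. }
  assert (X3 : (- PI * (kap * (t + 1/2) * (kap * (t + 1/2))) <= a / 2 + - a * t ^ 2)%R).
  { unfold a. assert (0 <= PI * kap ^ 2)%R by (apply Rmult_le_pos; [lra|apply pow2_ge_0]).
    replace (- PI * (kap * (t + 1/2) * (kap * (t + 1/2))))%R with (- (PI * kap ^ 2) * (t + 1/2) ^ 2)%R by ring.
    assert (0 <= PI * kap ^ 2 * ((t + 1) ^ 2 / 2))%R by (apply Rmult_le_pos; [lra|pose proof (pow2_ge_0 (t + 1)); lra]).
    replace (PI * kap ^ 2 / 2 / 2 + - (PI * kap ^ 2 / 2) * t ^ 2)%R with
      (- (PI * kap ^ 2) * (t + 1/2) ^ 2 + PI * kap ^ 2 * ((t + 1) ^ 2 / 2))%R by field. lra. }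
  assert (X4 : (- (2 * PI) * (t * Im u + Im u / 2) <= 2 * PI * (Rabs t * q + q / 2))%R).
  { assert (Y : (- (Rabs t * q + q / 2) <= t * Im u + Im u / 2)%R) by lra.
    apply Rmult_le_compat_l with (r := (2 * PI)%R) in Y; [|lra]. lra. }
  unfold c. lra.
Qed.

(** Write [(-1)^n sin (PI u) / (PI (u + n))] as the integral of [exp (2 PI i (u + n) t)] over
    [|t| <= 1/2], and apply Poisson summation in [n] under the integral sign. The resulting Gaussians
    in [t - r] integrate to the differences [erfG (kap (r + 1/2)) - erfG (kap (r - 1/2))]. The limiting
    values [+-1/2] of [erfG] only contribute at [r = 0] and produce the cosecant; in the rest,
    summation by parts brings back the factor [sin (PI u)], which cancels. *)
Theorem damped_csc (kap : R) (u : C) : (0 < kap)%R ->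
  Cexp (RtoC PI * Ci * u) - Cexp (- (RtoC PI * Ci * u)) <> 0 ->
  exists B, hasSum (fun r => RtoC (betaZ kap r) * Cexp (2 * RtoC PI * Ci * RtoC (IZR r + 1/2) * u)) B /\
  hasSum (fun n => sgnZ n * Cexp (- RtoC (PI / kap ^ 2) * ((u + RtoC (IZR n)) * (u + RtoC (IZR n)))) / (u + RtoC (IZR n)))
   (2 * RtoC PI * Ci / (Cexp (RtoC PI * Ci * u) - Cexp (- (RtoC PI * Ci * u))) + 2 * RtoC PI * Ci * B).
Proof.
  intros Hk HD. set (D := Cexp (RtoC PI * Ci * u) - Cexp (- (RtoC PI * Ci * u))) in *.
  pose proof PI_RGT_0 as Hpi.
  assert (HPI : RtoC PI <> 0) by (intros E; injection E; lra).
  assert (HCi : Ci <> 0) by (intros E; injection E; lra).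
  assert (Hkc : RtoC kap <> 0) by (intros E; injection E; lra).
  assert (H2 : RtoC 2 <> 0) by (intros E; injection E; lra).
  assert (Hun : forall n, u + RtoC (IZR n) <> 0).
  { intros n E. apply HD. unfold D.
    assert (Eu : u = - RtoC (IZR n)) by (replace u with ((u + RtoC (IZR n)) - RtoC (IZR n)) by ring; rewrite E; ring).
    rewrite Eu. replace (- (RtoC PI * Ci * - RtoC (IZR n))) with (RtoC PI * Ci * RtoC (IZR n)) by ring.
    replace (RtoC PI * Ci * - RtoC (IZR n)) with (RtoC PI * Ci * RtoC (IZR (- n))) by (rewrite opp_IZR, RtoC_opp; ring).
    rewrite !Cexp_pi_i, sgnZ_opp. ring. }
  destruct (betaZ_term_bound kap u Hk) as [K [HK HKb]].
  destruct (hasSum_ex _ (fun r => K * Zexp r)%R HKb) as [B HB].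
  { apply summable_scal; [exact HK|apply summable_Zexp]. }
  exists B. split; [exact HB|].
  set (b := RtoC (/ kap)).
  assert (Hik : (0 < / kap)%R) by (apply Rinv_0_lt_compat, Hk).
  assert (Hb : (Rabs (Im b) < Re b)%R) by (unfold b; simpl; rewrite Rabs_R0; exact Hik).
  assert (Hb0 : b <> 0) by (intros E; injection E; lra).
  assert (Eb : b = / RtoC kap) by (unfold b; rewrite RtoC_inv by lra; reflexivity).
  assert (EA : b * b = RtoC (/ kap ^ 2)).
  { unfold b. rewrite <- RtoC_mult. f_equal. field. lra. }
  (* [f n t] are the terms before Poisson summation, [g r t] the terms after it. *)
  set (f := fun (n : Z) (t : R) => Cexp (- RtoC (PI / kap ^ 2) * ((u + RtoC (IZR n)) * (u + RtoC (IZR n))) + 2 * RtoC PI * Ci * (u + RtoC (IZR n)) * RtoC t)).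
  set (g := fun (r : Z) (t : R) => RtoC (kap * gaussR (kap * (t - IZR r))) * Cexp (2 * RtoC PI * Ci * RtoC (IZR r) * u)).
  set (V := fun t => CSeriesZ (fun n => f n t)).
  assert (fb : exists K1, (0 <= K1)%R /\ forall n t, Boule 0 (mkposreal 1 Rlt_0_1) t -> (Cmod (f n t) <= K1 * Zexp n)%R).
  { destruct (gauss_term_bound1 (b * b) (Cmod u + kap ^ 2) (Re_sq_pos b Hb)) as [K1 [HK1 H1]].
    exists K1. split; [exact HK1|]. intros n t Ht. apply (proj1 (Boule01 t)) in Ht.
    set (p := u - Ci * RtoC (t * kap ^ 2)).
    assert (Hp : (Cmod p <= Cmod u + kap ^ 2)%R).
    { unfold p, Cminus. eapply Rle_trans; [apply Cmod_triangle|].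
      rewrite Cmod_opp, Cmod_mult, Cmod_Ci, Cmod_R, Rabs_mult, (Rabs_pos_eq (kap ^ 2)) by apply pow2_ge_0.
      pose proof (pow2_ge_0 kap). apply Rplus_le_compat_l; rewrite Rmult_1_l; rewrite <- (Rmult_1_l (kap ^ 2)) at 2; apply Rmult_le_compat_r; lra. }
    eapply Rle_trans; [|apply (H1 n p Hp)]. unfold f; rewrite !Cmod_Cexp. apply exp_le.
    replace (- RtoC PI * (b * b) * ((RtoC (IZR n) + p) * (RtoC (IZR n) + p))) with
     (- RtoC (PI / kap ^ 2) * ((u + RtoC (IZR n)) * (u + RtoC (IZR n))) + 2 * RtoC PI * Ci * (u + RtoC (IZR n)) * RtoC t + RtoC (PI * kap ^ 2 * (t * t))).
    2:{ unfold p. rewrite EA. unfold Rdiv. rewrite !RtoC_mult, RtoC_inv by (apply pow_nonzero; lra).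
        rewrite RtoC_pow.
        replace ((RtoC (IZR n) + (u - Ci * (RtoC t * RtoC kap ^ 2))) * (RtoC (IZR n) + (u - Ci * (RtoC t * RtoC kap ^ 2))))
         with ((u + RtoC (IZR n)) * (u + RtoC (IZR n)) - 2 * Ci * (u + RtoC (IZR n)) * RtoC t * RtoC kap ^ 2 + (Ci * Ci) * RtoC t * RtoC t * RtoC kap ^ 2 * RtoC kap ^ 2) by ring.
        rewrite Ci_sq. field. exact Hkc. }
    rewrite (Re_plus _ (RtoC _)), Re_RtoC. assert (0 <= PI * kap ^ 2 * (t * t))%R; [|lra].
    apply Rmult_le_pos; [apply Rmult_le_pos; [lra|apply pow2_ge_0]|nra]. }
  destruct fb as [K1 [HK1 fb]].
  assert (HS1 : summable (fun n => K1 * Zexp n)%R) by (apply summable_scal; [exact HK1|apply summable_Zexp]).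
  assert (HV : forall t, Boule 0 (mkposreal 1 Rlt_0_1) t -> hasSum (fun n => f n t) (V t)).
  { intros t Ht. apply (hasSum_CSeriesZ _ (fun n => K1 * Zexp n)%R); [intros n; apply fb, Ht|exact HS1]. }
  assert (gb : exists K2, (0 <= K2)%R /\ forall n t, Boule 0 (mkposreal 1 Rlt_0_1) t -> (Cmod (g n t) <= K2 * Zexp n)%R).
  { set (a := (PI * kap ^ 2 / 2)%R). assert (Ha : (0 < a)%R).
    { unfold a. assert (0 < kap ^ 2)%R by (apply pow_lt, Hk). nra. }
    destruct (gauss_majorant a (2 * PI * Rabs (Im u)) (2 * a) Ha) as [K2 [HK2 HG]].
    exists (kap * K2)%R. split; [apply Rmult_le_pos; lra|].
    intros r t Ht. apply (proj1 (Boule01 t)), Rabs_def2 in Ht. unfold g. rewrite Cmod_mult, Cmod_R, Cmod_Cexp.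
    rewrite Rabs_mult, (Rabs_pos_eq kap), Rabs_pos_eq by (try lra; apply Rlt_le, exp_pos).
    rewrite !(Rmult_assoc kap). apply Rmult_le_compat_l; [lra|].
    unfold gaussR. rewrite <- exp_plus. set (s := IZR r).
    replace (Re (2 * RtoC PI * Ci * RtoC s * u)) with (- (2 * PI) * (s * Im u))%R
      by (unfold Ci, Cmult, RtoC, Re, Im; simpl; ring).
    apply HG. fold s.
    assert (X1 : (- (Rabs s * Rabs (Im u)) <= s * Im u)%R).
    { pose proof (Rle_abs (- (s * Im u))) as X. rewrite Rabs_Ropp, Rabs_mult in X. lra. }
    assert (X3 : (- PI * (kap * (t - s) * (kap * (t - s))) <= 2 * a + - a * s ^ 2)%R).
    { replace (- PI * (kap * (t - s) * (kap * (t - s))))%R with (- (2 * a) * (t - s) ^ 2)%R by (unfold a; field).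
      assert (0 <= a * (2 * (1 - t ^ 2) + (s - 2 * t) ^ 2))%R.
      { apply Rmult_le_pos; [lra|]. pose proof (pow2_ge_0 (s - 2 * t)). nra. }
      nra. }
    apply Rmult_le_compat_l with (r := (2 * PI)%R) in X1; [|lra]. lra. }
  destruct gb as [K2 [HK2 gb]].
  assert (HS2 : summable (fun n => K2 * Zexp n)%R) by (apply summable_scal; [exact HK2|apply summable_Zexp]).
  assert (HVg : forall t, Boule 0 (mkposreal 1 Rlt_0_1) t -> hasSum (fun r => g r t) (V t)).
  { intros t Ht. set (p := u - Ci * RtoC (t * kap ^ 2)).
    destruct (poisson_gauss b p Hb) as [s [P1 P2]].
    assert (E1 : hasSum (fun n => f n t) (RtoC (gaussR (kap * t)) * s)).
    { apply (hasSum_scal (RtoC (gaussR (kap * t)))) in P1. revert P1. apply hasSum_ext. intros n.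
      unfold gaussR, f. rewrite <- Cexp_real, <- Cexp_plus. f_equal. unfold p. rewrite EA. unfold Rdiv.
      rewrite !RtoC_mult, RtoC_opp, RtoC_inv by (apply pow_nonzero; lra). rewrite RtoC_pow.
      replace ((RtoC (IZR n) + (u - Ci * (RtoC t * RtoC kap ^ 2))) * (RtoC (IZR n) + (u - Ci * (RtoC t * RtoC kap ^ 2))))
         with ((u + RtoC (IZR n)) * (u + RtoC (IZR n)) - 2 * Ci * (u + RtoC (IZR n)) * RtoC t * RtoC kap ^ 2 + (Ci * Ci) * RtoC t * RtoC t * RtoC kap ^ 2 * RtoC kap ^ 2) by ring.
      rewrite Ci_sq. field. exact Hkc. }
    rewrite (hasSum_unique _ _ _ (HV t Ht) E1).
    apply (hasSum_scal (RtoC (gaussR (kap * t)))) in P2. revert P2. apply hasSum_ext. intros r.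
    unfold g, gaussR. rewrite RtoC_mult, <- !Cexp_real.
    replace (/ b) with (RtoC kap) by (rewrite Eb; field; exact Hkc).
    replace (Cexp (RtoC (- PI * (kap * t * (kap * t)))) * (RtoC kap * Cexp (- RtoC PI / (b * b) * (RtoC (IZR r) * RtoC (IZR r)) + 2 * RtoC PI * Ci * RtoC (IZR r) * p)))
      with (RtoC kap * (Cexp (RtoC (- PI * (kap * t * (kap * t)))) * Cexp (- RtoC PI / (b * b) * (RtoC (IZR r) * RtoC (IZR r)) + 2 * RtoC PI * Ci * RtoC (IZR r) * p))) by ring.
    rewrite <- (Cmult_assoc (RtoC kap) (Cexp (RtoC (- PI * (kap * (t - IZR r) * (kap * (t - IZR r))))))), <- !Cexp_plus. f_equal. f_equal. unfold p.
    rewrite Eb, !RtoC_mult, RtoC_opp, RtoC_minus, RtoC_pow.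
    replace (2 * RtoC PI * Ci * RtoC (IZR r) * (u - Ci * (RtoC t * RtoC kap ^ 2))) with
     (2 * RtoC PI * Ci * RtoC (IZR r) * u - (Ci * Ci) * 2 * RtoC PI * RtoC (IZR r) * RtoC t * RtoC kap ^ 2) by ring.
    rewrite Ci_sq. field. exact Hkc. }
  set (lf := fun n => D / (2 * RtoC PI * Ci) * (sgnZ n * Cexp (- RtoC (PI / kap ^ 2) * ((u + RtoC (IZR n)) * (u + RtoC (IZR n)))) / (u + RtoC (IZR n)))).
  set (lg := fun r => RtoC (erfG (kap * (IZR r + 1/2)) - erfG (kap * (IZR r - 1/2))) * Cexp (2 * RtoC PI * Ci * RtoC (IZR r) * u)).
  assert (Df : forall n t, isD (f n) t (2 * RtoC PI * Ci * (u + RtoC (IZR n)) * f n t)).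
  { intros n t. eapply isD_eq; [apply isD_Cexp, isD_plus; [apply isD_const|apply isD_scal, isD_RtoC]|].
    unfold f. cbv beta. ring. }
  assert (Dg : forall r t, isD (fun t => RtoC (erfG (kap * (t - IZR r))) * Cexp (2 * RtoC PI * Ci * RtoC (IZR r) * u)) t (g r t)).
  { intros r t. unfold g.
    apply (isD_ext (fun t => Cexp (2 * RtoC PI * Ci * RtoC (IZR r) * u) * RtoC (erfG (kap * (t - IZR r))))); [intros; ring|].
    rewrite (Cmult_comm (RtoC (kap * _))). apply isD_scal. split; simpl; [|apply (derivable_pt_lim_const 0)].
    replace (kap * gaussR (kap * (t - IZR r)))%R with (gaussR (kap * (t - IZR r)) * kap)%R by ring.
    apply (derivable_pt_lim_comp (fun t => kap * (t - IZR r))%R erfG); [|apply erfG_derive].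
    apply is_derive_Reals. auto_derive; [exact I|ring]. }
  assert (Cg : forall r t, contC (g r) t).
  { intros r t. unfold g. apply contC_mult; [|eapply isD_contC, isD_const].
    split; simpl; [|apply continuity_pt_const; intros x y; reflexivity].
    apply derivable_continuous_pt. unfold gaussR. reg. }
  assert (If : forall n, isInt (f n) (- (1/2)) (1/2) (lf n)).
  { intros n. set (w := 2 * RtoC PI * Ci * (u + RtoC (IZR n))).
    assert (Hw : w <> 0) by (unfold w; repeat apply Cmult_neq_0; auto).
    pose proof (isInt_FTC (fun t => / w * f n t) (f n) (- (1/2)) (1/2) ltac:(lra)) as F.
    replace (lf n) with (/ w * f n (1/2)%R - / w * f n (- (1/2))%R).
    - apply F; intros t _.
      + eapply isD_eq; [apply isD_scal, Df|]. fold w. field. exact Hw.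
      + eapply isD_contC, Df.
    - unfold f, lf. rewrite !Cexp_plus. set (ee := Cexp (- RtoC (PI / kap ^ 2) * ((u + RtoC (IZR n)) * (u + RtoC (IZR n))))).
      replace (2 * RtoC PI * Ci * (u + RtoC (IZR n)) * RtoC (1/2)) with (RtoC PI * Ci * u + RtoC PI * Ci * RtoC (IZR n))
        by (rewrite RtoC_div by lra; field; exact H2).
      replace (2 * RtoC PI * Ci * (u + RtoC (IZR n)) * RtoC (- (1/2))) with (- (RtoC PI * Ci * u) + RtoC PI * Ci * RtoC (IZR (- n)))
        by (rewrite opp_IZR, !RtoC_opp, RtoC_div by lra; field; exact H2).
      rewrite !Cexp_plus, !Cexp_pi_i, sgnZ_opp. unfold D, w. field. auto. }
  assert (Ig : forall r, isInt (g r) (- (1/2)) (1/2) (lg r)).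
  { intros r. pose proof (isInt_FTC _ (g r) (- (1/2)) (1/2) ltac:(lra) (fun t _ => Dg r t) (fun t _ => Cg r t)) as F.
    cbv beta in F.
    replace (lg r) with (RtoC (erfG (kap * (1/2 - IZR r))) * Cexp (2 * RtoC PI * Ci * RtoC (IZR r) * u) -
      RtoC (erfG (kap * (- (1/2) - IZR r))) * Cexp (2 * RtoC PI * Ci * RtoC (IZR r) * u)); [exact F|].
    unfold lg. replace (kap * (1/2 - IZR r))%R with (- (kap * (IZR r - 1/2)))%R by ring.
    replace (kap * (- (1/2) - IZR r))%R with (- (kap * (IZR r + 1/2)))%R by ring.
    rewrite !erfG_opp, RtoC_minus, !RtoC_opp. ring. }
  assert (Hin : forall t, (- (1/2) <= t <= 1/2)%R -> Boule 0 (mkposreal 1 Rlt_0_1) t).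
  { intros t Ht. apply Boule01, Rabs_def1; lra. }
  destruct (dominated_isInt f V (fun n => K1 * Zexp n)%R 0 (mkposreal 1 Rlt_0_1)) with (A := (- (1/2))%R) (B := (1/2)%R) (l := lf) as [S1 [IV1 HlS1]]; auto; [intros n t _; eapply isD_contC, Df|lra|].
  destruct (dominated_isInt g V (fun n => K2 * Zexp n)%R 0 (mkposreal 1 Rlt_0_1)) with (A := (- (1/2))%R) (B := (1/2)%R) (l := lg) as [S2 [IV2 HlS2]]; auto; [lra|].
  rewrite <- (isInt_unique _ _ _ _ _ IV1 IV2) in HlS2.
  (* [erfG = sgn / 2 - betaZ]; shifting [r] by one in half of the [betaZ] terms produces [D * B]. *)
  assert (HlS3 : hasSum lg (1 + D * B)).
  { assert (Q1 : hasSum (fun r => RtoC (betaZ kap r) * Cexp (2 * RtoC PI * Ci * RtoC (IZR r) * u)) (Cexp (- (RtoC PI * Ci * u)) * B)).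
    { pose proof (hasSum_scal (Cexp (- (RtoC PI * Ci * u))) _ _ HB) as Q. revert Q. apply hasSum_ext. intros r.
      rewrite Cmult_assoc, (Cmult_comm (Cexp _) (RtoC _)), <- Cmult_assoc, <- Cexp_plus. f_equal. f_equal.
      rewrite RtoC_plus, RtoC_div by lra. field. }
    assert (Q2 : hasSum (fun r => RtoC (betaZ kap (r - 1)) * Cexp (2 * RtoC PI * Ci * RtoC (IZR r) * u)) (Cexp (RtoC PI * Ci * u) * B)).
    { pose proof (hasSum_scal (Cexp (RtoC PI * Ci * u)) _ _ HB) as Q.
      apply (hasSum_reindex (fun r => (r - 1)%Z) (fun r => (r + 1)%Z)) in Q; [|intros; lia|intros; lia].
      revert Q. apply hasSum_ext. intros r.
      rewrite Cmult_assoc, (Cmult_comm (Cexp _) (RtoC _)), <- Cmult_assoc, <- Cexp_plus. f_equal. f_equal.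
      rewrite RtoC_plus, RtoC_div, minus_IZR, RtoC_minus by lra. field. }
    pose proof (hasSum_single (fun r : Z => if Z.eq_dec r 0 then 1 else 0) 0%Z) as Q3. simpl in Q3.
    assert (Q3' : hasSum (fun r : Z => if Z.eq_dec r 0 then 1 else 0) 1).
    { apply Q3. intros i Hi. destruct (Z.eq_dec i 0); [contradiction|reflexivity]. }
    replace (1 + D * B) with (1 + ((-1) * (Cexp (- (RtoC PI * Ci * u)) * B) + Cexp (RtoC PI * Ci * u) * B)) by (unfold D; ring).
    pose proof (hasSum_plus _ _ _ _ Q3' (hasSum_plus _ _ _ _ (hasSum_scal (-1) _ _ Q1) Q2)) as Q.
    revert Q. apply hasSum_ext. intros r. unfold lg, betaZ.
    replace (kap * (IZR (r - 1) + 1/2))%R with (kap * (IZR r - 1/2))%R by (rewrite minus_IZR; field).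
    destruct (Z.eq_dec r 0) as [->|Hr].
    - destruct (Z_le_dec 0 0); [|lia]. destruct (Z_le_dec 0 (0 - 1)); [lia|].
      replace (2 * RtoC PI * Ci * 0 * u) with (RtoC 0) by ring. rewrite Cexp_0, !RtoC_minus.
      replace (RtoC (-1/2)) with (RtoC (1/2) - 1) by (rewrite <- RtoC_minus; f_equal; lra). ring.
    - destruct (Z_le_dec 0 r), (Z_le_dec 0 (r - 1)); try lia; rewrite !RtoC_minus; ring. }
  pose proof (hasSum_unique _ _ _ HlS3 HlS2) as ES. rewrite <- ES in HlS1.
  apply (hasSum_scal (2 * RtoC PI * Ci / D)) in HlS1.
  replace (2 * RtoC PI * Ci / D + 2 * RtoC PI * Ci * B) with (2 * RtoC PI * Ci / D * (1 + D * B)) by (field; exact HD).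
  revert HlS1. apply hasSum_ext. intros n. unfold lf. field. auto.
Qed.

End MordellSum.

(** * Euler's product and the pentagonal number theorem *)

Section EtaProduct.
Local Open Scope C_scope.

Lemma qpow_plus z r s : qpow z (r + s) = qpow z r * qpow z s.
Proof.
  unfold qpow. rewrite <- Cexp_plus. f_equal. rewrite !RtoC_mult, RtoC_plus. ring.
Qed.

Lemma qpow_0 z : qpow z 0 = 1.
Proof.
  unfold qpow. rewrite Rmult_0_r. replace (0 * Ci * z) with (RtoC 0) by ring. apply Cexp_0.
Qed.

Lemma qpow_opp z r : qpow z (- r) = / qpow z r.
Proof.
  unfold qpow. rewrite <- Cexp_opp. f_equal. rewrite !RtoC_mult, RtoC_opp. ring.
Qed.

Lemma qpow_neq_0 z r : qpow z r <> 0.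
Proof. apply Cexp_neq_0. Qed.

Lemma Cmod_qpow z r : Cmod (qpow z r) = exp (- (2 * PI * r * Im z)).
Proof.
  unfold qpow. rewrite Cmod_Cexp. f_equal. unfold Ci, Cmult, RtoC, Re, Im; simpl. ring.
Qed.

Lemma qpoch_partial_S z n : qpoch_partial z (S n) = qpoch_partial z n * (1 - qpow z (INR (S n))).
Proof. reflexivity. Qed.

Section Upper.
Variable z : C.
Hypothesis Hz : upper_half_plane z.

Let rho := exp (- (2 * PI * Im z)).

Lemma rho_bounds : (0 < rho < 1)%R.
Proof.
  unfold rho. split; [apply exp_pos|]. rewrite <- exp_0. apply exp_increasing.
  pose proof PI_RGT_0. unfold upper_half_plane in Hz. nra.
Qed.

Lemma Cmod_qpow_INR n : Cmod (qpow z (INR n)) = (rho ^ n)%R.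
Proof.
  rewrite Cmod_qpow. unfold rho. induction n as [|n IH].
  - simpl. rewrite Rmult_0_r, Rmult_0_l, Ropp_0. apply exp_0.
  - rewrite <- tech_pow_Rmult, <- IH, <- exp_plus, S_INR. f_equal. ring.
Qed.

Lemma rho_pow_le n : (0 < rho ^ S n <= rho)%R.
Proof.
  destruct rho_bounds as [H0 H1]. split; [apply pow_lt, H0|].
  rewrite <- tech_pow_Rmult. assert (rho ^ n <= 1)%R by (rewrite <- (pow1 n); apply pow_incr; lra).
  assert (0 <= rho ^ n)%R by (apply pow_le; lra). nra.
Qed.

Let G (n : nat) : R := (rho * (1 - rho ^ n) / (1 - rho))%R.

Lemma G_S n : G (S n) = (G n + rho ^ S n)%R.
Proof. unfold G. destruct rho_bounds. rewrite <- tech_pow_Rmult. field. lra. Qed.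

Lemma G_bound n : (0 <= G n <= rho / (1 - rho))%R.
Proof.
  unfold G. destruct rho_bounds as [H0 H1].
  assert (B0 : (0 < rho ^ n)%R) by (apply pow_lt; lra).
  assert (B1 : (rho ^ n <= 1)%R) by (rewrite <- (pow1 n); apply pow_incr; lra).
  split; [apply Rdiv_le_0_compat; [apply Rmult_le_pos; lra|lra]|].
  unfold Rdiv. apply Rmult_le_compat_r; [apply Rlt_le, Rinv_0_lt_compat; lra|nra].
Qed.

(** Multiply the inequalities [1 - x >= exp (- x / (1 - rho))], valid for [0 <= x <= rho]; [G n] is the
    geometric sum [rho + ... + rho ^ n]. *)
Lemma qpoch_partial_lower n : (exp (- (G n / (1 - rho))) <= Cmod (qpoch_partial z n))%R.
Proof.
  destruct rho_bounds as [H0 H1]. induction n as [|n IH].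
  - simpl. rewrite Cmod_1. unfold G. simpl. replace (- (rho * (1 - 1) / (1 - rho) / (1 - rho)))%R with 0%R by (field; lra).
    rewrite exp_0. lra.
  - rewrite qpoch_partial_S, Cmod_mult, G_S.
    replace (- ((G n + rho ^ S n) / (1 - rho)))%R with (- (G n / (1 - rho)) + - (rho ^ S n / (1 - rho)))%R by (field; lra).
    rewrite exp_plus. apply Rmult_le_compat; try (apply Rlt_le, exp_pos); [exact IH|].
    destruct (rho_pow_le n) as [P0 P1]. set (x := (rho ^ S n)%R) in *.
    assert (L : (1 - x <= Cmod (1 - qpow z (INR (S n))))%R).
    { unfold x. rewrite <- Cmod_qpow_INR. pose proof (Cmod_triangle (1 - qpow z (INR (S n))) (qpow z (INR (S n)))) as T.
      replace (1 - qpow z (INR (S n)) + qpow z (INR (S n))) with (RtoC 1) in T by ring. rewrite Cmod_1 in T. lra. }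
    eapply Rle_trans; [|exact L]. rewrite exp_Ropp.
    assert (E : (1 + x / (1 - rho) <= exp (x / (1 - rho)))%R) by apply exp_ineq1_le.
    assert (E2 : (/ (1 - x) <= 1 + x / (1 - rho))%R).
    { apply Rmult_le_reg_r with (1 - x)%R; [lra|]. rewrite Rinv_l by lra.
      apply Rmult_le_reg_r with (1 - rho)%R; [lra|].
      replace ((1 + x / (1 - rho)) * (1 - x) * (1 - rho))%R with ((1 - rho + x) * (1 - x))%R by (field; lra). nra. }
    rewrite <- (Rinv_inv (1 - x)). apply Rinv_le_contravar; [apply Rinv_0_lt_compat; lra|lra].
Qed.

Lemma qpoch_partial_lower' : exists m, (0 < m)%R /\ forall n, (m <= Cmod (qpoch_partial z n))%R.
Proof.
  destruct rho_bounds as [H0 H1]. exists (exp (- (rho / (1 - rho) / (1 - rho)))). split; [apply exp_pos|].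
  intros n. eapply Rle_trans; [|apply qpoch_partial_lower]. apply exp_le. apply Ropp_le_contravar.
  apply Rmult_le_compat_r; [apply Rlt_le, Rinv_0_lt_compat; lra|apply G_bound].
Qed.

Lemma qpoch_partial_neq_0 n : qpoch_partial z n <> 0.
Proof.
  intros E. destruct qpoch_partial_lower' as [m [Hm H]]. specialize (H n). rewrite E, Cmod_0 in H. lra.
Qed.

Lemma qpoch_partial_ratio k n : (k <= n)%nat ->
  (Cmod (qpoch_partial z n / qpoch_partial z k) <= exp (rho / (1 - rho)))%R.
Proof.
  intros Hkn.
  assert (H : (Cmod (qpoch_partial z n / qpoch_partial z k) <= exp (G n - G k))%R).
  { induction Hkn as [|n Hkn IH].
    - unfold Cdiv. rewrite Cinv_r by apply qpoch_partial_neq_0. rewrite Cmod_1, Rminus_diag, exp_0. lra.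
    - rewrite qpoch_partial_S.
      replace (qpoch_partial z n * (1 - qpow z (INR (S n))) / qpoch_partial z k) with
        (qpoch_partial z n / qpoch_partial z k * (1 - qpow z (INR (S n)))) by (unfold Cdiv; ring).
      rewrite Cmod_mult, G_S. replace (G n + rho ^ S n - G k)%R with (G n - G k + rho ^ S n)%R by ring.
      rewrite exp_plus. apply Rmult_le_compat; try apply Cmod_ge_0; [exact IH|].
      eapply Rle_trans; [|apply exp_ineq1_le]. unfold Cminus. eapply Rle_trans; [apply Cmod_triangle|].
      rewrite Cmod_1, Cmod_opp, Cmod_qpow_INR. lra. }
  eapply Rle_trans; [exact H|]. apply exp_le. pose proof (G_bound n). pose proof (G_bound k). lra.
Qed.

(** Shanks' finite form of the pentagonal number theorem. With [P n] the truncated product, the sum over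
    [k <= n] of [a n k = (-1)^k (P n / P k) q^(n k + k (k + 1) / 2)] equals the truncated pentagonal
    series exactly, and as [n] grows only its term [k = 0], which is [P n], survives. *)
Let P (n : nat) := qpoch_partial z n.
Let sg (n : nat) := sgnZ (Z.of_nat n).
Let a (n k : nat) : C := sg k * (P n / P k) * qpow z (INR n * INR k + INR k * (INR k + 1) / 2).
Let A (n K : nat) : C := Csum (a n) (seq 0 K).
Let pent (k : Z) : C := sgnZ k * qpow z (IZR k * (3 * IZR k + 1) / 2).

Lemma A_S n K : A n (S K) = A n K + a n K.
Proof. unfold A. rewrite seq_S, Csum_app. simpl. ring. Qed.

Lemma sg_S n : sg (S n) = - sg n.
Proof. unfold sg. rewrite Nat2Z.inj_succ. unfold Z.succ. rewrite sgnZ_plus, sgnZ_1. ring. Qed.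

(** Passing from [n] to [n + 1], the differences of the terms telescope in [k]. *)
Lemma shanks_step n K : (K <= n)%nat ->
  A (S n) (S K) - A n (S K) = - (sg K * (P n / P K) * qpow z (INR n * INR K + INR K * (INR K + 1) / 2 + (INR n + 1 + INR K))).
Proof.
  intros HK. induction K as [|K IH].
  - unfold A, a, sg. cbn [seq Csum]. rewrite INR_0. replace (sgnZ (Z.of_nat 0)) with (RtoC 1) by reflexivity.
    replace (INR (S n) * 0 + 0 * (0 + 1) / 2)%R with 0%R by field.
    replace (INR n * 0 + 0 * (0 + 1) / 2)%R with 0%R by field.
    replace (0 + (INR n + 1 + 0))%R with (INR (S n)) by (rewrite S_INR; ring).
    rewrite qpow_0. unfold P. rewrite qpoch_partial_S. field. apply qpoch_partial_neq_0.
  - rewrite (A_S (S n)), (A_S n).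
    replace (A (S n) (S K) + a (S n) (S K) - (A n (S K) + a n (S K))) with
      ((A (S n) (S K) - A n (S K)) + (a (S n) (S K) - a n (S K))) by ring.
    rewrite IH by lia. unfold a. rewrite sg_S.
    assert (N1 : P K <> 0) by apply qpoch_partial_neq_0.
    assert (N2 : P (S K) <> 0) by apply qpoch_partial_neq_0.
    assert (EK : P (S K) = P K * (1 - qpow z (INR (S K)))) by apply qpoch_partial_S.
    assert (EN : P (S n) = P n * (1 - qpow z (INR (S n)))) by apply qpoch_partial_S.
    assert (N3 : 1 - qpow z (INR (S K)) <> 0) by (intros E; apply N2; rewrite EK, E; ring).
    rewrite EN, EK. rewrite !S_INR in *.
    set (Q := qpow z (INR n * (INR K + 1) + (INR K + 1) * (INR K + 1 + 1) / 2)).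
    set (qk := qpow z (INR K + 1)) in *. set (qn := qpow z (INR n + 1)) in *.
    replace (qpow z (INR n * INR K + INR K * (INR K + 1) / 2 + (INR n + 1 + INR K))) with Q
      by (unfold Q; f_equal; field).
    replace (qpow z ((INR n + 1) * (INR K + 1) + (INR K + 1) * (INR K + 1 + 1) / 2)) with (Q * qk)
      by (unfold Q, qk; rewrite <- qpow_plus; f_equal; field).
    replace (qpow z (INR n * (INR K + 1) + (INR K + 1) * (INR K + 1 + 1) / 2 + (INR n + 1 + (INR K + 1)))) with (Q * qk * qn)
      by (unfold Q, qk, qn; rewrite <- !qpow_plus; f_equal; field).
    field. split; assumption.
Qed.

Lemma shanks n : A n (S n) = Csum pent (Zint n).
Proof.
  induction n as [|n IH].
  - unfold A, a, Zint, pent, sg, P. simpl. replace (0 * 0 + 0 * (0 + 1) / 2)%R with 0%R by field.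
    replace (0 * (3 * 0 + 1) / 2)%R with 0%R by field. unfold sgnZ; simpl. field.
  - rewrite Csum_Zint_S, <- IH, A_S. pose proof (shanks_step n n (le_n n)) as H.
    replace (A (S n) (S n) + a (S n) (S n)) with (A n (S n) + ((A (S n) (S n) - A n (S n)) + a (S n) (S n))) by ring.
    f_equal. rewrite H. unfold a, pent. rewrite sgnZ_opp. fold (sg (S n)). rewrite sg_S.
    rewrite opp_IZR, <- INR_IZR_INZ, !S_INR.
    replace (P n / P n) with (RtoC 1) by (unfold P; field; apply qpoch_partial_neq_0).
    replace (P (S n) / P (S n)) with (RtoC 1) by (unfold P; field; apply qpoch_partial_neq_0).
    replace (- (INR n + 1) * (3 * - (INR n + 1) + 1) / 2)%R with
      (INR n * INR n + INR n * (INR n + 1) / 2 + (INR n + 1 + INR n))%R by field.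
    replace ((INR n + 1) * (3 * (INR n + 1) + 1) / 2)%R with
      ((INR n + 1) * (INR n + 1) + (INR n + 1) * (INR n + 1 + 1) / 2)%R by field.
    ring.
Qed.

Lemma pent_bound : exists K, (0 <= K)%R /\ forall k, (Cmod (pent k) <= K * Zexp k)%R.
Proof.
  unfold upper_half_plane in Hz. pose proof PI_RGT_0 as Hpi.
  set (y := Im z) in *. assert (Hy : (0 < PI * y)%R) by (apply Rmult_lt_0_compat; lra).
  destruct (gauss_majorant (3 * (PI * y)) (PI * y) 0 ltac:(lra)) as [K [HK HG]]. exists K. split; [exact HK|].
  intros k. unfold pent. rewrite Cmod_mult, Cmod_sgnZ, Rmult_1_l, Cmod_qpow. fold y. apply HG. set (t := IZR k).
  replace (- (2 * PI * (t * (3 * t + 1) / 2) * y))%R with (- (3 * (PI * y)) * t ^ 2 + (PI * y) * - t)%R by field.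
  pose proof (Rle_abs (- t)) as X. rewrite Rabs_Ropp in X.
  apply Rmult_le_compat_l with (r := (PI * y)%R) in X; lra.
Qed.

Lemma n_exp_small c : (0 < c)%R -> forall n, (0 < n)%R -> (n * exp (- (c * n)) <= 4 / (c ^ 2 * n))%R.
Proof.
  intros Hc n Hn. assert (Hcn : (0 < c * n)%R) by (apply Rmult_lt_0_compat; lra).
  rewrite exp_Ropp. assert (E : (c * n * (c * n) / 4 <= exp (c * n))%R).
  { replace (c * n)%R with (c * n / 2 + c * n / 2)%R at 3 by field. rewrite exp_plus.
    pose proof (exp_ineq1_le (c * n / 2)). nra. }
  pose proof (exp_pos (c * n)) as E0.
  assert (Hc2 : (0 < c ^ 2 * n)%R) by (apply Rmult_lt_0_compat; [apply pow_lt; lra|lra]).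
  apply Rmult_le_reg_r with (exp (c * n) * (c ^ 2 * n))%R; [apply Rmult_lt_0_compat; lra|].
  replace (n * / exp (c * n) * (exp (c * n) * (c ^ 2 * n)))%R with (c * n * (c * n))%R by (field; lra).
  replace (4 / (c ^ 2 * n) * (exp (c * n) * (c ^ 2 * n)))%R with (4 * exp (c * n))%R by (field; lra). lra.
Qed.

(** In [shanks] the terms with [k >= 1] have modulus at most a constant times [|q|^n], so that their
    sum is [O(n |q|^n)]. *)
Theorem pentagonal : hasSum (fun k => sgnZ k * qpow z (IZR k * (3 * IZR k + 1) / 2)) (qpoch z) /\ qpoch z <> 0.
Proof.
  destruct pent_bound as [K [HK HKb]].
  assert (HS : hasSum pent (CSeriesZ pent)).
  { apply (hasSum_CSeriesZ _ (fun k => K * Zexp k)%R HKb). apply summable_scal; [exact HK|apply summable_Zexp]. }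
  assert (HL : forall eps, (0 < eps)%R -> exists N, forall n, (N <= n)%nat -> (Cmod (qpoch_partial z n - CSeriesZ pent) < eps)%R).
  { intros eps He. destruct (hasSum_Zint _ _ HS (eps / 2)%R ltac:(lra)) as [N1 H1].
    set (c := (2 * PI * Im z)%R).
    assert (Hc : (0 < c)%R) by (unfold c, upper_half_plane in *; pose proof PI_RGT_0; apply Rmult_lt_0_compat; lra).
    set (E := exp (rho / (1 - rho))). assert (HE : (0 < E)%R) by apply exp_pos.
    destruct (INR_unbounded (8 * E / (c ^ 2 * eps))) as [N2 H2].
    exists (Nat.max 1 (Nat.max N1 N2)). intros n Hn.
    specialize (H1 n ltac:(lia)). rewrite <- shanks in H1.
    assert (Hn0 : (0 < INR n)%R) by (apply lt_0_INR; lia).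
    assert (HnN : (INR N2 <= INR n)%R) by (apply le_INR; lia).
    assert (X : (Cmod (qpoch_partial z n - A n (S n)) <= E * (INR n * exp (- (c * INR n))))%R).
    { unfold A. cbn [seq Csum].
      assert (Ea0 : a n 0%nat = qpoch_partial z n).
      { unfold a, sg, P. simpl INR. replace (INR n * 0 + 0 * (0 + 1) / 2)%R with 0%R by field.
        rewrite qpow_0. unfold sgnZ; simpl. field. }
      rewrite Ea0. replace (qpoch_partial z n - (qpoch_partial z n + Csum (a n) (seq 1 n))) with (- Csum (a n) (seq 1 n)) by ring.
      rewrite Cmod_opp. eapply Rle_trans; [apply Cmod_Csum_le|].
      apply Rle_trans with (Rsum (fun _ : nat => E * exp (- (c * INR n)))%R (seq 1 n)).
      - apply Rsum_le. intros k Hk. apply in_seq in Hk. unfold a, P. rewrite !Cmod_mult. unfold sg. rewrite Cmod_sgnZ, Rmult_1_l.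
        apply Rmult_le_compat; try apply Cmod_ge_0; [apply qpoch_partial_ratio; lia|].
        rewrite Cmod_qpow. apply exp_le. unfold c.
        assert (K1 : (1 <= INR k)%R) by (apply (le_INR 1); lia).
        assert (B : (INR n <= INR n * INR k + INR k * (INR k + 1) / 2)%R) by nra.
        apply Rmult_le_compat_l with (r := (2 * PI * Im z)%R) in B; [|unfold c in Hc; lra]. lra.
      - rewrite Rsum_const, length_seq. right. ring. }
    assert (Y : (E * (INR n * exp (- (c * INR n))) < eps / 2)%R).
    { pose proof (n_exp_small c Hc (INR n) Hn0) as B.
      apply Rle_lt_trans with (E * (4 / (c ^ 2 * INR n)))%R; [apply Rmult_le_compat_l; lra|].
      assert (Hc2 : (0 < c ^ 2)%R) by (apply pow_lt; lra).
      apply Rmult_lt_reg_r with (c ^ 2 * INR n)%R; [apply Rmult_lt_0_compat; lra|].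
      replace (E * (4 / (c ^ 2 * INR n)) * (c ^ 2 * INR n))%R with (4 * E)%R by (field; lra).
      assert (Z : (8 * E / (c ^ 2 * eps) < INR n)%R) by lra.
      apply Rmult_lt_compat_r with (r := (c ^ 2 * eps)%R) in Z; [|apply Rmult_lt_0_compat; lra].
      replace (8 * E / (c ^ 2 * eps) * (c ^ 2 * eps))%R with (8 * E)%R in Z by (field; lra). lra. }
    replace (qpoch_partial z n - CSeriesZ pent) with ((qpoch_partial z n - A n (S n)) + (A n (S n) - CSeriesZ pent)) by ring.
    eapply Rle_lt_trans; [apply Cmod_triangle|]. lra. }
  assert (Eq : qpoch z = CSeriesZ pent) by (apply CLim_seq_eq, HL).
  rewrite Eq. split; [exact HS|].
  intros Z. destruct qpoch_partial_lower' as [m [Hm Hmb]]. destruct (HL m Hm) as [N HN].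
  specialize (HN N (le_n N)). rewrite Z in HN. replace (qpoch_partial z N - 0) with (qpoch_partial z N) in HN by ring.
  specialize (Hmb N). lra.
Qed.

Lemma eta_hasSum : hasSum (fun k => sgnZ k * qpow z ((6 * IZR k + 1) ^ 2 / 24)) (eta z).
Proof.
  destruct pentagonal as [H _]. unfold eta. apply (hasSum_scal (qpow z (1 / 24))) in H.
  revert H. apply hasSum_ext. intros k.
  replace ((6 * IZR k + 1) ^ 2 / 24)%R with (1 / 24 + IZR k * (3 * IZR k + 1) / 2)%R by field.
  rewrite qpow_plus. ring.
Qed.

Lemma eta_neq_0 : eta z <> 0.
Proof. unfold eta. apply Cmult_neq_0; [apply qpow_neq_0|apply pentagonal]. Qed.

End Upper.
End EtaProduct.

(** * Theta sums that collapse to eta *)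

Section Collapse.
Local Open Scope C_scope.
Variable z : C.
Hypothesis Hz : upper_half_plane z.

Lemma eta_class_pos n :
  hasSum (fun m => sgnZ m * qpow z ((6 * IZR m + (6 * IZR n + 1)) ^ 2 / 24)) (sgnZ n * eta z).
Proof.
  pose proof (hasSum_reindex (fun m => (m + n)%Z) (fun m => (m - n)%Z) _ _ ltac:(intros; cbv beta; lia) ltac:(intros; cbv beta; lia) (eta_hasSum z Hz)) as H.
  apply (hasSum_scal (sgnZ n)) in H. revert H. apply hasSum_ext. intros m.
  rewrite sgnZ_plus, plus_IZR.
  replace (6 * (IZR m + IZR n) + 1)%R with (6 * IZR m + (6 * IZR n + 1))%R by ring.
  transitivity ((sgnZ n * sgnZ n) * (sgnZ m * qpow z ((6 * IZR m + (6 * IZR n + 1)) ^ 2 / 24))); [ring|].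
  rewrite sgnZ_sq. ring.
Qed.

Lemma eta_class_neg n :
  hasSum (fun m => sgnZ m * qpow z ((6 * IZR m + (6 * IZR n + 5)) ^ 2 / 24)) (sgnZ (n + 1) * eta z).
Proof.
  pose proof (hasSum_reindex (fun m => (- m - n - 1)%Z) (fun m => (- m - n - 1)%Z) _ _ ltac:(intros; cbv beta; lia) ltac:(intros; cbv beta; lia) (eta_hasSum z Hz)) as H.
  apply (hasSum_scal (sgnZ (n + 1))) in H. revert H. apply hasSum_ext. intros m.
  replace (- m - n - 1)%Z with (- m + - (n + 1))%Z by ring.
  rewrite (sgnZ_plus (- m)), plus_IZR, !opp_IZR, plus_IZR, !sgnZ_opp.
  replace ((6 * (- IZR m + - (IZR n + 1)) + 1) ^ 2)%R with ((6 * IZR m + (6 * IZR n + 5)) ^ 2)%R by ring.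
  transitivity ((sgnZ (n + 1) * sgnZ (n + 1)) * (sgnZ m * qpow z ((6 * IZR m + (6 * IZR n + 5)) ^ 2 / 24))); [ring|].
  rewrite sgnZ_sq. ring.
Qed.

Lemma eta_class_zero n s :
  hasSum (fun m => sgnZ m * qpow z ((6 * IZR m + (6 * IZR n + 3)) ^ 2 / 24)) s -> s = 0.
Proof.
  intros H.
  pose proof (hasSum_reindex (fun m => (- m - 2 * n - 1)%Z) (fun m => (- m - 2 * n - 1)%Z) _ _ ltac:(intros; cbv beta; lia) ltac:(intros; cbv beta; lia) H) as H'.
  assert (E : s = (-1) * s).
  { apply (hasSum_unique _ _ _ H'). apply (hasSum_scal (-1)) in H. revert H. apply hasSum_ext. intros m.
    replace (- m - 2 * n - 1)%Z with (- (m + (2 * n + 1)))%Z by ring.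
    rewrite sgnZ_opp, sgnZ_plus, opp_IZR, !plus_IZR, mult_IZR.
    assert (E1 : sgnZ (2 * n + 1) = -1).
    { unfold sgnZ. rewrite Z.even_add, Z.even_mul. reflexivity. }
    rewrite E1.
    replace ((6 * - (IZR m + (2 * IZR n + 1)) + (6 * IZR n + 3)) ^ 2)%R with ((6 * IZR m + (6 * IZR n + 3)) ^ 2)%R by ring.
    ring. }
  assert (E2 : (2 : C) * s = 0) by (replace (2 * s) with (s + s) by ring; rewrite E at 1; ring).
  replace s with (/ 2 * (2 * s)) by (field; intros Q; injection Q; lra). rewrite E2. ring.
Qed.

(** Completing the square [3 m^2 / 2 + m rho = (6 m + k)^2 / 24 - k^2 / 24] with [k = 2 rho], the sum
    over [m] only sees the class of the odd number [k] modulo 6: it is [+- eta] for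
    [k = +-1 (mod 6)] and vanishes by antisymmetry when 3 divides [k]. The indices [r = 3 n] and
    [r = - 3 n - 1] in the conclusion are those with [k = 6 n + 1] and [k = - (6 n + 1)]. *)
Theorem eta_collapse (g : Z -> C) (K : R) : (0 <= K)%R ->
  (forall m r, (Cmod (sgnZ m * qpow z (3 * IZR m ^ 2 / 2 + IZR m * (IZR r + 1/2)) * g r) <= K * (Zexp m * Zexp r))%R) ->
  exists T, hasSum (fun mr => sgnZ (fst mr) * qpow z (3 * IZR (fst mr) ^ 2 / 2 + IZR (fst mr) * (IZR (snd mr) + 1/2)) * g (snd mr)) (eta z * T) /\
  hasSum (fun n => sgnZ n * qpow z (- ((6 * IZR n + 1) ^ 2 / 24)) * (g (3 * n)%Z + g (- (3 * n) - 1)%Z)) T.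
Proof.
  intros HK Hb.
  set (f := fun mr : Z * Z => sgnZ (fst mr) * qpow z (3 * IZR (fst mr) ^ 2 / 2 + IZR (fst mr) * (IZR (snd mr) + 1/2)) * g (snd mr)).
  assert (S2 : summable (fun mr : Z * Z => K * (Zexp (fst mr) * Zexp (snd mr)))%R)
    by (apply summable_scal; [exact HK|apply summable_Zexp2]).
  destruct (hasSum_ex f _ (fun mr => Hb (fst mr) (snd mr)) S2) as [s Hs].
  set (ks := fun r : Z => (2 * IZR r + 1)%R).
  assert (Hf : forall m r, f (m, r) = qpow z (- (ks r ^ 2 / 24)) * g r * (sgnZ m * qpow z ((6 * IZR m + ks r) ^ 2 / 24))).
  { intros m r. unfold f, ks. simpl fst. simpl snd.
    replace (3 * IZR m ^ 2 / 2 + IZR m * (IZR r + 1/2))%R with (- ((2 * IZR r + 1) ^ 2 / 24) + (6 * IZR m + (2 * IZR r + 1)) ^ 2 / 24)%R by field.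
    rewrite qpow_plus. ring. }
  destruct (choice_fun (fun r t => hasSum (fun m => f (m, r)) t)) as [S HS].
  { intros r. apply (hasSum_ex _ (fun m => K * Zexp r * Zexp m)%R).
    - intros m. eapply Rle_trans; [apply (Hb m r)|right; ring].
    - apply summable_scal; [apply Rmult_le_pos; [exact HK|apply Zexp_pos]|apply summable_Zexp]. }
  assert (HSs : hasSum S s).
  { apply (hasSum_fubini (fun rm => f (snd rm, fst rm))); [apply hasSum_swap, Hs|exact HS]. }
  destruct summable_Zexp as [M HM].
  assert (HM0 : (0 <= M)%R) by (specialize (HM nil (NoDup_nil _)); exact HM).
  assert (HSb : forall r, (Cmod (S r) <= K * M * Zexp r)%R).
  { intros r. apply (hasSum_bound (fun m => f (m, r)) (S r)); [|apply HS].
    intros L N. eapply Rle_trans; [apply Cmod_Csum_le|].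
    eapply Rle_trans; [apply Rsum_le; intros m _; apply (Hb m r)|].
    simpl snd; simpl fst. rewrite (Rsum_scal K (fun m => (Zexp m * Zexp r)%R)).
    replace (K * M * Zexp r)%R with (K * (Zexp r * M))%R by ring. apply Rmult_le_compat_l; [exact HK|].
    eapply Rle_trans; [right|apply Rmult_le_compat_l; [apply Zexp_pos|apply (HM L N)]].
    rewrite <- Rsum_scal. clear. induction L as [|m L IH]; simpl; [reflexivity|rewrite IH; ring]. }
  assert (HKM : (0 <= K * M)%R) by (apply Rmult_le_pos; assumption).
  assert (sub : forall j, exists t, hasSum (fun n => S (3 * n + j)%Z) t).
  { intros j. apply (hasSum_ex _ (fun n => K * M * Zexp (3 * n + j))%R); [intros n; apply HSb|].
    apply (summable_inj (fun n => (3 * n + j)%Z) (fun r => K * M * Zexp r)%R); [intros; lia|].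
    apply summable_scal; [exact HKM|apply summable_Zexp]. }
  destruct (sub 0%Z) as [s0 H0]. destruct (sub 2%Z) as [s2 H2].
  assert (V0 : forall n, S (3 * n + 0)%Z = eta z * (sgnZ n * qpow z (- ((6 * IZR n + 1) ^ 2 / 24)) * g (3 * n)%Z)).
  { intros n. rewrite Z.add_0_r. apply (hasSum_unique _ _ _ (HS (3 * n)%Z)).
    assert (Ek : ks (3 * n)%Z = (6 * IZR n + 1)%R) by (unfold ks; rewrite mult_IZR; ring).
    pose proof (hasSum_scal (qpow z (- ((6 * IZR n + 1) ^ 2 / 24)) * g (3 * n)%Z) _ _ (eta_class_pos n)) as H.
    replace (eta z * (sgnZ n * qpow z (- ((6 * IZR n + 1) ^ 2 / 24)) * g (3 * n)%Z)) with
     (qpow z (- ((6 * IZR n + 1) ^ 2 / 24)) * g (3 * n)%Z * (sgnZ n * eta z)) by ring.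
    revert H. apply hasSum_ext. intros m. rewrite Hf, Ek. reflexivity. }
  assert (V1 : forall n, S (3 * n + 1)%Z = 0).
  { intros n. 
    assert (Ek : ks (3 * n + 1)%Z = (6 * IZR n + 3)%R) by (unfold ks; rewrite plus_IZR, mult_IZR; ring).
    destruct (classic (g (3 * n + 1)%Z = 0)) as [G0|G0].
    - apply (hasSum_unique _ _ _ (HS (3 * n + 1)%Z)). eapply hasSum_ext; [|apply hasSum_zero].
      intros m. rewrite Hf, G0. ring.
    - set (c := qpow z (- (ks (3 * n + 1)%Z ^ 2 / 24)) * g (3 * n + 1)%Z).
      assert (Hc : c <> 0) by (apply Cmult_neq_0; [apply qpow_neq_0|exact G0]).
      pose proof (hasSum_scal (/ c) _ _ (HS (3 * n + 1)%Z)) as H.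
      assert (E : / c * S (3 * n + 1)%Z = 0).
      { apply (eta_class_zero n). revert H. apply hasSum_ext. intros m. rewrite Hf. fold c. rewrite Ek.
        rewrite Cmult_assoc. replace (/ c * c) with (RtoC 1) by (field; exact Hc). ring. }
      replace (S (3 * n + 1)%Z) with (c * (/ c * S (3 * n + 1)%Z)) by (field; exact Hc). rewrite E. ring. }
  assert (V2 : forall n, S (3 * n + 2)%Z = eta z * (sgnZ (n + 1) * qpow z (- ((6 * IZR n + 5) ^ 2 / 24)) * g (3 * n + 2)%Z)).
  { intros n. apply (hasSum_unique _ _ _ (HS (3 * n + 2)%Z)).
    assert (Ek : ks (3 * n + 2)%Z = (6 * IZR n + 5)%R) by (unfold ks; rewrite plus_IZR, mult_IZR; ring).
    pose proof (hasSum_scal (qpow z (- ((6 * IZR n + 5) ^ 2 / 24)) * g (3 * n + 2)%Z) _ _ (eta_class_neg n)) as H.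
    replace (eta z * (sgnZ (n + 1) * qpow z (- ((6 * IZR n + 5) ^ 2 / 24)) * g (3 * n + 2)%Z)) with
     (qpow z (- ((6 * IZR n + 5) ^ 2 / 24)) * g (3 * n + 2)%Z * (sgnZ (n + 1) * eta z)) by ring.
    revert H. apply hasSum_ext. intros m. rewrite Hf, Ek. reflexivity. }
  pose proof (eta_neq_0 z Hz) as He.
  assert (Es : s = s0 + (0 + s2)).
  { apply (hasSum_unique _ _ _ HSs). apply hasSum_mod3; [|eapply hasSum_ext; [|apply hasSum_zero]; intros n; rewrite V1; reflexivity|exact H2].
    revert H0. apply hasSum_ext. intros n. rewrite Z.add_0_r. reflexivity. }
  exists (/ eta z * s). split.
  - replace (eta z * (/ eta z * s)) with s by (field; exact He). exact Hs.
  - rewrite Es. apply (hasSum_reindex (fun n => (- n - 1)%Z) (fun n => (- n - 1)%Z)) in H2; [|intros; lia|intros; lia].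
    pose proof (hasSum_scal (/ eta z) _ _ (hasSum_plus _ _ _ _ H0 H2)) as H.
    replace (s0 + (0 + s2)) with (s0 + s2) by ring. revert H. apply hasSum_ext. intros n.
    rewrite V0, V2.
    replace (3 * (- n - 1) + 2)%Z with (- (3 * n) - 1)%Z by ring.
    replace (sgnZ (- n - 1 + 1)) with (sgnZ n) by (rewrite <- (sgnZ_opp n); f_equal; ring).
    rewrite minus_IZR, opp_IZR.
    replace ((6 * (- IZR n - 1) + 5) ^ 2)%R with ((6 * IZR n + 1) ^ 2)%R by ring.
    field. exact He.
Qed.

End Collapse.

(** * The rank function as a lattice sum *)

Section Lattice.
Local Open Scope C_scope.

Definition lattice_pt (x : R) (z : C) (mn : Z * Z) : C := RtoC x + RtoC (IZR (fst mn)) * z + RtoC (IZR (snd mn)).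

Definition rank_lattice (x : R) (z : C) (mn : Z * Z) : C :=
  sgnZ (fst mn * snd mn + fst mn + snd mn) * Cexp (RtoC (- (3 * PI * IZR (fst mn) * x)) * Ci) *
  Cexp (- RtoC (3 * PI / (2 * Im z)) * (lattice_pt x z mn * Cconj (lattice_pt x z mn))) / lattice_pt x z mn.

Variables (x : R) (z : C).
Hypothesis Hx : (0 < x < 1)%R.
Hypothesis Hz : upper_half_plane z.

Let y := Im z.

Lemma y_pos : (0 < y)%R.
Proof. exact Hz. Qed.

Lemma Cmod_sq_RI w : (Cmod w ^ 2 = Re w ^ 2 + Im w ^ 2)%R.
Proof.
  unfold Cmod. rewrite pow2_sqrt; [reflexivity|]. pose proof (pow2_ge_0 (fst w)). pose proof (pow2_ge_0 (snd w)). lra.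
Qed.

Lemma Cmul_conj_real w : w * Cconj w = RtoC (Cmod w ^ 2).
Proof. symmetry. apply Cmod2_conj. Qed.

Lemma lattice_pt_ReIm m n : Re (lattice_pt x z (m, n)) = (x + IZR m * Re z + IZR n)%R /\ Im (lattice_pt x z (m, n)) = (IZR m * y)%R.
Proof. unfold lattice_pt, y, Cplus, Cmult, RtoC, Re, Im; simpl. split; ring. Qed.

Lemma IZR_sq_ge_1 m : (m <> 0)%Z -> (1 <= IZR m ^ 2)%R.
Proof.
  intros H. replace (IZR m ^ 2)%R with (IZR (m * m)) by (rewrite mult_IZR; ring). apply (IZR_le 1). nia.
Qed.

Lemma lattice_pt_lower : exists w0, (0 < w0)%R /\ forall mn, (w0 <= Cmod (lattice_pt x z mn))%R.
Proof.
  pose proof y_pos as Hy.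
  exists (Rmin y (Rmin x (1 - x))). split; [repeat apply Rmin_pos; lra|].
  intros [m n]. destruct (lattice_pt_ReIm m n) as [E1 E2].
  destruct (Z.eq_dec m 0) as [->|Hm].
  - eapply Rle_trans; [apply Rmin_r|]. eapply Rle_trans; [|apply Rabs_Re_le_Cmod]. rewrite E1.
    replace (x + 0 * Re z + IZR n)%R with (x + IZR n)%R by ring.
    destruct (Z_le_dec 0 n) as [Hn|Hn].
    + apply IZR_le in Hn. eapply Rle_trans; [apply Rmin_l|]. rewrite Rabs_pos_eq; lra.
    + assert (Hn' : (n <= -1)%Z) by lia. apply IZR_le in Hn'. eapply Rle_trans; [apply Rmin_r|].
      rewrite <- Rabs_Ropp, Rabs_pos_eq; lra.
  - eapply Rle_trans; [apply Rmin_l|]. eapply Rle_trans; [|apply Rabs_Im_le_Cmod]. rewrite E2, Rabs_mult, (Rabs_pos_eq y) by lra.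
    assert (1 <= Rabs (IZR m))%R.
    { rewrite <- abs_IZR. apply (IZR_le 1). lia. }
    nra.
Qed.

(** The quadratic form [|m z + p|^2] is positive definite; the shift of [n] by [x] costs the
    constant [1]. *)
Lemma lattice_pt_quad : exists c, (0 < c)%R /\ forall m n, (c * (IZR m ^ 2 + IZR n ^ 2) - 1 <= Cmod (lattice_pt x z (m, n)) ^ 2)%R.
Proof.
  pose proof y_pos as Hy. set (X := Re z). set (N := (X ^ 2 + y ^ 2 + 1)%R).
  assert (HN : (0 < N)%R) by (unfold N; pose proof (pow2_ge_0 X); pose proof (pow2_ge_0 y); lra).
  exists (y ^ 2 / (2 * N))%R. split; [apply Rdiv_lt_0_compat; [apply pow_lt, Hy|lra]|].
  intros m n. destruct (lattice_pt_ReIm m n) as [E1 E2]. rewrite Cmod_sq_RI, E1, E2. fold X.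
  set (s := IZR m). set (t := IZR n). 
  set (p := (x + s * X + t)%R).
  assert (Q : (y ^ 2 * (s ^ 2 + (t + x) ^ 2) <= N * (p ^ 2 + (s * y) ^ 2))%R).
  { replace (t + x)%R with (p - s * X)%R by (unfold p; ring). unfold N.
    assert (0 <= (X * p + s * y * y) ^ 2)%R by apply pow2_ge_0.
    assert (0 <= p ^ 2)%R by apply pow2_ge_0. 
    replace ((X ^ 2 + y ^ 2 + 1) * (p ^ 2 + (s * y) ^ 2) - y ^ 2 * (s ^ 2 + (p - s * X) ^ 2))%R with
      ((X * p + s * y * y) ^ 2 + p ^ 2)%R in * by ring.
    assert (E : ((X ^ 2 + y ^ 2 + 1) * (p ^ 2 + (s * y) ^ 2) - y ^ 2 * (s ^ 2 + (p - s * X) ^ 2) = (X * p + s * y * y) ^ 2 + p ^ 2)%R) by ring.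
    lra. }
  assert (Q2 : (t ^ 2 / 2 - 1 <= (t + x) ^ 2)%R).
  { pose proof (pow2_ge_0 (t + 2 * x)). nra. }
  assert (Q3 : (y ^ 2 / N * (s ^ 2 / 2 + t ^ 2 / 2 - 1) <= p ^ 2 + (s * y) ^ 2)%R).
  { apply Rmult_le_reg_r with N; [exact HN|].
    replace (y ^ 2 / N * (s ^ 2 / 2 + t ^ 2 / 2 - 1) * N)%R with (y ^ 2 * (s ^ 2 / 2 + t ^ 2 / 2 - 1))%R by (field; lra).
    assert (y ^ 2 * (s ^ 2 / 2 + t ^ 2 / 2 - 1) <= y ^ 2 * (s ^ 2 + (t + x) ^ 2))%R; [|lra].
    apply Rmult_le_compat_l; [apply pow2_ge_0|]. pose proof (pow2_ge_0 s). lra. }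
  assert (Q4 : (y ^ 2 / N <= 1)%R).
  { apply Rmult_le_reg_r with N; [exact HN|]. replace (y ^ 2 / N * N)%R with (y ^ 2)%R by (field; lra).
    unfold N. pose proof (pow2_ge_0 X). lra. }
  replace (y ^ 2 / (2 * N) * (s ^ 2 + t ^ 2))%R with (y ^ 2 / N * (s ^ 2 / 2 + t ^ 2 / 2 - 1) + y ^ 2 / N)%R by (field; lra).
  lra.
Qed.

Lemma rank_lattice_bound : exists K, (0 <= K)%R /\ forall mn, (Cmod (rank_lattice x z mn) <= K * (Zexp (fst mn) * Zexp (snd mn)))%R.
Proof.
  pose proof y_pos as Hy. pose proof PI_RGT_0 as Hpi.
  destruct lattice_pt_lower as [w0 [Hw0 HW]]. destruct lattice_pt_quad as [c [Hc HQ]].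
  set (k := (3 * PI / (2 * y))%R). assert (Hk : (0 < k)%R) by (apply Rdiv_lt_0_compat; lra).
  assert (Hkc : (0 < k * c)%R) by (apply Rmult_lt_0_compat; assumption).
  destruct (gauss_majorant2 (k * c) k Hkc) as [K [HK HG]].
  exists (/ w0 * K)%R. split; [apply Rmult_le_pos; [apply Rlt_le, Rinv_0_lt_compat, Hw0|exact HK]|].
  intros [m n]. unfold rank_lattice. simpl fst. simpl snd. fold y. fold k.
  specialize (HW (m, n)). specialize (HQ m n). set (W := lattice_pt x z (m, n)) in *.
  assert (HW0 : W <> 0) by (apply Cmod_gt_0; lra).
  rewrite Cmod_div by exact HW0. rewrite !Cmod_mult, Cmod_sgnZ, Cmul_conj_real, !Cmod_Cexp.
  replace (Re (RtoC (- (3 * PI * IZR m * x)) * Ci)) with 0%R by (unfold Ci, Cmult, RtoC, Re; simpl; ring).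
  replace (Re (- RtoC k * RtoC (Cmod W ^ 2))) with (- k * Cmod W ^ 2)%R by (unfold Cmult, Copp, RtoC, Re; simpl; ring).
  rewrite exp_0, !Rmult_1_l.
  unfold Rdiv. rewrite Rmult_comm, (Rmult_assoc (/ w0)).
  apply Rmult_le_compat; [apply Rlt_le, Rinv_0_lt_compat; lra|apply Rlt_le, exp_pos|apply Rinv_le_contravar; lra|].
  apply HG. apply Rmult_le_compat_l with (r := k) in HQ; lra.
Qed.

Let Dm (m : Z) : C := Cexp (RtoC PI * Ci * (RtoC x + RtoC (IZR m) * z)) - Cexp (- (RtoC PI * Ci * (RtoC x + RtoC (IZR m) * z))).

Lemma sin_pix_pos : (0 < sin (x * PI))%R.
Proof. pose proof PI_RGT_0. apply sin_gt_0; nra. Qed.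

Lemma Dm_0 : Dm 0 = 2 * Ci * RtoC (sin (x * PI)).
Proof.
  unfold Dm. replace (RtoC PI * Ci * (RtoC x + 0 * z)) with (RtoC (x * PI) * Ci) by (rewrite RtoC_mult; ring).
  replace (- (RtoC (x * PI) * Ci)) with (RtoC (- (x * PI)) * Ci) by (rewrite RtoC_opp; ring).
  rewrite !Cexp_Rmult_i, cos_neg, sin_neg. unfold Cminus, Cplus, Copp, Cmult, Ci, RtoC; simpl. f_equal; ring.
Qed.

Lemma Dm_neq_0 m : Dm m <> 0.
Proof.
  pose proof y_pos as Hy. pose proof PI_RGT_0 as Hpi.
  destruct (Z.eq_dec m 0) as [->|Hm].
  - rewrite Dm_0. pose proof sin_pix_pos. repeat apply Cmult_neq_0; intros E; injection E; lra.
  - intros E. unfold Dm in E. set (w := RtoC PI * Ci * (RtoC x + RtoC (IZR m) * z)) in *.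
    assert (E' : Cexp w = Cexp (- w)) by (replace (Cexp w) with ((Cexp w - Cexp (- w)) + Cexp (- w)) by ring; rewrite E; ring).
    apply (f_equal Cmod) in E'. rewrite !Cmod_Cexp in E'. apply exp_inv in E'.
    replace (Re (- w)) with (- Re w)%R in E' by reflexivity.
    assert (Re w = - (PI * (IZR m * y)))%R by (unfold w, y, Ci, Cmult, Cplus, RtoC, Re, Im; simpl; ring).
    assert (Hm' : IZR m <> 0%R) by (apply not_0_IZR, Hm).
    assert (PI * (IZR m * y) <> 0)%R by (apply Rmult_integral_contrapositive_currified; [lra|apply Rmult_integral_contrapositive_currified; lra]). lra.
Qed.

(** The terms [m] and [-m] combine into one term of the series defining [calN]: with
    [e = exp (PI i x)] and [t = q^(m/2)] this is the partial fraction identity checked in [Hpair]. *)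
Lemma calN_csc s : hasSum (fun m => sgnZ m * qpow z (3 * IZR m ^ 2 / 2) * (2 * Ci / Dm m)) s ->
  s = eta z * calN x z.
Proof.
  intros Hs. set (h := fun m => sgnZ m * qpow z (3 * IZR m ^ 2 / 2) * (2 * Ci / Dm m)) in *.
  pose proof sin_pix_pos as Hsin. set (si := sin (x * PI)) in *.
  assert (Hsc : RtoC si <> 0) by (intros E; injection E; lra).
  assert (H2i : 2 * Ci <> 0) by (intros E; injection E; lra).
  set (ser := fun m : nat =>
         let n := INR (S m) in
         RtoC ((-1) ^ S m) * (1 + qpow z n) * RtoC (2 - 2 * cos (2 * PI * x))
         / (1 - RtoC (2 * cos (2 * PI * x)) * qpow z n + qpow z (2 * n))
         * qpow z (1 / 2 * n * (3 * n + 1))).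
  assert (H0 : h 0%Z = / RtoC si).
  { unfold h. rewrite Dm_0. fold si. replace (3 * 0 ^ 2 / 2)%R with 0%R by field. rewrite qpow_0. unfold sgnZ; simpl.
    field. split; [exact Hsc|]. intros E; injection E; lra. }
  assert (Hpair : forall m : nat, h (Z.of_nat (S m)) + h (- Z.of_nat (S m))%Z = / RtoC si * ser m).
  { intros m. unfold ser. set (n := INR (S m)). cbv zeta.
    unfold h. rewrite sgnZ_opp, opp_IZR, <- INR_IZR_INZ. fold n.
    replace (3 * (- n) ^ 2 / 2)%R with (3 * n ^ 2 / 2)%R by field.
    replace (RtoC ((-1) ^ S m)) with (sgnZ (Z.of_nat (S m))).
    2:{ generalize (S m). clear. induction n as [|n IH]; [reflexivity|].
        rewrite Nat2Z.inj_succ. unfold Z.succ. rewrite sgnZ_plus, sgnZ_1, IH. simpl pow. rewrite RtoC_mult. ring. }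
    set (e := Cexp (RtoC (x * PI) * Ci)). set (t := qpow z (n / 2)).
    assert (He : e <> 0) by apply Cexp_neq_0. assert (Ht : t <> 0) by apply qpow_neq_0.
    assert (D1 : Dm (Z.of_nat (S m)) = e * t - / (e * t)).
    { unfold Dm. rewrite Cexp_opp, <- INR_IZR_INZ. fold n. replace (Cexp (RtoC PI * Ci * (RtoC x + RtoC n * z))) with (e * t); [reflexivity|].
      unfold e, t, qpow. rewrite <- Cexp_plus. f_equal. rewrite !RtoC_mult, RtoC_div by lra. field. }
    assert (D2 : Dm (- Z.of_nat (S m)) = e / t - t / e).
    { unfold Dm. rewrite Cexp_opp, opp_IZR, <- INR_IZR_INZ. fold n. rewrite RtoC_opp.
      replace (Cexp (RtoC PI * Ci * (RtoC x + - RtoC n * z))) with (e / t); [field; split; assumption|].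
      unfold e, t, qpow, Cdiv. rewrite <- Cexp_opp, <- Cexp_plus. f_equal. rewrite !RtoC_mult, RtoC_div by lra. field. }
    pose proof (Dm_neq_0 (Z.of_nat (S m))) as N1. pose proof (Dm_neq_0 (- Z.of_nat (S m))) as N2.
    rewrite D1 in *. rewrite D2 in *.
    assert (Q1 : qpow z n = t * t) by (unfold t; rewrite <- qpow_plus; f_equal; field).
    assert (Q2 : qpow z (2 * n) = t * t * (t * t)) by (unfold t; rewrite <- !qpow_plus; f_equal; field).
    assert (Q3 : qpow z (1 / 2 * n * (3 * n + 1)) = qpow z (3 * n ^ 2 / 2) * t) by (unfold t; rewrite <- qpow_plus; f_equal; field).
    rewrite Q1, Q2, Q3.
    assert (C2 : RtoC (2 * cos (2 * PI * x)) = e * e + / (e * e)).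
    { unfold e. rewrite <- Cexp_plus, <- Cexp_opp.
      replace (RtoC (x * PI) * Ci + RtoC (x * PI) * Ci) with (RtoC (2 * PI * x) * Ci) by (rewrite !RtoC_mult; ring).
      rewrite Cexp_add_opp. reflexivity. }
    assert (S2 : 2 * Ci * RtoC si = e - / e).
    { unfold e. rewrite <- Cexp_opp. replace (- (RtoC (x * PI) * Ci)) with (RtoC (- (x * PI)) * Ci) by (rewrite RtoC_opp; ring).
      rewrite !Cexp_Rmult_i, cos_neg, sin_neg. unfold si, Cminus, Cplus, Copp, Cmult, Ci, RtoC; simpl. f_equal; ring. }
    assert (Es : RtoC si = (e - / e) / (2 * Ci)) by (rewrite <- S2; field; intros E; injection E; lra).
    assert (HCi : Ci <> 0) by (intros E; injection E; lra).
    assert (He2 : e * e - 1 <> 0).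
    { intros E. apply Hsc. rewrite Es. replace (e - / e) with ((e * e - 1) / e) by (field; exact He). rewrite E. field. split; assumption. }
    assert (M1 : e * t * (e * t) - 1 <> 0).
    { intros E. apply N1. replace (e * t - / (e * t)) with ((e * t * (e * t) - 1) / (e * t)) by (field; split; assumption). rewrite E. field. split; assumption. }
    assert (M2 : e * e - t * t <> 0).
    { intros E. apply N2. replace (e / t - t / e) with ((e * e - t * t) / (t * e)) by (field; split; assumption). rewrite E. field. split; assumption. }
    assert (M3 : 1 - RtoC (2 * cos (2 * PI * x)) * (t * t) + t * t * (t * t) <> 0).
    { rewrite C2. replace (1 - (e * e + / (e * e)) * (t * t) + t * t * (t * t)) with ((e * t * (e * t) - 1) * - (e * e - t * t) / (e * e)) by (field; exact He).
      unfold Cdiv. repeat apply Cmult_neq_0; try assumption.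
      - intros E. apply M2. replace (e * e - t * t) with (- - (e * e - t * t)) by ring. rewrite E. ring.
      - intros E. assert (Z : e * e * / (e * e) = 1) by (field; exact He). rewrite E in Z. replace (e * e * 0) with (RtoC 0) in Z by ring. injection Z; lra. }
    rewrite RtoC_minus, C2, Es. rewrite C2 in M3.
    set (sg := sgnZ (Z.of_nat (S m))). set (Q := qpow z (3 * n ^ 2 / 2)).
    assert (E4 : Ci * Ci = - (1)) by apply Ci_sq.
    transitivity (sg * Q * (2 * Ci) * (e * t / (e * t * (e * t) - 1) + e * t / (e * e - t * t))).
    { field. repeat split; try assumption. }
    transitivity (sg * Q * (2 * Ci) * (e * t * (1 + t * t) * (e * e - 1)) / ((e * t * (e * t) - 1) * (e * e - t * t))).
    { field. split; assumption. }
    transitivity (/ ((e - / e) / (2 * Ci)) * (sg * (1 + t * t) * (2 - (e * e + / (e * e))) * (e * e) / - ((e * t * (e * t) - 1) * (e * e - t * t)) * (Q * t))).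
    - field. repeat split; assumption.
    - f_equal. f_equal.
      replace (1 - (e * e + / (e * e)) * (t * t) + t * t * (t * t)) with ((e * t * (e * t) - 1) * - (e * e - t * t) / (e * e)) by (field; exact He).
      field. repeat split; try assumption. }
  assert (HP : CSeries ser = RtoC si * s - 1).
  { unfold CSeries, is_series.
    apply (@iota_filterlim_locally C_AbsRing C_CompleteNormedModule nat eventually _ (sum_n ser) (RtoC si * s - 1)).
    apply filterlim_C_iff. intros eps Heps.
    destruct (hasSum_Zint _ _ (hasSum_scal (RtoC si) _ _ Hs) eps Heps) as [N HN].
    exists N. intros n Hn. specialize (HN (S n) ltac:(lia)).
    replace (sum_n (G := C_AbelianMonoid) ser n - (RtoC si * s - 1)) with (Csum (fun i => RtoC si * h i) (Zint (S n)) - RtoC si * s); [exact HN|].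
    assert (E : Csum (fun i => RtoC si * h i) (Zint (S n)) = 1 + sum_n (G := C_AbelianMonoid) ser n).
    { clear HN Hn. induction n as [|n IH].
      - rewrite Csum_Zint_S, sum_O. replace (ser 0%nat) with (RtoC si * (/ RtoC si * ser 0%nat)) by (field; exact Hsc).
        rewrite <- Hpair. unfold Zint. simpl seq. cbn [map Csum]. simpl Z.sub. rewrite H0. field. exact Hsc.
      - rewrite Csum_Zint_S, IH, sum_Sn. change (plus ?u ?v) with (u + v).
        replace (ser (S n)) with (RtoC si * (/ RtoC si * ser (S n))) by (field; exact Hsc).
        rewrite <- Hpair. ring. }
    rewrite E. ring. }
  unfold calN. fold ser. rewrite HP. fold si. unfold eta.
  destruct (pentagonal z Hz) as [_ Hq]. rewrite qpow_opp. rewrite RtoC_inv by lra.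
  field. repeat split; try assumption. apply qpow_neq_0.
Qed.

(** With this value [PI / kap ^ 2 = 3 PI / (2 y)], the Gaussian rate in [rank_lattice]. *)
Let kap := sqrt (2 * y / 3).

Lemma kap_sq : (kap ^ 2 = 2 * y / 3)%R.
Proof. unfold kap. apply pow2_sqrt. pose proof y_pos. lra. Qed.

Lemma kap_pos : (0 < kap)%R.
Proof. apply sqrt_lt_R0. pose proof y_pos. lra. Qed.

Let g (r : Z) : C := RtoC (betaZ kap r) * Cexp (RtoC (2 * PI * (IZR r + 1/2) * x) * Ci).

(** Since [|betaZ| <= exp (- PI kap^2 rho^2)] and [kap^2 = 2 y / 3], the exponent is
    [- PI y (3 m^2 + 2 m rho + 2 rho^2 / 3)], a negative definite form. *)
Lemma beta_family_bound : exists K, (0 <= K)%R /\ forall m r,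
  (Cmod (sgnZ m * qpow z (3 * IZR m ^ 2 / 2 + IZR m * (IZR r + 1/2)) * g r) <= K * (Zexp m * Zexp r))%R.
Proof.
  pose proof y_pos as Hy. pose proof PI_RGT_0 as Hpi. pose proof kap_pos as Hk.
  set (a := (PI * y / 8)%R). assert (Ha : (0 < a)%R) by (unfold a; assert (0 < PI * y)%R by (apply Rmult_lt_0_compat; lra); lra).
  destruct (gauss_majorant2 a a Ha) as [K [HK HG]]. exists K. split; [exact HK|].
  intros m r. unfold g. rewrite !Cmod_mult, Cmod_sgnZ, Cmod_qpow, Cmod_R, Cmod_Cexp, Rmult_1_l.
  replace (Re (RtoC (2 * PI * (IZR r + 1/2) * x) * Ci)) with 0%R by (unfold Ci, Cmult, RtoC, Re; simpl; ring).
  rewrite exp_0, Rmult_1_r.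
  eapply Rle_trans; [apply Rmult_le_compat_l; [apply Rlt_le, exp_pos|apply betaZ_bound, Hk]|].
  unfold gaussR. rewrite <- exp_plus. set (s := IZR m). set (t := IZR r). fold y.
  replace (- PI * (kap * (t + 1/2) * (kap * (t + 1/2))))%R with (- PI * (kap ^ 2) * (t + 1/2) ^ 2)%R by ring.
  rewrite kap_sq.
  apply HG. fold s t. set (q := (t + 1/2)%R).
  (* The form stays positive after subtracting [(s^2 + q^2) / 4], as [(3 - 1/4) (2/3 - 1/4) > 1]. *)
  assert (Q : (0 <= (3 - 1/4) * s ^ 2 + 2 * (s * q) + (2/3 - 1/4) * q ^ 2)%R).
  { pose proof (pow2_ge_0 (11/4 * s + q)). pose proof (pow2_ge_0 q). nra. }
  assert (Q2 : (t ^ 2 / 2 - 1 / 2 <= q ^ 2)%R) by (unfold q; pose proof (pow2_ge_0 (t + 1)); nra).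
  assert (Q4 : (1/8 * (s ^ 2 + t ^ 2) - 1/8 <= 3 * s ^ 2 + 2 * (s * q) + 2/3 * q ^ 2)%R) by (pose proof (pow2_ge_0 s); lra).
  apply Rmult_le_compat_l with (r := (PI * y)%R) in Q4; [|apply Rmult_le_pos; lra].
  replace (- (2 * PI * (3 * s ^ 2 / 2 + s * q) * y) + - PI * (2 * y / 3) * q ^ 2)%R with
    (- (PI * y * (3 * s ^ 2 + 2 * (s * q) + 2/3 * q ^ 2)))%R by field. unfold a. lra.
Qed.

(** Summing over [n] first, [damped_csc] gives a cosecant for each [m], whence [eta * calN], and a
    double series of error functions, which [eta_collapse] reduces to [eta] times a single series. *)
Theorem rank_lattice_sum : exists T,
  hasSum (fun n => sgnZ n * qpow z (- ((6 * IZR n + 1) ^ 2 / 24)) *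
     (RtoC (betaZ (sqrt (2 * Im z / 3)) (3 * n)) * RtoC (sin (PI * x * (6 * IZR n + 1))))) T /\
  hasSum (rank_lattice x z) (RtoC PI * (eta z * (calN x z - 4 * T))).
Proof.
  pose proof y_pos as Hy. pose proof PI_RGT_0 as Hpi.
  assert (H2i : 2 * Ci <> 0) by (intros E; injection E; lra).
  assert (HPI : RtoC PI <> 0) by (intros E; injection E; lra).
  destruct rank_lattice_bound as [K [HK HKb]].
  destruct (hasSum_ex (rank_lattice x z) _ HKb) as [L HL]; [apply summable_scal; [exact HK|apply summable_Zexp2]|].
  destruct beta_family_bound as [K2 [HK2 HK2b]].
  destruct (eta_collapse z Hz g K2 HK2 HK2b) as [T2 [HT1 HT2]].
  destruct (choice_fun (fun m B =>
    hasSum (fun r => RtoC (betaZ kap r) * Cexp (2 * RtoC PI * Ci * RtoC (IZR r + 1/2) * (RtoC x + RtoC (IZR m) * z))) B /\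
    hasSum (fun n => rank_lattice x z (m, n)) (sgnZ m * qpow z (3 * IZR m ^ 2 / 2) * (2 * RtoC PI * Ci / Dm m + 2 * RtoC PI * Ci * B)))) as [Bf HB].
  { intros m. destruct (damped_csc kap (RtoC x + RtoC (IZR m) * z) kap_pos (Dm_neq_0 m)) as [B [HB1 HB2]].
    exists B. split; [exact HB1|]. fold (Dm m) in HB2.
    apply (hasSum_scal (sgnZ m * qpow z (3 * IZR m ^ 2 / 2))) in HB2. revert HB2. apply hasSum_ext. intros n.
    unfold rank_lattice. simpl fst. simpl snd. change (RtoC x + RtoC (IZR m) * z + RtoC (IZR n)) with (lattice_pt x z (m, n)).
    set (W := lattice_pt x z (m, n)). fold y.
    assert (EC : Cconj W = W - 2 * Ci * RtoC (IZR m * y)).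
    { unfold W, lattice_pt, Cconj, Cminus, Cplus, Copp, Cmult, Ci, RtoC, y, Im; simpl. f_equal; ring. }
    assert (EP : (PI / kap ^ 2 = 3 * PI / (2 * y))%R) by (rewrite kap_sq; field; lra).
    rewrite EP. rewrite !sgnZ_plus.
    assert (EX : Cexp (RtoC (- (3 * PI * IZR m * x)) * Ci) * Cexp (- RtoC (3 * PI / (2 * y)) * (W * Cconj W)) =
      sgnZ (m * n) * (qpow z (3 * IZR m ^ 2 / 2) * Cexp (- RtoC (3 * PI / (2 * y)) * (W * W)))).
    { replace (sgnZ (m * n)) with (Cexp (RtoC PI * Ci * RtoC (IZR (3 * (m * n))))).
      2:{ rewrite Cexp_pi_i. unfold sgnZ. rewrite Z.even_mul. reflexivity. }
      unfold qpow. rewrite <- !Cexp_plus. f_equal. rewrite EC.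
      replace (W * (W - 2 * Ci * RtoC (IZR m * y))) with (W * W - 2 * Ci * RtoC (IZR m * y) * W) by ring.
      replace (- RtoC (3 * PI / (2 * y)) * (W * W - 2 * Ci * RtoC (IZR m * y) * W)) with
       (- RtoC (3 * PI / (2 * y)) * (W * W) + 3 * RtoC PI * Ci * RtoC (IZR m) * W).
      - rewrite !mult_IZR. rewrite !RtoC_opp, !RtoC_mult.
        replace (RtoC (3 * IZR m ^ 2 / 2)) with (3 * RtoC (IZR m) * RtoC (IZR m) / 2) by (rewrite RtoC_div by lra; rewrite RtoC_mult, RtoC_pow; field).
        unfold W, lattice_pt. simpl fst. simpl snd. field.
      - replace (RtoC (3 * PI / (2 * y))) with (3 * RtoC PI / (2 * RtoC y)) by (rewrite RtoC_div, !RtoC_mult by lra; reflexivity).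
        rewrite RtoC_mult. field. intros E; injection E; lra. }
    transitivity (sgnZ m * sgnZ n * (sgnZ (m * n) * sgnZ (m * n)) * (qpow z (3 * IZR m ^ 2 / 2) * Cexp (- RtoC (3 * PI / (2 * y)) * (W * W))) / W).
    { rewrite sgnZ_sq. unfold Cdiv. ring. }
    transitivity (sgnZ (m * n) * sgnZ m * sgnZ n * (Cexp (RtoC (- (3 * PI * IZR m * x)) * Ci) * Cexp (- RtoC (3 * PI / (2 * y)) * (W * Cconj W))) / W).
    { rewrite EX. unfold Cdiv. ring. }
    unfold Cdiv. ring. }
  pose proof (hasSum_fubini _ _ L HL (fun m => proj2 (HB m))) as F1.
  assert (F2 : hasSum (fun m => sgnZ m * qpow z (3 * IZR m ^ 2 / 2) * Bf m) (eta z * T2)).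
  { apply (hasSum_fubini _ _ _ HT1). intros m. simpl fst. simpl snd.
    pose proof (hasSum_scal (sgnZ m * qpow z (3 * IZR m ^ 2 / 2)) _ _ (proj1 (HB m))) as H. revert H. apply hasSum_ext. intros r.
    rewrite qpow_plus. unfold g.
    replace (Cexp (2 * RtoC PI * Ci * RtoC (IZR r + 1/2) * (RtoC x + RtoC (IZR m) * z))) with
     (Cexp (RtoC (2 * PI * (IZR r + 1/2) * x) * Ci) * qpow z (IZR m * (IZR r + 1/2))).
    - ring.
    - unfold qpow. rewrite <- Cexp_plus. f_equal. rewrite !RtoC_mult. ring. }
  assert (F3 : hasSum (fun m => sgnZ m * qpow z (3 * IZR m ^ 2 / 2) * (2 * Ci / Dm m)) (/ RtoC PI * L + (- (2 * Ci)) * (eta z * T2))).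
  { pose proof (hasSum_plus _ _ _ _ (hasSum_scal (/ RtoC PI) _ _ F1) (hasSum_scal (- (2 * Ci)) _ _ F2)) as H. revert H. apply hasSum_ext. intros m.
    field. split; [apply Dm_neq_0|exact HPI]. }
  pose proof (calN_csc _ F3) as EL.
  exists (/ (2 * Ci) * T2). split.
  - pose proof (hasSum_scal (/ (2 * Ci)) _ _ HT2) as H. revert H. apply hasSum_ext. intros n.
    unfold g. rewrite betaZ_opp, RtoC_opp. fold y. fold kap.
    replace (RtoC (2 * PI * (IZR (- (3 * n) - 1) + 1/2) * x) * Ci) with (- (RtoC (PI * x * (6 * IZR n + 1)) * Ci)).
    2:{ replace (- (RtoC (PI * x * (6 * IZR n + 1)) * Ci)) with (RtoC (- (PI * x * (6 * IZR n + 1))) * Ci) by (rewrite RtoC_opp; ring).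
        f_equal. f_equal. rewrite minus_IZR, opp_IZR, mult_IZR. field. }
    replace (RtoC (2 * PI * (IZR (3 * n) + 1/2) * x)) with (RtoC (PI * x * (6 * IZR n + 1))) by (f_equal; rewrite mult_IZR; field).
    assert (S2 : Cexp (RtoC (PI * x * (6 * IZR n + 1)) * Ci) - Cexp (- (RtoC (PI * x * (6 * IZR n + 1)) * Ci)) = 2 * Ci * RtoC (sin (PI * x * (6 * IZR n + 1)))).
    { generalize (PI * x * (6 * IZR n + 1))%R as th. intros th.
      replace (- (RtoC th * Ci)) with (RtoC (- th) * Ci) by (rewrite RtoC_opp; ring).
      rewrite !Cexp_Rmult_i, cos_neg, sin_neg. unfold Cminus, Cplus, Copp, Cmult, Ci, RtoC; simpl. f_equal; ring. }
    transitivity (/ (2 * Ci) * (sgnZ n * qpow z (- ((6 * IZR n + 1) ^ 2 / 24)) * (RtoC (betaZ kap (3 * n)) * (Cexp (RtoC (PI * x * (6 * IZR n + 1)) * Ci) - Cexp (- (RtoC (PI * x * (6 * IZR n + 1)) * Ci)))))); [ring|].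
    rewrite S2. field. intros E; injection E; lra.
  - replace (RtoC PI * (eta z * (calN x z - 4 * (/ (2 * Ci) * T2)))) with L; [exact HL|].
    assert (EL2 : L = RtoC PI * (eta z * calN x z + 2 * Ci * (eta z * T2))).
    { rewrite <- EL. field. exact HPI. }
    rewrite EL2. assert (E4 : / (2 * Ci) = - Ci / 2).
    { replace (/ (2 * Ci)) with (Ci / (2 * (Ci * Ci))) by (field; intros E; injection E; lra). rewrite Ci_sq. field. }
    rewrite E4. field.
Qed.

End Lattice.

(** * The period integral *)

Section PowerFunctions.
Local Open Scope C_scope.

Lemma Carg_pos (t : R) : (0 < t)%R -> Carg (RtoC t) = 0%R.
Proof.
  intros Ht. unfold Carg. simpl Im. destruct (Rle_dec 0 0) as [_|n]; [|exfalso; apply n; lra].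
  rewrite Cmod_R, Rabs_pos_eq by lra. simpl Re. unfold Rdiv. rewrite Rinv_r by lra. apply acos_1.
Qed.

Lemma Csqrt_pos (t : R) : (0 < t)%R -> Csqrt (RtoC t) = RtoC (sqrt t).
Proof.
  intros Ht. unfold Csqrt, Cpower, Clog. rewrite Carg_pos, Cmod_R, Rabs_pos_eq by lra.
  replace (RtoC (1/2) * (ln t, 0%R)) with (RtoC (1/2 * ln t)) by (unfold Cmult, RtoC; simpl; f_equal; ring).
  rewrite Cexp_real. f_equal. rewrite <- Rpower_sqrt by exact Ht. unfold Rpower. f_equal. lra.
Qed.

Lemma powerRZ_sgnZ n : RtoC (powerRZ (-1) n) = sgnZ n.
Proof.
  assert (Hn : forall k : nat, RtoC ((-1) ^ k) = sgnZ (Z.of_nat k)).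
  { induction k as [|k IH]; [reflexivity|]. rewrite Nat2Z.inj_succ. unfold Z.succ. rewrite sgnZ_plus, sgnZ_1, <- IH.
    simpl pow. rewrite RtoC_mult. ring. }
  destruct n as [|p|p]; simpl powerRZ.
  - reflexivity.
  - rewrite Hn, positive_nat_Z. reflexivity.
  - rewrite RtoC_inv by (apply pow_nonzero; lra). rewrite Hn, positive_nat_Z.
    replace (Z.neg p) with (- Z.pos p)%Z by reflexivity. rewrite sgnZ_opp.
    pose proof (sgnZ_sq (Z.pos p)) as E. unfold sgnZ in *. destruct (Z.even _); field; intros Q; injection Q; lra.
Qed.

End PowerFunctions.

Section Eichler.
Local Open Scope C_scope.

Lemma is_RInt_gen_of_limit (f : R -> C) (I : R -> C) (l : C) :
  (forall T, (0 <= T)%R -> isInt f 0 T (I T)) ->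
  (forall eps, (0 < eps)%R -> exists M, forall T, (M <= T)%R -> (Cmod (I T - l) < eps)%R) ->
  is_RInt_gen (V := C_R_NormedModule) f (at_point 0%R) (Rbar_locally p_infty) l.
Proof.
  intros HI HL P [[eps Heps] HP]. destruct (HL eps Heps) as [M HM].
  apply (Filter_prod _ _ _ (fun a => a = 0%R) (fun b => Rmax 0 M < b)%R).
  - reflexivity.
  - exists (Rmax 0 M). intros b Hb. exact Hb.
  - intros a b -> Hb. simpl.
    assert (B1 : (0 <= b)%R) by (pose proof (Rmax_l 0 M); lra).
    assert (B2 : (M <= b)%R) by (pose proof (Rmax_r 0 M); lra).
    exists (I b). split.
    + destruct (HI b B1) as [H1 H2]. destruct (I b) as [i1 i2]. apply (is_RInt_fct_extend_pair (U := R_NormedModule) (V := R_NormedModule)); assumption.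
    + apply HP. specialize (HM b B2).
      split; unfold ball; simpl; unfold AbsRing_ball, abs, minus, plus, opp; simpl;
      eapply Rle_lt_trans; try exact HM.
      * apply (Rabs_Re_le_Cmod (I b - l)).
      * apply (Rabs_Im_le_Cmod (I b - l)).
Qed.

Variables (x : R) (z : C).
Hypothesis Hz : upper_half_plane z.
Let y := Im z.

Let kapS (s : R) := sqrt (s / 3).
Let kf (n : Z) : R := (6 * IZR n + 1)%R.
Let cf (n : Z) : C := sgnZ n * qpow z (- (kf n ^ 2 / 24)) * RtoC (sin (PI * x * kf n)).
Let th (n : Z) (t : R) : C := cf n * RtoC (kf n * gaussR (kapS (2 * y + t) * (kf n / 2)) / sqrt (2 * y + t)).

Lemma kf_ge n : (1 <= kf n ^ 2)%R.
Proof.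
  unfold kf. replace (6 * IZR n + 1)%R with (IZR (6 * n + 1)) by (rewrite plus_IZR, mult_IZR; reflexivity).
  apply IZR_sq_ge_1. lia.
Qed.

Lemma kapS_sq s : (0 <= s)%R -> (kapS s ^ 2 = s / 3)%R.
Proof. intros H. unfold kapS. apply pow2_sqrt. lra. Qed.

(** On the half-line [tau = - conj z + i t] one has [- i (tau + z) = 2 y + t], a positive real number, and
    the exponential splits into a power of [q] and a real Gaussian. *)
Lemma Theta1_term n t : (- y < t)%R ->
  RtoC (powerRZ (-1) n * (6 * IZR n + 1) * sin (PI * x * (6 * IZR n + 1)))
    * Cexp (3 * RtoC PI * Ci * (- Cconj z + Ci * RtoC t) * RtoC ((IZR n + 1 / 6) ^ 2)) / RtoC (sqrt (2 * y + t)) = th n t.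
Proof.
  intros Ht. assert (Hy : (0 < y)%R) by exact Hz.
  assert (Hs : (0 < sqrt (2 * y + t))%R) by (apply sqrt_lt_R0; lra).
  assert (Hsc : RtoC (sqrt (2 * y + t)) <> 0) by (intros E; injection E; lra).
  unfold th, cf, gaussR. fold (kf n).
  replace (- PI * (kapS (2 * y + t) * (kf n / 2) * (kapS (2 * y + t) * (kf n / 2))))%R with
    (- PI * (kapS (2 * y + t) ^ 2) * (kf n ^ 2 / 4))%R by field.
  rewrite kapS_sq by lra.
  assert (EC : - Cconj z = - z + Ci * RtoC (2 * y)).
  { unfold Cconj, Copp, Cplus, Cmult, Ci, RtoC, y, Im; simpl. f_equal; ring. }
  rewrite EC.
  assert (EE : Cexp (3 * RtoC PI * Ci * (- z + Ci * RtoC (2 * y) + Ci * RtoC t) * RtoC ((IZR n + 1 / 6) ^ 2)) =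
    qpow z (- (kf n ^ 2 / 24)) * RtoC (exp (- PI * ((2 * y + t) / 3) * (kf n ^ 2 / 4)))).
  { unfold qpow. rewrite <- Cexp_real, <- Cexp_plus. f_equal.
    replace ((IZR n + 1/6) ^ 2)%R with (kf n ^ 2 / 36)%R by (unfold kf; field).
    replace (3 * RtoC PI * Ci * (- z + Ci * RtoC (2 * y) + Ci * RtoC t) * RtoC (kf n ^ 2 / 36)) with
     (3 * RtoC PI * (- (Ci * z) + (Ci * Ci) * RtoC (2 * y + t)) * RtoC (kf n ^ 2 / 36)) by (rewrite RtoC_plus; ring).
    rewrite Ci_sq. set (k2 := (kf n ^ 2)%R). set (s := (2 * y + t)%R).
    unfold Rdiv. rewrite ?RtoC_mult, ?RtoC_opp, ?RtoC_mult, ?RtoC_inv by lra. field.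
 }
  rewrite EE. rewrite RtoC_mult, RtoC_mult, powerRZ_sgnZ. fold (kf n).
  rewrite RtoC_div, RtoC_mult by lra. field. exact Hsc.
Qed.

Let Fn (n : Z) (t : R) : C := cf n * RtoC (4 * sqrt 3 * erfG (kapS (2 * y + t) * (kf n / 2))).

(** Each term has an elementary primitive in terms of the error function, which is why the period
    integral becomes a series of complementary error functions. *)
Lemma Fn_isD n t : (- y < t)%R -> isD (Fn n) t (th n t).
Proof.
  intros Ht. assert (Hy : (0 < y)%R) by exact Hz. unfold Fn, th. apply isD_scal.
  split; simpl; [|apply (derivable_pt_lim_const 0)].
  assert (H3 : (0 < sqrt 3)%R) by (apply sqrt_lt_R0; lra).
  assert (Hs : (0 < sqrt (2 * y + t))%R) by (apply sqrt_lt_R0; lra).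
  assert (D : derivable_pt_lim (fun t => kapS (2 * y + t) * (kf n / 2))%R t (kf n / (4 * sqrt 3 * sqrt (2 * y + t)))%R).
  { apply is_derive_Reals. unfold kapS.
    auto_derive; [lra|].
    assert (E : (sqrt ((2 * y + t) / 3) = sqrt (2 * y + t) / sqrt 3)%R) by (apply sqrt_div_alt; lra).
    replace ((2 * y + t) * / 3)%R with ((2 * y + t) / 3)%R by reflexivity. rewrite E.
    replace 3%R with (sqrt 3 * sqrt 3)%R at 1 by (apply sqrt_sqrt; lra). field. split; lra. }
  replace (kf n * gaussR (kapS (2 * y + t) * (kf n / 2)) / sqrt (2 * y + t))%R with
    (4 * sqrt 3 * (gaussR (kapS (2 * y + t) * (kf n / 2)) * (kf n / (4 * sqrt 3 * sqrt (2 * y + t)))))%R by (field; split; lra).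
  apply (derivable_pt_lim_scal (fun t => erfG (kapS (2 * y + t) * (kf n / 2)))).
  apply (derivable_pt_lim_comp (fun t => kapS (2 * y + t) * (kf n / 2))%R erfG); [exact D|apply erfG_derive].
Qed.

Lemma th_cont n t : (- y < t)%R -> contC (th n) t.
Proof.
  intros Ht. assert (Hy : (0 < y)%R) by exact Hz. unfold th.
  apply contC_mult; [eapply isD_contC, isD_const|].
  split; simpl; [|apply continuity_pt_const; intros a b; reflexivity].
  assert (Hs : (0 < sqrt (2 * y + t))%R) by (apply sqrt_lt_R0; lra).
  apply continuity_pt_filterlim.
  refine (ex_derive_continuous (V := R_NormedModule) (fun s => kf n * gaussR (kapS (2 * y + s) * (kf n / 2)) / sqrt (2 * y + s))%R t _).
  unfold gaussR, kapS. auto_derive. repeat split; lra.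
Qed.

Lemma th_bound : exists K, (0 <= K)%R /\ forall n t, (- y / 2 < t)%R -> (Cmod (th n t) <= K * Zexp n)%R.
Proof.
  assert (Hy : (0 < y)%R) by exact Hz. pose proof PI_RGT_0 as Hpi.
  set (a := (PI * y * (3 / 2))%R). assert (Ha : (0 < a)%R) by (unfold a; assert (0 < PI * y)%R by (apply Rmult_lt_0_compat; lra); lra).
  assert (Hs : (0 < sqrt y)%R) by (apply sqrt_lt_R0; lra).
  destruct (gauss_majorant a (a / 3 + 6) 1 Ha) as [K [HK HG]]. exists (/ sqrt y * K)%R.
  split; [apply Rmult_le_pos; [apply Rlt_le, Rinv_0_lt_compat, Hs|exact HK]|].
  intros n t Ht. unfold th, cf.
  rewrite !Cmod_mult, Cmod_sgnZ, Cmod_qpow, !Cmod_R, Rmult_1_l. fold y.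
  unfold Rdiv at 2. rewrite !Rabs_mult.
  assert (Hs2 : (sqrt y <= sqrt (2 * y + t))%R) by (apply sqrt_le_1_alt; lra).
  rewrite (Rabs_pos_eq (/ sqrt (2 * y + t))) by (apply Rlt_le, Rinv_0_lt_compat; lra).
  rewrite (Rabs_pos_eq (gaussR _)) by (apply Rlt_le, exp_pos).
  assert (Hsin : (Rabs (sin (PI * x * kf n)) <= 1)%R) by (apply Rabs_le; pose proof (SIN_bound (PI * x * kf n)); lra).
  assert (Hk : (Rabs (kf n) <= exp (1 + 6 * Rabs (IZR n)))%R).
  { eapply Rle_trans; [apply Rabs_le_exp|]. apply exp_le. unfold kf.
    eapply Rle_trans; [apply Rabs_triang|]. rewrite Rabs_mult, (Rabs_pos_eq 6), (Rabs_pos_eq 1) by lra. lra. }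
  unfold gaussR.
  replace (- PI * (kapS (2 * y + t) * (kf n / 2) * (kapS (2 * y + t) * (kf n / 2))))%R with
    (- PI * (kapS (2 * y + t) ^ 2) * (kf n ^ 2 / 4))%R by field.
  rewrite kapS_sq by lra.
  set (s := Rabs (sin (PI * x * kf n))) in *.
  assert (Hs0 : (0 <= s)%R) by apply Rabs_pos.
  set (E1 := exp (- (2 * PI * - (kf n ^ 2 / 24) * y))). set (E2 := exp (- PI * ((2 * y + t) / 3) * (kf n ^ 2 / 4))).
  assert (E10 : (0 < E1)%R) by apply exp_pos. assert (E20 : (0 < E2)%R) by apply exp_pos.
  apply Rle_trans with (E1 * 1 * (exp (1 + 6 * Rabs (IZR n)) * E2 * / sqrt y))%R.
  { apply Rmult_le_compat.
    - apply Rmult_le_pos; lra.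
    - apply Rmult_le_pos; [apply Rmult_le_pos; [apply Rabs_pos|lra]|apply Rlt_le, Rinv_0_lt_compat; lra].
    - apply Rmult_le_compat_l; lra.
    - apply Rmult_le_compat; [apply Rmult_le_pos; [apply Rabs_pos|lra]|apply Rlt_le, Rinv_0_lt_compat; lra| |apply Rinv_le_contravar; lra].
      apply Rmult_le_compat_r; lra. }
  replace (E1 * 1 * (exp (1 + 6 * Rabs (IZR n)) * E2 * / sqrt y))%R with (/ sqrt y * (exp (1 + 6 * Rabs (IZR n)) * (E1 * E2)))%R by ring.
  rewrite Rmult_assoc. apply Rmult_le_compat_l; [apply Rlt_le, Rinv_0_lt_compat, Hs|].
  unfold E1, E2. rewrite <- !exp_plus.
  apply HG. unfold a, kf. set (m := IZR n).
  pose proof (Rle_abs (- m)) as X. rewrite Rabs_Ropp in X.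
  assert (T1 : (PI * (kf n ^ 2 / 12) * y = PI * y * (6 * m + 1) ^ 2 / 12)%R) by (unfold kf, m; field).
  assert (T2 : (0 <= PI * (6 * m + 1) ^ 2 * (t + y / 2))%R).
  { apply Rmult_le_pos; [apply Rmult_le_pos; [lra|apply pow2_ge_0]|lra]. }
  assert (T3 : (PI * y * (- m) <= PI * y * Rabs m)%R) by (apply Rmult_le_compat_l; [apply Rmult_le_pos; lra|exact X]).
  assert (T4 : (0 <= PI * y)%R) by (apply Rmult_le_pos; lra).
  replace (- (2 * PI * - ((6 * m + 1) ^ 2 / 24) * y) + - PI * ((2 * y + t) / 3) * ((6 * m + 1) ^ 2 / 4))%R with
   (- (PI * (6 * m + 1) ^ 2 * (t + y / 2)) / 12 + (- (PI * y) * (6 * m + 1) ^ 2 / 24))%R by field.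
  replace (- (PI * y) * (6 * m + 1) ^ 2 / 24)%R with (- (PI * y * (3/2)) * m ^ 2 + PI * y * (- m) / 2 - PI * y / 24)%R by field. lra.
Qed.

Lemma kapS_tail n t : (0 <= t)%R -> 
  (Rabs (betaZ (kapS (2 * y + t)) (3 * n)) <= exp (- (PI * y * kf n ^ 2 / 6)) * exp (- (PI * t / 12)))%R.
Proof.
  intros Ht. assert (Hy : (0 < y)%R) by exact Hz. pose proof PI_RGT_0 as Hpi.
  eapply Rle_trans; [apply betaZ_bound; apply sqrt_lt_R0; lra|].
  unfold gaussR. rewrite <- exp_plus. apply exp_le.
  replace (kapS (2 * y + t) * (IZR (3 * n) + 1/2) * (kapS (2 * y + t) * (IZR (3 * n) + 1/2)))%R with
    (kapS (2 * y + t) ^ 2 * (kf n ^ 2 / 4))%R by (unfold kf; rewrite mult_IZR; field).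
  rewrite kapS_sq by lra. pose proof (kf_ge n) as K1.
  assert (0 <= PI * t * (kf n ^ 2 - 1))%R by (apply Rmult_le_pos; [apply Rmult_le_pos; lra|lra]).
  lra.
Qed.

(** Termwise integration over [0, S] followed by [S] to infinity. The remainder carries the uniform factor
    [exp (- PI S / 12)], because [(6 n + 1)^2 >= 1]. *)
Lemma T1_series T : hasSum (fun n => sgnZ n * qpow z (- ((6 * IZR n + 1) ^ 2 / 24)) *
     (RtoC (betaZ (sqrt (2 * Im z / 3)) (3 * n)) * RtoC (sin (PI * x * (6 * IZR n + 1))))) T ->
  T1 x z = 4 * T.
Proof.
  intros HT. assert (Hy : (0 < y)%R) by exact Hz. pose proof PI_RGT_0 as Hpi.
  assert (H3 : (0 < sqrt 3)%R) by (apply sqrt_lt_R0; lra).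
  assert (H3c : RtoC (sqrt 3) <> 0) by (intros E; injection E; lra).
  destruct th_bound as [K [HK HKb]].
  assert (HS : summable (fun n => K * Zexp n)%R) by (apply summable_scal; [exact HK|apply summable_Zexp]).
  set (Th := fun t => CSeriesZ (fun n => th n t)).
  assert (HTh : forall t, (- y / 2 < t)%R -> hasSum (fun n => th n t) (Th t)).
  { intros t Ht. apply (hasSum_CSeriesZ _ (fun n => K * Zexp n)%R); [intros n; apply HKb, Ht|exact HS]. }
  set (f := fun t : R => Theta1 x (- Cconj z + Ci * RtoC t) / Csqrt (- Ci * (- Cconj z + Ci * RtoC t + z)) * Ci).
  assert (Ef : forall t, (0 <= t)%R -> f t = Ci * Th t).
  { intros t Ht. unfold f.
    replace (- Ci * (- Cconj z + Ci * RtoC t + z)) with (RtoC (2 * y + t)).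
    2:{ unfold Cconj, Copp, Cplus, Cmult, Ci, RtoC, y, Im; simpl. f_equal; ring. }
    rewrite Csqrt_pos by lra.
    assert (Hs : (0 < sqrt (2 * y + t))%R) by (apply sqrt_lt_R0; lra).
    assert (Hsc : RtoC (sqrt (2 * y + t)) <> 0) by (intros E; injection E; lra).
    assert (E : Theta1 x (- Cconj z + Ci * RtoC t) = RtoC (sqrt (2 * y + t)) * Th t).
    { unfold Theta1.
      pose proof (hasSum_scal (RtoC (sqrt (2 * y + t))) _ _ (HTh t ltac:(lra))) as H.
      eapply hasSum_unique; [|exact H].
      set (u := fun n : Z => RtoC (powerRZ (-1) n * (6 * IZR n + 1) * sin (PI * x * (6 * IZR n + 1)))
        * Cexp (3 * RtoC PI * Ci * (- Cconj z + Ci * RtoC t) * RtoC ((IZR n + 1 / 6) ^ 2))).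
      assert (Eu : forall n, u n = RtoC (sqrt (2 * y + t)) * th n t).
      { intros n. rewrite <- Theta1_term by lra. unfold u. field. exact Hsc. }
      apply (hasSum_ext u); [exact Eu|]. change (hasSum u (CSeriesZ u)).
      apply (hasSum_CSeriesZ _ (fun n => sqrt (2 * y + t) * (K * Zexp n))%R).
      - intros n. rewrite Eu, Cmod_mult, Cmod_R, Rabs_pos_eq by lra. apply Rmult_le_compat_l; [lra|]. apply HKb; lra.
      - apply summable_scal; [lra|exact HS]. }
    rewrite E. field. exact Hsc. }
  set (ln := fun (S : R) (n : Z) => Fn n S - Fn n 0%R).
  assert (HI : forall S, (0 <= S)%R -> exists J, isInt f 0 S (Ci * J) /\ hasSum (ln S) J).
  { intros S HS0.
    assert (Hr : (0 < S / 2 + y / 2)%R) by lra.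
    assert (HB : forall t, Boule (S / 2) (mkposreal _ Hr) t -> (- y / 2 < t)%R).
    { intros t Ht. unfold Boule in Ht; simpl in Ht. apply Rabs_def2 in Ht. lra. }
    destruct (dominated_isInt th Th (fun n => K * Zexp n)%R (S / 2) (mkposreal _ Hr)) with (A := 0%R) (B := S) (l := ln S) as [J [HJ1 HJ2]].
    - intros n t Ht. apply th_cont. specialize (HB t Ht). lra.
    - intros n t Ht. apply HKb, HB, Ht.
    - exact HS.
    - intros t Ht. apply HTh, HB, Ht.
    - exact HS0.
    - intros t Ht. unfold Boule; simpl. apply Rabs_def1; lra.
    - intros n. apply isInt_FTC; [exact HS0| |].
      + intros t Ht. apply Fn_isD. lra.
      + intros t Ht. apply th_cont. lra.
    - exists J. split; [|exact HJ2]. apply (isInt_ext_on (fun t => Ci * Th t)); [exact HS0| |apply isInt_scal, HJ1].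
      intros t Ht. symmetry. apply Ef. lra. }
  assert (HT' : hasSum (fun n => RtoC (4 * sqrt 3) * (cf n * RtoC (betaZ (kapS (2 * y)) (3 * n)))) (RtoC (4 * sqrt 3) * T)).
  { apply hasSum_scal. revert HT. apply hasSum_ext. intros n. unfold cf, kf, kapS, y. ring. }
  assert (Fb : forall n t, Fn n t = RtoC (4 * sqrt 3) * (cf n * RtoC ((if Z_le_dec 0 (3 * n) then 1/2 else -1/2) - betaZ (kapS (2 * y + t)) (3 * n)))).
  { intros n t. unfold Fn, betaZ. replace (IZR (3 * n) + 1/2)%R with (kf n / 2)%R by (unfold kf; rewrite mult_IZR; field).
    replace ((if Z_le_dec 0 (3 * n) then 1/2 else -1/2) - ((if Z_le_dec 0 (3 * n) then 1/2 else -1/2) - erfG (kapS (2 * y + t) * (kf n / 2))))%R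
      with (erfG (kapS (2 * y + t) * (kf n / 2))) by ring.
    rewrite !RtoC_mult. ring. }
  set (a2 := (3 * (PI * y))%R). assert (Ha2 : (0 < a2)%R) by (unfold a2; assert (0 < PI * y)%R by (apply Rmult_lt_0_compat; lra); lra).
  destruct (gauss_majorant a2 (a2 / 3) 0 Ha2) as [G [HG HGb]].
  assert (Cb : forall n, (Cmod (cf n) * exp (- (PI * y * kf n ^ 2 / 6)) <= G * Zexp n)%R).
  { intros n. unfold cf. rewrite !Cmod_mult, Cmod_sgnZ, Cmod_qpow, Cmod_R, Rmult_1_l. fold y.
    assert (Hsin : (Rabs (sin (PI * x * kf n)) <= 1)%R) by (apply Rabs_le; pose proof (SIN_bound (PI * x * kf n)); lra).
    apply Rle_trans with (exp (- (2 * PI * - (kf n ^ 2 / 24) * y)) * 1 * exp (- (PI * y * kf n ^ 2 / 6)))%R.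
    { apply Rmult_le_compat_r; [apply Rlt_le, exp_pos|]. apply Rmult_le_compat_l; [apply Rlt_le, exp_pos|exact Hsin]. }
    rewrite Rmult_1_r, <- exp_plus. apply HGb. unfold a2, kf. set (m := IZR n).
    pose proof (Rle_abs (- m)) as X. rewrite Rabs_Ropp in X.
    assert (T4 : (0 <= PI * y)%R) by (apply Rmult_le_pos; lra).
    assert (T3 : (PI * y * (- m) <= PI * y * Rabs m)%R) by (apply Rmult_le_compat_l; [exact T4|exact X]).
    replace (- (2 * PI * - ((6 * m + 1) ^ 2 / 24) * y) + - (PI * y * (6 * m + 1) ^ 2 / 6))%R with
     (- (3 * (PI * y)) * m ^ 2 + (PI * y * (- m)) - PI * y / 12)%R by field. lra. }
  destruct summable_Zexp as [M HM].
  assert (HM0 : (0 <= M)%R) by (specialize (HM nil (NoDup_nil _)); exact HM).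
  set (Kc := (4 * sqrt 3 * (G * M) + 1)%R).
  assert (HKc : (0 < Kc)%R).
  { unfold Kc. assert (0 <= 4 * sqrt 3 * (G * M))%R by (apply Rmult_le_pos; [lra|apply Rmult_le_pos; lra]). lra. }
  assert (Hdiff : forall S J, (0 <= S)%R -> hasSum (ln S) J -> (Cmod (J - RtoC (4 * sqrt 3) * T) <= Kc * exp (- (PI * S / 12)))%R).
  { intros S J HS0 HJ.
    pose proof (hasSum_plus _ _ _ _ HJ (hasSum_scal (-1) _ _ HT')) as H.
    replace (J - RtoC (4 * sqrt 3) * T) with (J + (-1) * (RtoC (4 * sqrt 3) * T)) by ring.
    revert H. apply hasSum_bound. intros L NL.
    eapply Rle_trans; [apply Cmod_Csum_le|].
    apply Rle_trans with (Rsum (fun n => (4 * sqrt 3 * G * exp (- (PI * S / 12))) * Zexp n)%R L).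
    - apply Rsum_le. intros n _. unfold ln. rewrite !Fb. rewrite Rplus_0_r.
      replace (RtoC (4 * sqrt 3) * (cf n * RtoC ((if Z_le_dec 0 (3 * n) then 1/2 else -1/2) - betaZ (kapS (2 * y + S)) (3 * n))) -
         RtoC (4 * sqrt 3) * (cf n * RtoC ((if Z_le_dec 0 (3 * n) then 1/2 else -1/2) - betaZ (kapS (2 * y)) (3 * n))) +
         (-1) * (RtoC (4 * sqrt 3) * (cf n * RtoC (betaZ (kapS (2 * y)) (3 * n))))) with
        (- (RtoC (4 * sqrt 3) * (cf n * RtoC (betaZ (kapS (2 * y + S)) (3 * n))))) by (rewrite !RtoC_minus; ring).
      rewrite Cmod_opp, !Cmod_mult, !Cmod_R, (Rabs_pos_eq (4 * sqrt 3)) by lra.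
      replace (4 * sqrt 3 * G * exp (- (PI * S / 12)) * Zexp n)%R with (4 * sqrt 3 * ((G * Zexp n) * exp (- (PI * S / 12))))%R by ring.
      apply Rmult_le_compat_l; [lra|].
      apply Rle_trans with (Cmod (cf n) * (exp (- (PI * y * kf n ^ 2 / 6)) * exp (- (PI * S / 12))))%R.
      + apply Rmult_le_compat_l; [apply Cmod_ge_0|apply kapS_tail, HS0].
      + rewrite <- Rmult_assoc. apply Rmult_le_compat_r; [apply Rlt_le, exp_pos|apply Cb].
    - rewrite Rsum_scal. pose proof (exp_pos (- (PI * S / 12))) as E0.
      apply Rle_trans with (4 * sqrt 3 * G * exp (- (PI * S / 12)) * M)%R.
      + apply Rmult_le_compat_l; [|apply HM, NL]. apply Rmult_le_pos; [|lra]. apply Rmult_le_pos; lra.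
      + unfold Kc. replace (4 * sqrt 3 * G * exp (- (PI * S / 12)) * M)%R with (4 * sqrt 3 * (G * M) * exp (- (PI * S / 12)))%R by ring.
        apply Rmult_le_compat_r; lra. }
  assert (HIG : is_RInt_gen (V := C_R_NormedModule) f (at_point 0%R) (Rbar_locally p_infty) (Ci * (RtoC (4 * sqrt 3) * T))).
  { destruct (choice_fun (fun S J => (0 <= S)%R -> isInt f 0 S (Ci * J) /\ hasSum (ln S) J)) as [Jf HJf].
    { intros S. destruct (Rle_dec 0 S) as [h|h]; [destruct (HI S h) as [J HJ]; exists J; auto|exists 0; contradiction]. }
    apply (is_RInt_gen_of_limit f (fun S => Ci * Jf S)).
    - intros S HS0. apply HJf, HS0.
    - intros eps Heps. exists (12 / PI * (Kc / eps))%R. intros S HSM.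
      assert (P0 : (0 < Kc / eps)%R) by (apply Rdiv_lt_0_compat; lra).
      assert (P1 : (0 < 12 / PI)%R) by (apply Rdiv_lt_0_compat; lra).
      assert (HS0 : (0 <= S)%R) by (assert (0 <= 12 / PI * (Kc / eps))%R by (apply Rmult_le_pos; lra); lra).
      destruct (HJf S HS0) as [_ HJ]. set (J := Jf S) in *.
      replace (Ci * J - Ci * (RtoC (4 * sqrt 3) * T)) with (Ci * (J - RtoC (4 * sqrt 3) * T)) by ring.
      rewrite Cmod_mult, Cmod_Ci, Rmult_1_l. eapply Rle_lt_trans; [apply (Hdiff S J HS0 HJ)|].
      rewrite exp_Ropp. assert (B : (Kc / eps <= PI * S / 12)%R).
      { apply Rmult_le_compat_l with (r := (PI / 12)%R) in HSM; [|lra].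
        replace (PI / 12 * (12 / PI * (Kc / eps)))%R with (Kc / eps)%R in HSM by (field; lra). lra. }
      assert (B2 : (Kc / eps < exp (PI * S / 12))%R) by (pose proof (exp_ineq1 (PI * S / 12) ltac:(lra)); lra).
      pose proof (exp_pos (PI * S / 12)) as E0.
      apply Rmult_lt_reg_r with (exp (PI * S / 12)); [exact E0|].
      replace (Kc * / exp (PI * S / 12) * exp (PI * S / 12))%R with Kc by (field; lra).
      apply Rmult_lt_compat_r with (r := eps) in B2; [|exact Heps].
      replace (Kc / eps * eps)%R with Kc in B2 by (field; lra). lra. }
  unfold T1, int_to_iinfty.
  assert (E : RInt_gen (V := C_R_CompleteNormedModule) f (at_point 0%R) (Rbar_locally p_infty) = Ci * (RtoC (4 * sqrt 3) * T)).
  { apply (is_RInt_gen_unique (V := C_R_CompleteNormedModule)). exact HIG. }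
  unfold f in E. rewrite E.
  replace (- (Ci / RtoC (sqrt 3)) * (Ci * (RtoC (4 * sqrt 3) * T))) with (- (Ci * Ci) * RtoC (4 * sqrt 3) / RtoC (sqrt 3) * T) by (field; exact H3c).
  rewrite Ci_sq, RtoC_mult. field. exact H3c.
Qed.

End Eichler.

Section F1Lattice.
Local Open Scope C_scope.

Theorem F1_lattice (x : R) (z : C) : (0 < x < 1)%R -> upper_half_plane z ->
  hasSum (rank_lattice x z) (RtoC PI * F1 x z).
Proof.
  intros Hx Hz. destruct (rank_lattice_sum x z Hx Hz) as [T [HT HL]].
  unfold F1, G1. rewrite (T1_series x z Hz T HT). exact HL.
Qed.

End F1Lattice.

(** * Principal square roots *)

Section SquareRoots.
Local Open Scope C_scope.

Lemma Cexp_Clog (w : C) : w <> 0 -> Cexp (Clog w) = w.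
Proof.
  intros Hw. apply (proj1 (Cmod_gt_0 w)) in Hw. unfold Cexp, Clog. simpl Re. simpl Im. rewrite exp_ln by exact Hw.
  set (m := Cmod w) in *. pose proof (Cmod_sq_RI w) as Q. fold m in Q.
  assert (B : (-1 <= Re w / m <= 1)%R).
  { pose proof (Rabs_Re_le_Cmod w) as B. fold m in B. apply Rabs_le_between in B.
    split; [apply Rle_div_r|apply Rle_div_l]; lra. }
  assert (S : (sin (acos (Re w / m)) = Rabs (Im w) / m)%R).
  { rewrite sin_acos by exact B. replace (1 - (Re w / m)²)%R with ((Im w / m)²)%R.
    - rewrite sqrt_Rsqr_abs. unfold Rdiv. rewrite Rabs_mult, (Rabs_pos_eq (/ m)); [reflexivity|apply Rlt_le, Rinv_0_lt_compat, Hw].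
    - unfold Rsqr. replace (Im w / m * (Im w / m))%R with (Im w ^ 2 / m ^ 2)%R by (field; lra).
      replace (Im w ^ 2)%R with (m ^ 2 - Re w ^ 2)%R by lra. field. lra. }
  unfold Carg. fold m. destruct (Rle_dec 0 (Im w)) as [H|H].
  - rewrite cos_acos, S, Rabs_pos_eq by assumption. destruct w as [u v]. unfold Cmult, RtoC, Re, Im in *; simpl in *. f_equal; field; lra.
  - rewrite cos_neg, sin_neg, cos_acos, S, Rabs_left by lra. destruct w as [u v]. unfold Cmult, RtoC, Re, Im in *; simpl in *. f_equal; field; lra.
Qed.

Lemma Cpower_m1 (w : C) : w <> 0 -> Cpower w (- (1)) = / w.
Proof.
  intros Hw. unfold Cpower. replace (RtoC (- (1)) * Clog w) with (- Clog w) by (rewrite RtoC_opp; ring).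
  rewrite Cexp_opp, Cexp_Clog by exact Hw. reflexivity.
Qed.

Lemma Cpower_opp_half w : Cpower w (- (1/2)) = / Cpower w (1/2).
Proof.
  unfold Cpower. rewrite <- Cexp_opp. f_equal. rewrite RtoC_opp. ring.
Qed.

Lemma Cpower_half_sq (w : C) : w <> 0 -> Cpower w (1/2) * Cpower w (1/2) = w.
Proof.
  intros Hw. unfold Cpower. rewrite <- Cexp_plus.
  replace (RtoC (1/2) * Clog w + RtoC (1/2) * Clog w) with (Clog w); [apply Cexp_Clog, Hw|].
  rewrite RtoC_div by lra. field.
Qed.

Lemma Carg_bound w : (- PI <= Carg w <= PI)%R.
Proof.
  unfold Carg. pose proof (acos_bound (Re w / Cmod w)). pose proof PI_RGT_0. destruct (Rle_dec 0 (Im w)); lra.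
Qed.

Lemma Cpower_half_Re w : (0 <= Re (Cpower w (1/2)))%R.
Proof.
  unfold Cpower, Cexp. rewrite Re_scal_r.
  apply Rmult_le_pos; [apply Rlt_le, exp_pos|]. unfold Re at 1. simpl fst.
  pose proof (Carg_bound w). apply cos_ge_0; unfold Clog, Cmult, RtoC, Im; simpl; lra.
Qed.

Lemma Cpower_half_upper w : (0 < Im w)%R -> (0 < Re (Cpower w (1/2)))%R /\ (0 < Im (Cpower w (1/2)))%R.
Proof.
  intros Hw. assert (H0 : w <> 0) by (intros E; rewrite E in Hw; simpl in Hw; lra).
  pose proof (f_equal Im (Cpower_half_sq w H0)) as E. rewrite Im_mult in E.
  pose proof (Cpower_half_Re w). set (a := Re _) in *. set (b := Im (Cpower w (1/2))) in *.
  destruct (Req_dec a 0) as [Z|Z]; [rewrite Z in E; lra|]. assert (0 < a)%R by lra.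
  split; [assumption|]. apply Rnot_le_lt. intros Hb. nra.
Qed.

Lemma Cpower_half_lower w : (Im w < 0)%R -> (0 < Re (Cpower w (1/2)))%R /\ (Im (Cpower w (1/2)) < 0)%R.
Proof.
  intros Hw. assert (H0 : w <> 0) by (intros E; rewrite E in Hw; simpl in Hw; lra).
  pose proof (f_equal Im (Cpower_half_sq w H0)) as E. rewrite Im_mult in E.
  pose proof (Cpower_half_Re w). set (a := Re _) in *. set (b := Im (Cpower w (1/2))) in *.
  destruct (Req_dec a 0) as [Z|Z]; [rewrite Z in E; lra|]. assert (0 < a)%R by lra.
  split; [assumption|]. apply Rnot_le_lt. intros Hb. nra.
Qed.

Lemma Cpower_half_one : Cpower 1 (1/2) = 1.
Proof.
  replace (RtoC 1) with (RtoC 1) by reflexivity. change (Csqrt (RtoC 1) = 1). rewrite Csqrt_pos by lra. rewrite sqrt_1. reflexivity.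
Qed.

Lemma Cpower_half_sector w : (0 < Re w)%R -> (Rabs (Im (Cpower w (1/2))) < Re (Cpower w (1/2)))%R.
Proof.
  intros Hw. pose proof (f_equal Re (Cpower_half_sq w (Re_pos_neq_0 w Hw))) as E. rewrite Re_mult in E.
  pose proof (Cpower_half_Re w). set (a := Re (Cpower w (1/2))) in *. set (b := Im (Cpower w (1/2))) in *.
  apply Rsqr_incrst_0; [|apply Rabs_pos|assumption]. rewrite <- Rsqr_abs. unfold Rsqr. lra.
Qed.

End SquareRoots.

(** * Weight one *)

Section ModularAction.
Local Open Scope C_scope.

Definition jac (A : SL2Z) (z : C) : C := RtoC (IZR (mc A)) * z + RtoC (IZR (md A)).
Definition mob (A : SL2Z) (z : C) : C := (RtoC (IZR (ma A)) * z + RtoC (IZR (mb A))) / jac A z.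

Lemma det_C (A : SL2Z) : RtoC (IZR (ma A)) * RtoC (IZR (md A)) - RtoC (IZR (mb A)) * RtoC (IZR (mc A)) = 1.
Proof.
  rewrite <- !RtoC_mult, <- !mult_IZR, <- RtoC_minus, <- minus_IZR, SL2Z_det. reflexivity.
Qed.

Lemma jac_neq_0 A z : Im z <> 0%R -> jac A z <> 0.
Proof.
  intros Hz E. pose proof (SL2Z_det A) as D.
  assert (E2 : (IZR (mc A) * Im z = 0)%R).
  { pose proof (f_equal Im E) as E'. unfold jac in E'. rewrite Im_plus, Im_mult, Re_RtoC, !Im_RtoC in E'. simpl in E'. lra. }
  assert (C0 : IZR (mc A) = 0%R) by (apply Rmult_integral in E2; destruct E2; [assumption|contradiction]).
  pose proof (f_equal Re E) as E3. unfold jac in E3. rewrite Re_plus, Re_mult, Re_RtoC, Im_RtoC, C0, Re_RtoC in E3. simpl in E3.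
  assert (D0 : IZR (md A) = 0%R) by lra. apply eq_IZR in C0, D0. rewrite C0, D0 in D. lia.
Qed.

Lemma Im_mob A z : Im z <> 0%R -> (Im (mob A z) = Im z / Cmod (jac A z) ^ 2)%R.
Proof.
  intros Hz. pose proof (jac_neq_0 A z Hz) as Hj. pose proof (proj1 (Cmod_gt_0 _) Hj) as Hm.
  pose proof (SL2Z_det A) as D. apply (f_equal IZR) in D. rewrite minus_IZR, !mult_IZR in D.
  assert (E : mob A z = (RtoC (IZR (ma A)) * z + RtoC (IZR (mb A))) * Cconj (jac A z) * RtoC (/ Cmod (jac A z) ^ 2)).
  { unfold mob. rewrite RtoC_inv by (apply pow_nonzero; lra). rewrite <- Cmul_conj_real. field. split; [|exact Hj].
    intros E. assert (Cmod (Cconj (jac A z)) = 0%R) by (rewrite E; apply Cmod_0). rewrite Cmod_conj in H. lra. }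
  rewrite E. rewrite Im_mult, Re_RtoC, Im_RtoC.
  replace (Im ((RtoC (IZR (ma A)) * z + RtoC (IZR (mb A))) * Cconj (jac A z))) with (Im z)%R.
  - field. lra.
  - unfold jac, Cconj, Cmult, Cplus, RtoC, Im, Re; simpl. 
    transitivity ((IZR (ma A) * IZR (md A) - IZR (mb A) * IZR (mc A)) * snd z)%R; [rewrite D; ring|ring].
Qed.

Lemma mob_upper A z : upper_half_plane z -> upper_half_plane (mob A z).
Proof.
  intros Hz. unfold upper_half_plane in *. rewrite Im_mob by lra.
  apply Rdiv_lt_0_compat; [exact Hz|]. apply pow_lt. apply Cmod_gt_0, jac_neq_0. lra.
Qed.

Lemma mob_lower A z : (Im z < 0)%R -> (Im (mob A z) < 0)%R.
Proof.
  intros Hz. rewrite Im_mob by lra. assert (0 < Cmod (jac A z) ^ 2)%R by (apply pow_lt, Cmod_gt_0, jac_neq_0; lra).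
  assert (0 < - Im z / Cmod (jac A z) ^ 2)%R by (apply Rdiv_lt_0_compat; lra).
  unfold Rdiv in *. lra.
Qed.

(** The right action of [A] on row vectors of lattice indices, followed by a translation. *)
Definition actZ (A : SL2Z) (s t : Z) (mn : Z * Z) : Z * Z :=
  ((fst mn * ma A + snd mn * mc A + s)%Z, (fst mn * mb A + snd mn * md A + t)%Z).

Definition actZ_inv (A : SL2Z) (s t : Z) (mn : Z * Z) : Z * Z :=
  (((fst mn - s) * md A - (snd mn - t) * mc A)%Z, (- (fst mn - s) * mb A + (snd mn - t) * ma A)%Z).

Lemma actZ_K1 A s t mn : actZ A s t (actZ_inv A s t mn) = mn.
Proof.
  destruct mn as [m n]. pose proof (SL2Z_det A) as D. unfold actZ, actZ_inv. simpl fst; simpl snd. f_equal.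
  - transitivity ((m - s) * (ma A * md A - mb A * mc A) + s)%Z; [ring|rewrite D; ring].
  - transitivity ((n - t) * (ma A * md A - mb A * mc A) + t)%Z; [ring|rewrite D; ring].
Qed.

Lemma actZ_K2 A s t mn : actZ_inv A s t (actZ A s t mn) = mn.
Proof.
  destruct mn as [m n]. pose proof (SL2Z_det A) as D. unfold actZ, actZ_inv. simpl fst; simpl snd. f_equal.
  - transitivity (m * (ma A * md A - mb A * mc A))%Z; [ring|rewrite D; ring].
  - transitivity (n * (ma A * md A - mb A * mc A))%Z; [ring|rewrite D; ring].
Qed.

Lemma sgnZ_eq m n : Z.even m = Z.even n -> sgnZ m = sgnZ n.
Proof. intros H. unfold sgnZ. rewrite H. reflexivity. Qed.

Lemma mob_lattice A z (m n : Z) : jac A z <> 0 ->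
  RtoC (IZR m) * mob A z + RtoC (IZR n) =
  (RtoC (IZR (m * ma A + n * mc A)) * z + RtoC (IZR (m * mb A + n * md A))) / jac A z.
Proof.
  intros Hj. unfold mob. rewrite !plus_IZR, !mult_IZR, !RtoC_plus, !RtoC_mult.
  transitivity ((RtoC (IZR m) * (RtoC (IZR (ma A)) * z + RtoC (IZR (mb A))) + RtoC (IZR n) * jac A z) / jac A z); [field; exact Hj|].
  unfold jac. unfold Cdiv. ring.
Qed.

(** The lattice sum at [A z] is, term by term, the reindexed lattice sum at [z]. The translation comes
    from [x (c z + d) = x + (l c / p) z + l (d - 1) / p]. *)
Theorem F1_modular (p l : Z) (A : SL2Z) : (0 < p)%Z -> Z.odd p = true -> (0 < l < p)%Z ->
  Gamma0 (p ^ 2) A -> Gamma1 p A -> forall z, upper_half_plane z ->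
  F1 (IZR l / IZR p) (mob A z) = jac A z * F1 (IZR l / IZR p) z.
Proof.
  intros Hp Hodd Hl [c1 Hc] [_ [[a1 Ha] [d1 Hd]]] z Hz.
  set (x := (IZR l / IZR p)%R).
  assert (HpR : (0 < IZR p)%R) by (apply IZR_lt; lia).
  assert (Hx : (0 < x < 1)%R).
  { unfold x. split; [apply Rdiv_lt_0_compat; [apply IZR_lt; lia|exact HpR]|].
    apply Rmult_lt_reg_r with (IZR p); [exact HpR|]. replace (IZR l / IZR p * IZR p)%R with (IZR l) by (field; lra).
    rewrite Rmult_1_l. apply IZR_lt; lia. }
  assert (Hz0 : Im z <> 0%R) by (unfold upper_half_plane in Hz; lra).
  pose proof (jac_neq_0 A z Hz0) as Hj. pose proof (proj1 (Cmod_gt_0 _) Hj) as Hjm.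
  set (s := (l * p * c1)%Z). set (t := (l * d1)%Z).
  assert (Hs : (x * IZR (mc A) = IZR s)%R).
  { unfold x, s. rewrite Hc. replace (c1 * p ^ 2)%Z with (c1 * p * p)%Z by ring. rewrite !mult_IZR. field. lra. }
  assert (Ht : (x * IZR (md A) = x + IZR t)%R).
  { unfold x, t. replace (md A) with (d1 * p + 1)%Z by lia. rewrite plus_IZR, !mult_IZR. field. lra. }
  assert (Hta : (x * IZR (ma A) = x + IZR (l * a1))%R).
  { unfold x. replace (ma A) with (a1 * p + 1)%Z by lia. rewrite plus_IZR, !mult_IZR. field. lra. }
  assert (Hxs : (x * IZR s = IZR (l * l * c1))%R).
  { unfold x, s. rewrite !mult_IZR. field. lra. }
  pose proof (F1_lattice x (mob A z) Hx (mob_upper A z Hz)) as H1.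
  pose proof (F1_lattice x z Hx Hz) as H2.
  apply (hasSum_reindex (actZ A s t) (actZ_inv A s t)) in H2; [|apply actZ_K1|apply actZ_K2].
  apply (hasSum_scal (jac A z)) in H2.
  assert (E : forall mn, jac A z * rank_lattice x z (actZ A s t mn) = rank_lattice x (mob A z) mn).
  { intros [m n]. unfold rank_lattice.
    assert (HW : lattice_pt x (mob A z) (m, n) = lattice_pt x z (actZ A s t (m, n)) / jac A z).
    { unfold lattice_pt at 1. simpl fst; simpl snd. rewrite <- Cplus_assoc, mob_lattice by exact Hj.
      unfold lattice_pt, actZ. simpl fst; simpl snd. set (m0 := (m * ma A + n * mc A)%Z). set (n0 := (m * mb A + n * md A)%Z).
      rewrite !plus_IZR, !RtoC_plus.
      replace (RtoC x) with ((RtoC (IZR s) * z + (RtoC x + RtoC (IZR t))) / jac A z) at 1.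
      - field. exact Hj.
      - rewrite <- Hs, <- RtoC_plus, <- Ht, !RtoC_mult. unfold jac in *. field. exact Hj. }
    destruct (actZ A s t (m, n)) as [m' n'] eqn:Emn. rewrite HW. set (W := lattice_pt x z (m', n')) in *.
    assert (HW0 : W <> 0).
    { unfold W. destruct (lattice_pt_lower x z Hx Hz) as [w0 [Hw0 HL]]. apply Cmod_gt_0. specialize (HL (m', n')). lra. }
    assert (EG : - RtoC (3 * PI / (2 * Im (mob A z))) * (W / jac A z * Cconj (W / jac A z)) = - RtoC (3 * PI / (2 * Im z)) * (W * Cconj W)).
    { rewrite !Cmul_conj_real, Cmod_div, Im_mob by assumption. rewrite <- !RtoC_opp, <- !RtoC_mult. f_equal. field. lra. }
    rewrite EG. simpl fst; simpl snd.
    assert (EP : sgnZ (m * n + m + n) * Cexp (RtoC (- (3 * PI * IZR m * x)) * Ci) =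
      sgnZ (m' * n' + m' + n') * Cexp (RtoC (- (3 * PI * IZR m' * x)) * Ci)).
    { set (k := (m * (l * a1) + n * s + l * l * c1)%Z).
      assert (Ek : (IZR m' * x = IZR m * x + IZR k)%R).
      { unfold actZ in Emn. simpl in Emn. injection Emn as Em _.
        assert (E1 : IZR m' = (IZR m * IZR (ma A) + IZR n * IZR (mc A) + IZR s)%R)
          by (rewrite <- Em, !plus_IZR, (mult_IZR m (ma A)), (mult_IZR n (mc A)); reflexivity).
        assert (E2 : IZR k = (IZR m * IZR (l * a1) + IZR n * IZR s + IZR (l * l * c1))%R)
          by (unfold k; rewrite !plus_IZR, (mult_IZR m (l * a1)), (mult_IZR n s); reflexivity).
        rewrite E1, E2, <- Hxs.
        transitivity (IZR m * (x * IZR (ma A)) + IZR n * (x * IZR (mc A)) + x * IZR s)%R; [ring|]. rewrite Hta, Hs. ring. }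
      replace (RtoC (- (3 * PI * IZR m' * x)) * Ci) with (RtoC (- (3 * PI * IZR m * x)) * Ci + RtoC PI * Ci * RtoC (IZR (- (3 * k)))).
      2:{ replace (3 * PI * IZR m' * x)%R with (3 * PI * (IZR m' * x))%R by ring. rewrite Ek.
          rewrite opp_IZR, mult_IZR. rewrite ?RtoC_opp, ?RtoC_mult, ?RtoC_plus, ?RtoC_mult. ring. }
      rewrite Cexp_plus, Cexp_pi_i.
      transitivity ((sgnZ (m' * n' + m' + n') * sgnZ (- (3 * k))) * Cexp (RtoC (- (3 * PI * IZR m * x)) * Ci)); [|ring].
      f_equal. rewrite <- sgnZ_plus. apply sgnZ_eq.
      pose proof (SL2Z_det A) as D. unfold actZ in Emn. simpl in Emn. injection Emn as Em En.
      rewrite <- Em, <- En. unfold k, s, t.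
      assert (Hep : Z.even p = false) by (rewrite <- Z.negb_odd, Hodd; reflexivity).
      assert (Ea : ma A = (a1 * p + 1)%Z) by lia. assert (Ed : md A = (d1 * p + 1)%Z) by lia.
      rewrite Ea, Ed, Hc in *. apply (f_equal Z.even) in D.
      replace (p ^ 2)%Z with (p * p)%Z in * by ring.
      repeat first [rewrite Z.even_add in *|rewrite Z.even_sub in *|rewrite Z.even_mul in *|rewrite Z.even_opp in *].
      rewrite Hep in *. simpl in *.
      destruct (Z.even m), (Z.even n), (Z.even l), (Z.even a1), (Z.even d1), (Z.even c1), (Z.even (mb A)); simpl in *; try reflexivity; discriminate. }
    rewrite EP. field. split; assumption. }
  pose proof (hasSum_ext _ _ _ E H2) as H3. pose proof (hasSum_unique _ _ _ H1 H3) as H4.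
  assert (HPI : RtoC PI <> 0) by (pose proof PI_RGT_0; intros Q; injection Q; lra).
  replace (F1 x (mob A z)) with (/ RtoC PI * (RtoC PI * F1 x (mob A z))) by (field; exact HPI).
  rewrite H4. field. exact HPI.
Qed.

End ModularAction.

(** * The transformation law of eta *)

Section EtaModular.
Local Open Scope C_scope.

(** Shifting [u] by [i / (2 b^2)] multiplies the [n]-th Gaussian by [(-1)^n], up to a factor independent
    of [n]. *)
Lemma poisson_alt (b u : C) : (Rabs (Im b) < Re b)%R -> exists s,
  hasSum (fun n => sgnZ n * Cexp (- RtoC PI * (b * b) * ((RtoC (IZR n) + u) * (RtoC (IZR n) + u)))) s /\
  hasSum (fun r => / b * Cexp (- RtoC PI / (b * b) * RtoC ((IZR r + 1/2) ^ 2) + 2 * RtoC PI * Ci * RtoC (IZR r + 1/2) * u)) s.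
Proof.
  intros Hb. pose proof (Re_pos_neq_0 (b * b) (Re_sq_pos b Hb)) as HA.
  assert (Hb0 : b <> 0) by (intros E; apply HA; rewrite E; ring).
  set (A := b * b) in *.
  destruct (poisson_gauss b (u + Ci / (2 * A)) Hb) as [s [H1 H2]]. fold A in H1, H2.
  set (k := RtoC PI * Ci * u - RtoC PI / (4 * A)).
  exists (Cexp k * s). split.
  - apply (hasSum_scal (Cexp k)) in H1. revert H1. apply hasSum_ext. intros n.
    rewrite <- (sgnZ_opp n), <- Cexp_pi_i, <- !Cexp_plus. f_equal. unfold k. rewrite opp_IZR, RtoC_opp.
    replace ((RtoC (IZR n) + (u + Ci / (2 * A))) * (RtoC (IZR n) + (u + Ci / (2 * A)))) with
     ((RtoC (IZR n) + u) * (RtoC (IZR n) + u) + Ci * (RtoC (IZR n) + u) / A + (Ci * Ci) / (4 * A * A)) by (field; exact HA).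
    rewrite Ci_sq. field. exact HA.
  - apply (hasSum_scal (Cexp k)) in H2. revert H2. apply hasSum_ext. intros r.
    replace (Cexp k * (/ b * Cexp (- RtoC PI / A * (RtoC (IZR r) * RtoC (IZR r)) + 2 * RtoC PI * Ci * RtoC (IZR r) * (u + Ci / (2 * A))))) with
     (/ b * (Cexp k * Cexp (- RtoC PI / A * (RtoC (IZR r) * RtoC (IZR r)) + 2 * RtoC PI * Ci * RtoC (IZR r) * (u + Ci / (2 * A))))) by ring.
    rewrite <- Cexp_plus. f_equal. f_equal. unfold k. rewrite RtoC_pow, RtoC_plus, RtoC_div by lra.
    replace (2 * RtoC PI * Ci * RtoC (IZR r) * (u + Ci / (2 * A))) with (2 * RtoC PI * Ci * RtoC (IZR r) * u + (Ci * Ci) * RtoC PI * RtoC (IZR r) / A) by (field; exact HA).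
    rewrite Ci_sq. field. exact HA.
Qed.

(** With [k = (4 a c - b^2) / (4 (a + c))] the form minus [k (m^2 + n^2)] has determinant [k^2]. *)
Lemma posdef_lower (a b c : R) : (0 < a)%R -> (0 < 4 * a * c - b ^ 2)%R ->
  exists k, (0 < k)%R /\ forall m n, (k * (m ^ 2 + n ^ 2) <= a * n ^ 2 + b * m * n + c * m ^ 2)%R.
Proof.
  intros Ha HD. assert (Hc : (0 < c)%R).
  { apply Rnot_le_lt. intros Hc. pose proof (pow2_ge_0 b). nra. }
  set (k := ((4 * a * c - b ^ 2) / (4 * (a + c)))%R).
  assert (Hk : (0 < k)%R) by (apply Rdiv_lt_0_compat; lra).
  assert (Ek : (4 * k * (a + c) = 4 * a * c - b ^ 2)%R) by (unfold k; field; lra).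
  assert (Hka : (0 < a - k)%R).
  { apply Rmult_lt_reg_r with (4 * (a + c))%R; [lra|]. pose proof (pow2_ge_0 b). nra. }
  exists k. split; [exact Hk|]. intros m n.
  assert (Q : (4 * (a - k) * (a * n ^ 2 + b * m * n + c * m ^ 2 - k * (m ^ 2 + n ^ 2)) =
     (2 * (a - k) * n + b * m) ^ 2 + 4 * k ^ 2 * m ^ 2)%R).
  { assert (Eb : (b ^ 2 = 4 * a * c - 4 * k * (a + c))%R) by lra.
    replace ((2 * (a - k) * n + b * m) ^ 2)%R with (4 * (a - k) ^ 2 * n ^ 2 + 4 * (a - k) * n * b * m + b ^ 2 * m ^ 2)%R by ring.
    rewrite Eb. ring. }
  apply Rnot_lt_le. intros Hlt.
  pose proof (pow2_ge_0 (2 * (a - k) * n + b * m)). pose proof (pow2_ge_0 (k * m)). nra.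
Qed.

(** The quotient [(m z + n) (m w + n) / (z - w)] is invariant under the simultaneous action of the modular
    group on [z], [w] and [(m, n)]; for [w = conj z] the exponent is that of [rank_lattice] at [x = 0]. *)
Definition eta_lattice (z w : C) (mn : Z * Z) : C :=
  sgnZ (fst mn * snd mn + fst mn + snd mn) *
  Cexp (- (3 * RtoC PI * Ci * ((RtoC (IZR (fst mn)) * z + RtoC (IZR (snd mn))) * (RtoC (IZR (fst mn)) * w + RtoC (IZR (snd mn)))) / (z - w))).

Section Pair.
Variables (z w b : C).
Hypothesis Hz : upper_half_plane z.
Hypothesis Hw : (Im w < 0)%R.
Hypothesis Hb : (Rabs (Im b) < Re b)%R.
Hypothesis Hb2 : b * b = 3 * Ci / (z - w).

Lemma zw_neq_0 : z - w <> 0.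
Proof.
  intros E. pose proof (f_equal Im E) as E'. unfold upper_half_plane in Hz.
  assert (Im (z - w) = Im z - Im w)%R by reflexivity. rewrite H in E'. change (Im 0) with 0%R in E'. lra.
Qed.

Lemma eta_lattice_bound : exists K, (0 <= K)%R /\ forall mn, (Cmod (eta_lattice z w mn) <= K * (Zexp (fst mn) * Zexp (snd mn)))%R.
Proof.
  unfold upper_half_plane in Hz. pose proof PI_RGT_0 as Hpi.
  set (X := Re z). set (X' := Re w). set (y := Im z). set (y' := (- Im w)%R).
  set (sg := (y + y')%R). set (de := (X - X')%R). set (N := (sg ^ 2 + de ^ 2)%R).
  assert (Hy : (0 < y)%R) by exact Hz. assert (Hy' : (0 < y')%R) by (unfold y'; lra).
  assert (Hsg : (0 < sg)%R) by (unfold sg; lra).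
  assert (HN : (0 < N)%R) by (unfold N; pose proof (pow2_ge_0 de); assert (0 < sg ^ 2)%R by (apply pow_lt, Hsg); lra).
  destruct (posdef_lower sg (sg * (X + X') - de * (y - y')) (sg * (X * X' + y * y') - de * (y * X' - X * y')) Hsg) as [k [Hk HQ]].
  { replace (4 * sg * (sg * (X * X' + y * y') - de * (y * X' - X * y')) - (sg * (X + X') - de * (y - y')) ^ 2)%R with (4 * (y * y') * N)%R
      by (unfold N, sg, de; ring).
    apply Rmult_lt_0_compat; [|exact HN]. assert (0 < y * y')%R by (apply Rmult_lt_0_compat; assumption). lra. }
  set (a := (3 * PI * k / N)%R).
  assert (Ha : (0 < a)%R) by (apply Rdiv_lt_0_compat; [apply Rmult_lt_0_compat; lra|exact HN]).
  destruct (gauss_majorant2 a 0 Ha) as [K [HK HG]]. exists K. split; [exact HK|].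
  intros [m n]. unfold eta_lattice. simpl fst; simpl snd. rewrite Cmod_mult, Cmod_sgnZ, Rmult_1_l, Cmod_Cexp.
  specialize (HQ (IZR m) (IZR n)). set (s := IZR m) in *. set (t := IZR n) in *.
  apply HG. fold s t.
  assert (E : Re (- (3 * RtoC PI * Ci * ((RtoC s * z + RtoC t) * (RtoC s * w + RtoC t)) / (z - w))) =
    (- (3 * PI / N) * (sg * t ^ 2 + (sg * (X + X') - de * (y - y')) * s * t + (sg * (X * X' + y * y') - de * (y * X' - X * y')) * s ^ 2))%R).
  { pose proof HN as HN'. unfold N, sg, de, y', y, X, X' in HN'. unfold Cdiv, Cinv. unfold N, sg, de, y', y, X, X'.
    destruct z as [zx zy]. destruct w as [wx wy].
    unfold Cminus, Cplus, Copp, Cmult, Ci, RtoC, Re, Im in *. simpl in *. field. intros Q. lra. }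
  rewrite E. apply Rmult_le_compat_l with (r := (3 * PI / N)%R) in HQ; [|apply Rlt_le, Rdiv_lt_0_compat; lra].
  replace (0 - a * (s ^ 2 + t ^ 2))%R with (- (3 * PI / N * (k * (s ^ 2 + t ^ 2))))%R by (unfold a; field; lra). lra.
Qed.

Lemma Re_inv_b2 : Re (/ (b * b)) = ((Im z - Im w) / 3)%R.
Proof.
  rewrite Hb2. pose proof zw_neq_0 as H0.
  assert (HCi : Ci <> 0) by (intros E; injection E; lra).
  replace (/ (3 * Ci / (z - w))) with (- (Ci * (z - w)) / 3).
  - unfold Cdiv, Cinv, Cminus, Cplus, Copp, Cmult, Ci, RtoC, Re, Im; simpl. field.
  - replace (- (Ci * (z - w)) / 3) with (- (Ci * Ci) * (z - w) / (3 * Ci)) by (field; exact HCi).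
    rewrite Ci_sq. field. split; assumption.
Qed.

(** As for [rank_lattice]: Poisson summation over [n], then [eta_collapse], which splits off [eta z]; the
    remaining single series is the theta series of [eta] at [- w]. *)
Lemma eta_pair : hasSum (eta_lattice z w) (2 * / b * (eta z * eta (- w))).
Proof.
  pose proof PI_RGT_0 as Hpi. pose proof zw_neq_0 as H0.
  assert (HCi : Ci <> 0) by (intros E; injection E; lra).
  pose proof (Re_pos_neq_0 (b * b) (Re_sq_pos b Hb)) as HA.
  assert (Hb0 : b <> 0) by (intros E; apply HA; rewrite E; ring).
  assert (Hw' : upper_half_plane (- w)) by (unfold upper_half_plane; destruct w; simpl in *; lra).
  destruct eta_lattice_bound as [K [HK HKb]].
  destruct (hasSum_ex (eta_lattice z w) _ HKb) as [L HL]; [apply summable_scal; [exact HK|apply summable_Zexp2]|].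
  set (g := fun r : Z => / b * Cexp (- RtoC PI / (b * b) * RtoC ((IZR r + 1/2) ^ 2))).
  assert (gb : exists K2, (0 <= K2)%R /\ forall m r,
    (Cmod (sgnZ m * qpow z (3 * IZR m ^ 2 / 2 + IZR m * (IZR r + 1/2)) * g r) <= K2 * (Zexp m * Zexp r))%R).
  { unfold upper_half_plane in Hz. set (y := Im z) in *. set (y' := (- Im w)%R). assert (Hy' : (0 < y')%R) by (unfold y'; lra).
    destruct (posdef_lower ((y + y') / 3)%R (2 * y)%R (3 * y)%R ltac:(lra)) as [k [Hk HQ]].
    { replace (4 * ((y + y') / 3) * (3 * y) - (2 * y) ^ 2)%R with (4 * (y * y'))%R by field.
      assert (0 < y * y')%R by (apply Rmult_lt_0_compat; assumption). lra. }
    set (a := (PI * k / 2)%R). assert (Ha : (0 < a)%R) by (unfold a; assert (0 < PI * k)%R by (apply Rmult_lt_0_compat; lra); lra).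
    destruct (gauss_majorant2 a a Ha) as [K2 [HK2 HG]].
    exists (Cmod (/ b) * K2)%R. split; [apply Rmult_le_pos; [apply Cmod_ge_0|exact HK2]|].
    intros m r. unfold g. rewrite !Cmod_mult, Cmod_sgnZ, Cmod_qpow, Cmod_Cexp, Rmult_1_l.
    set (s := IZR m). set (t := IZR r).
    replace (exp (- (2 * PI * (3 * s ^ 2 / 2 + s * (t + 1/2)) * Im z)) * (Cmod (/ b) * exp (Re (- RtoC PI / (b * b) * RtoC ((t + 1/2) ^ 2)))))%R
     with (Cmod (/ b) * (exp (- (2 * PI * (3 * s ^ 2 / 2 + s * (t + 1/2)) * Im z)) * exp (Re (- RtoC PI / (b * b) * RtoC ((t + 1/2) ^ 2)))))%R by ring.
    rewrite (Rmult_assoc (Cmod (/ b))). apply Rmult_le_compat_l; [apply Cmod_ge_0|].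
    replace (- RtoC PI / (b * b) * RtoC ((t + 1/2) ^ 2)) with (RtoC (- PI * (t + 1/2) ^ 2) * / (b * b)) by (rewrite RtoC_mult, RtoC_opp; unfold Cdiv; ring).
    rewrite Re_scal_r, Re_inv_b2. rewrite <- exp_plus.
    apply HG. fold s t. specialize (HQ s (t + 1/2)%R).
    assert (Q2 : (t ^ 2 / 2 - 1 / 2 <= (t + 1/2) ^ 2)%R) by (pose proof (pow2_ge_0 (t + 1)); nra).
    assert (Q3 : (k * (s ^ 2 / 2 + t ^ 2 / 2 - 1/2) <= k * (s ^ 2 + (t + 1/2) ^ 2))%R).
    { apply Rmult_le_compat_l; [lra|]. pose proof (pow2_ge_0 s). lra. }
    assert (Q4 : (k * (s ^ 2 / 2 + t ^ 2 / 2 - 1/2) <= (y + y') / 3 * (t + 1/2) ^ 2 + 2 * y * s * (t + 1/2) + 3 * y * s ^ 2)%R) by lra.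
    apply Rmult_le_compat_l with (r := PI) in Q4; [|lra]. fold y.
    replace (y - Im w)%R with (y + y')%R by (unfold y'; ring).
    replace (- (2 * PI * (3 * s ^ 2 / 2 + s * (t + 1/2)) * y) + - PI * (t + 1/2) ^ 2 * ((y + y') / 3))%R with
      (- (PI * ((y + y') / 3 * (t + 1/2) ^ 2 + 2 * y * s * (t + 1/2) + 3 * y * s ^ 2)))%R by field.
    unfold a. lra. }
  destruct gb as [K2 [HK2 gb]].
  destruct (eta_collapse z Hz g K2 HK2 gb) as [T [HT1 HT2]].
  assert (ET : T = 2 * / b * eta (- w)).
  { apply (hasSum_unique _ _ _ HT2). pose proof (hasSum_scal (2 * / b) _ _ (eta_hasSum (- w) Hw')) as H.
    revert H. apply hasSum_ext. intros n. unfold g.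
    replace ((IZR (- (3 * n) - 1) + 1/2) ^ 2)%R with ((IZR (3 * n) + 1/2) ^ 2)%R by (rewrite minus_IZR, opp_IZR; field).
    replace ((IZR (3 * n) + 1/2) ^ 2)%R with ((6 * IZR n + 1) ^ 2 / 4)%R by (rewrite mult_IZR; field).
    set (k2 := ((6 * IZR n + 1) ^ 2)%R).
    assert (EQ : qpow (- w) (k2 / 24) = qpow z (- (k2 / 24)) * Cexp (- RtoC PI / (b * b) * RtoC (k2 / 4))).
    { unfold qpow. rewrite <- Cexp_plus. f_equal. rewrite Hb2.
      replace (- RtoC PI / (3 * Ci / (z - w))) with (RtoC PI * Ci * (z - w) / 3).
      2:{ replace (RtoC PI * Ci * (z - w) / 3) with (RtoC PI * (Ci * Ci) * (z - w) / (3 * Ci)) by (field; exact HCi).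
          rewrite Ci_sq. field. split; assumption. }
      unfold Rdiv. rewrite ?RtoC_mult, ?RtoC_opp, ?RtoC_mult, ?RtoC_inv by lra. field. }
    rewrite EQ. ring. }
  replace (2 * / b * (eta z * eta (- w))) with L; [exact HL|].
  destruct (choice_fun (fun m B => hasSum (fun r => g r * Cexp (2 * RtoC PI * Ci * RtoC (IZR r + 1/2) * (RtoC (IZR m) * z))) B /\
     hasSum (fun n => eta_lattice z w (m, n)) (sgnZ m * qpow z (3 * IZR m ^ 2 / 2) * B))) as [Bf HB].
  { intros m. destruct (poisson_alt b (RtoC (IZR m) * z) Hb) as [B [P1 P2]]. exists B. split.
    - revert P2. apply hasSum_ext. intros r. unfold g. rewrite Cexp_plus. ring.
    - apply (hasSum_scal (sgnZ m * qpow z (3 * IZR m ^ 2 / 2))) in P1. revert P1. apply hasSum_ext. intros n.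
      unfold eta_lattice. simpl fst; simpl snd. rewrite !sgnZ_plus, Hb2.
      set (W := RtoC (IZR m) * z + RtoC (IZR n)).
      replace (RtoC (IZR n) + RtoC (IZR m) * z) with W by (unfold W; ring).
      replace (RtoC (IZR m) * w + RtoC (IZR n)) with (W - RtoC (IZR m) * (z - w)) by (unfold W; ring).
      assert (EX : Cexp (- (3 * RtoC PI * Ci * (W * (W - RtoC (IZR m) * (z - w))) / (z - w))) =
        sgnZ (m * n) * (qpow z (3 * IZR m ^ 2 / 2) * Cexp (- RtoC PI * (3 * Ci / (z - w)) * (W * W)))).
      { replace (sgnZ (m * n)) with (Cexp (RtoC PI * Ci * RtoC (IZR (3 * (m * n))))).
        2:{ rewrite Cexp_pi_i. unfold sgnZ. rewrite Z.even_mul. reflexivity. }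
        unfold qpow. rewrite <- !Cexp_plus. f_equal. rewrite !mult_IZR. rewrite !RtoC_mult.
        replace (RtoC (3 * IZR m ^ 2 / 2)) with (3 * RtoC (IZR m) * RtoC (IZR m) / 2) by (rewrite RtoC_div by lra; rewrite RtoC_mult, RtoC_pow; field).
        unfold W. field. exact H0. }
      rewrite EX.
      transitivity (sgnZ m * sgnZ n * (sgnZ (m * n) * sgnZ (m * n)) * (qpow z (3 * IZR m ^ 2 / 2) * Cexp (- RtoC PI * (3 * Ci / (z - w)) * (W * W)))).
      { rewrite sgnZ_sq. ring. }
      ring. }
  pose proof (hasSum_fubini _ _ L HL (fun m => proj2 (HB m))) as F1.
  assert (F2 : hasSum (fun m => sgnZ m * qpow z (3 * IZR m ^ 2 / 2) * Bf m) (eta z * T)).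
  { apply (hasSum_fubini _ _ _ HT1). intros m. simpl fst. simpl snd.
    pose proof (hasSum_scal (sgnZ m * qpow z (3 * IZR m ^ 2 / 2)) _ _ (proj1 (HB m))) as H. revert H. apply hasSum_ext. intros r.
    rewrite qpow_plus.
    replace (Cexp (2 * RtoC PI * Ci * RtoC (IZR r + 1/2) * (RtoC (IZR m) * z))) with (qpow z (IZR m * (IZR r + 1/2))); [ring|].
    unfold qpow. f_equal. rewrite !RtoC_mult. ring. }
  rewrite (hasSum_unique _ _ _ F1 F2), ET. ring.
Qed.

End Pair.

Lemma sector_sqrt_exists (z w : C) : upper_half_plane z -> (Im w < 0)%R ->
  exists b, (Rabs (Im b) < Re b)%R /\ b * b = 3 * Ci / (z - w).
Proof.
  intros Hz Hw. unfold upper_half_plane in Hz.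
  assert (H : (0 < Re (3 * Ci / (z - w)))%R).
  { replace (Re (3 * Ci / (z - w))) with (3 * (Im z - Im w) / ((Re z - Re w) ^ 2 + (Im z - Im w) ^ 2))%R.
    - assert (0 < (Im z - Im w) ^ 2)%R by (apply pow_lt; lra). pose proof (pow2_ge_0 (Re z - Re w)).
      apply Rdiv_lt_0_compat; lra.
    - destruct z as [zx zy], w as [wx wy]. unfold Cdiv, Cinv, Cminus, Cplus, Copp, Cmult, Ci, RtoC, Re, Im in *; simpl in *.
      assert (0 < (zy - wy) * (zy - wy))%R by (apply Rmult_lt_0_compat; lra). pose proof (Rle_0_sqr (zx - wx)) as HS. unfold Rsqr in HS.
      field. intros Q. lra. }
  exists (Cpower (3 * Ci / (z - w)) (1/2)). split; [apply Cpower_half_sector, H|].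
  apply Cpower_half_sq, Re_pos_neq_0, H.
Qed.

(** Compare [eta_pair] at [(z, w)] and at [(A z, A w)], with [w = - i] fixed. The factor in front of the
    eta values is a square root in the sector [|Im b| < Re b]; it changes by the product of the principal square
    roots of [c z + d] and [c w + d], which has positive real part since these numbers lie in opposite
    half-planes. A matrix with [c = 0] and [d = -1] would break this, whence the hypothesis. *)
Theorem eta_modular (A : SL2Z) : (mc A = 0%Z -> md A = 1%Z) ->
  exists nu : C, nu <> 0 /\ forall z, upper_half_plane z -> eta (mob A z) = Cpower (jac A z) (1/2) * (nu * eta z).
Proof.
  intros HA. set (w := - Ci).
  assert (Hw : (Im w < 0)%R) by (unfold w; simpl; lra).
  assert (Hw' : upper_half_plane (- w)) by (unfold upper_half_plane; unfold w; simpl; lra).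
  assert (Hmw : (Im (mob A w) < 0)%R) by (apply mob_lower, Hw).
  assert (Hmw' : upper_half_plane (- mob A w)).
  { unfold upper_half_plane. replace (Im (- mob A w)) with (- Im (mob A w))%R by reflexivity. lra. }
  pose proof (jac_neq_0 A w ltac:(lra)) as Hjw.
  set (ga := Cpower (jac A w) (1/2)).
  assert (Ega : ga * ga = jac A w) by (apply Cpower_half_sq, Hjw).
  assert (Hga : ga <> 0) by (intros E; apply Hjw; rewrite <- Ega, E; ring).
  pose proof (eta_neq_0 (- w) Hw') as N1. pose proof (eta_neq_0 (- mob A w) Hmw') as N2.
  exists (ga * eta (- w) / eta (- mob A w)). split.
  { unfold Cdiv. apply Cmult_neq_0; [apply Cmult_neq_0; assumption|]. intros E.
    assert (Q : eta (- mob A w) * / eta (- mob A w) = 1) by (field; exact N2).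
    rewrite E in Q. replace (eta (- mob A w) * 0) with (RtoC 0) in Q by ring. injection Q; lra. }
  intros z Hz. assert (Hz0 : Im z <> 0%R) by (unfold upper_half_plane in Hz; lra).
  pose proof (jac_neq_0 A z Hz0) as Hjz. pose proof (mob_upper A z Hz) as Hmz.
  destruct (sector_sqrt_exists z w Hz Hw) as [b [Hb Eb]].
  destruct (sector_sqrt_exists (mob A z) (mob A w) Hmz Hmw) as [b' [Hb' Eb']].
  pose proof (zw_neq_0 z w Hz Hw) as D0.
  assert (ED : mob A z - mob A w = (z - w) / (jac A z * jac A w)).
  { unfold mob.
    transitivity (((RtoC (IZR (ma A)) * RtoC (IZR (md A)) - RtoC (IZR (mb A)) * RtoC (IZR (mc A))) * (z - w)) / (jac A z * jac A w)).
    - transitivity (((RtoC (IZR (ma A)) * z + RtoC (IZR (mb A))) * jac A w - (RtoC (IZR (ma A)) * w + RtoC (IZR (mb A))) * jac A z) / (jac A z * jac A w)).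
      + field. split; assumption.
      + unfold jac at 1 2. unfold Cdiv. ring.
    - rewrite det_C. f_equal. ring. }
  pose proof (eta_pair z w b Hz Hw Hb Eb) as S1.
  pose proof (eta_pair (mob A z) (mob A w) b' Hmz Hmw Hb' Eb') as S2.
  apply (hasSum_reindex (actZ A 0 0) (actZ_inv A 0 0)) in S1; [|apply actZ_K1|apply actZ_K2].
  assert (EL : forall mn, eta_lattice z w (actZ A 0 0 mn) = eta_lattice (mob A z) (mob A w) mn).
  { intros [m n]. unfold eta_lattice. simpl fst; simpl snd. rewrite !mob_lattice, ED by assumption. rewrite !Z.add_0_r.
    set (m' := (m * ma A + n * mc A)%Z). set (n' := (m * mb A + n * md A)%Z).
    f_equal.
    - apply sgnZ_eq. unfold m', n'. pose proof (SL2Z_det A) as D. apply (f_equal Z.even) in D.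
      repeat first [rewrite Z.even_add in *|rewrite Z.even_sub in *|rewrite Z.even_mul in *].
      simpl in *. destruct (Z.even m), (Z.even n), (Z.even (ma A)), (Z.even (mb A)), (Z.even (mc A)), (Z.even (md A)); simpl in *; try reflexivity; discriminate.
    - f_equal. f_equal. field. repeat split; assumption. }
  pose proof (hasSum_unique _ _ _ (hasSum_ext _ _ _ EL S1) S2) as E.
  set (al := Cpower (jac A z) (1/2)).
  assert (Eal : al * al = jac A z) by (apply Cpower_half_sq, Hjz).
  assert (Hal : al <> 0) by (intros Q; apply Hjz; rewrite <- Eal, Q; ring).
  pose proof (Re_pos_neq_0 (b * b) (Re_sq_pos b Hb)) as HA0.
  assert (Hb0 : b <> 0) by (intros Q; apply HA0; rewrite Q; ring).
  assert (Hag : (0 < Re (al * ga))%R).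
  { rewrite Re_mult. destruct (Z.eq_dec (mc A) 0) as [C0|C0].
    - assert (J : forall v, jac A v = 1) by (intros v; unfold jac; rewrite C0, (HA C0); ring).
      unfold al, ga. rewrite !J, Cpower_half_one. simpl. lra.
    - assert (I1 : Im (jac A z) = (IZR (mc A) * Im z)%R) by (unfold jac; rewrite Im_plus, Im_mult, Re_RtoC, !Im_RtoC; ring).
      assert (I2 : Im (jac A w) = (IZR (mc A) * Im w)%R) by (unfold jac; rewrite Im_plus, Im_mult, Re_RtoC, !Im_RtoC; ring).
      unfold upper_half_plane in Hz. destruct (Z_lt_le_dec 0 (mc A)) as [P|P].
      + apply IZR_lt in P. destruct (Cpower_half_upper (jac A z)) as [A1 A2]; [rewrite I1; nra|].
        destruct (Cpower_half_lower (jac A w)) as [A3 A4]; [rewrite I2; nra|]. fold al in A1, A2. fold ga in A3, A4. nra.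
      + assert (P' : (mc A <= -1)%Z) by lia. apply IZR_le in P'.
        destruct (Cpower_half_lower (jac A z)) as [A1 A2]; [rewrite I1; nra|].
        destruct (Cpower_half_upper (jac A w)) as [A3 A4]; [rewrite I2; nra|]. fold al in A1, A2. fold ga in A3, A4. nra. }
  assert (Bsq : (b' - b * (al * ga)) * (b' + b * (al * ga)) = 0).
  { replace ((b' - b * (al * ga)) * (b' + b * (al * ga))) with (b' * b' - (b * b) * (al * al) * (ga * ga)) by ring.
    rewrite Eb, Eb', Eal, Ega, ED. field. repeat split; assumption. }
  assert (Bm : b' = b * (al * ga)).
  { destruct (classic (b' - b * (al * ga) = 0)) as [Q|Q].
    - replace b' with ((b' - b * (al * ga)) + b * (al * ga)) by ring. rewrite Q. ring.
    - exfalso.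
      (* Otherwise [b'] is [- b (al ga)], and [Re (b' conj b)] would be both positive and negative. *)
      assert (Q2 : b' + b * (al * ga) = 0).
      { replace (b' + b * (al * ga)) with (/ (b' - b * (al * ga)) * ((b' - b * (al * ga)) * (b' + b * (al * ga)))) by (field; exact Q). rewrite Bsq. ring. }
      assert (Q3 : b' = - (b * (al * ga))) by (replace b' with ((b' + b * (al * ga)) - b * (al * ga)) by ring; rewrite Q2; ring).
      assert (P1 : (0 < Re b' * Re b + Im b' * Im b)%R).
      { apply Rabs_def2 in Hb. apply Rabs_def2 in Hb'. nra. }
      rewrite Q3 in P1. set (v := al * ga) in *.
      replace (Re (- (b * v)) * Re b + Im (- (b * v)) * Im b)%R with (- (Re b ^ 2 + Im b ^ 2) * Re v)%R in P1
        by (unfold Copp, Cmult, Re, Im; simpl; ring).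
      pose proof (pow2_ge_0 (Re b)). pose proof (pow2_ge_0 (Im b)). nra. }
  rewrite Bm in E.
  assert (H2 : RtoC 2 <> 0) by (intros Q; injection Q; lra).
  assert (EE : eta (mob A z) * eta (- mob A w) = al * ga * (eta z * eta (- w))).
  { transitivity (b * (al * ga) / 2 * (2 * / (b * (al * ga)) * (eta (mob A z) * eta (- mob A w)))); [field; repeat split; assumption|].
    rewrite <- E. field. exact Hb0. }
  transitivity (eta (mob A z) * eta (- mob A w) / eta (- mob A w)); [field; exact N2|].
  rewrite EE. field. exact N2.
Qed.

(** The constant is unique since [eta] does not vanish at [i]. *)
Lemma nu_eta_spec (A : SL2Z) (nu : C) :
  (forall z, upper_half_plane z -> eta (mob A z) = Cpower (jac A z) (1/2) * (nu * eta z)) -> nu_eta A = nu.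
Proof.
  intros H.
  assert (P : forall z, upper_half_plane z -> slash (1/2) A eta z = nu * eta z).
  { intros z Hz. unfold slash. cbv zeta. fold (jac A z). fold (mob A z). rewrite (H z Hz), Cpower_opp_half.
    assert (Hj : jac A z <> 0) by (apply jac_neq_0; unfold upper_half_plane in Hz; lra).
    field. intros E. apply Hj. rewrite <- (Cpower_half_sq _ Hj), E. ring. }
  assert (U : forall mu : C, (forall z, upper_half_plane z -> slash (1/2) A eta z = mu * eta z) -> mu = nu).
  { intros mu Hmu. assert (Hi : upper_half_plane Ci) by (unfold upper_half_plane; simpl; lra).
    pose proof (eta_neq_0 Ci Hi) as N.
    assert (E : mu * eta Ci = nu * eta Ci) by (rewrite <- (P Ci Hi); symmetry; apply (Hmu Ci Hi)).
    transitivity (mu * eta Ci / eta Ci); [field; exact N|]. rewrite E. field. exact N. }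
  exact (@iota_unique C_AbsRing C_CompleteNormedModule _ nu U P).
Qed.

End EtaModular.

(** The first law is [F1_modular]; dividing it by the law of [eta] gives the second. *)
Theorem corollary4p2 (p l : Z)
  (p_prime : prime p) (p_gt3 : (3 < p)%Z)
  (l_bounds : (1 <= l <= (p - 1) / 2)%Z)
  (A : SL2Z) (A0 : Gamma0 (p ^ 2) A) (A1 : Gamma1 p A) :
  (forall z : C, upper_half_plane z ->
     slash 1 A (F1 (IZR l / IZR p)) z = F1 (IZR l / IZR p) z) /\
  (forall z : C, upper_half_plane z ->
     slash (1 / 2) A (G1 (IZR l / IZR p)) z
     = (1 / nu_eta A * G1 (IZR l / IZR p) z)%C).
Proof.
  assert (Hodd : Z.odd p = true).
  { apply Z.odd_spec. destruct (Z.Even_or_Odd p) as [[k Hk]|H]; [|exact H]. exfalso.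
    destruct (prime_divisors p p_prime 2) as [H|[H|[H|H]]]; [exists k|..]; lia. }
  assert (Hl : (0 < l < p)%Z).
  { assert ((p - 1) / 2 <= p - 1)%Z by (apply Z.div_le_upper_bound; lia). lia. }
  set (x := (IZR l / IZR p)%R).
  assert (HF : forall z, upper_half_plane z -> F1 x (mob A z) = (jac A z * F1 x z)%C)
    by (apply F1_modular; try assumption; lia).
  assert (HJ : forall z, upper_half_plane z -> jac A z <> 0%C)
    by (intros z Hz; apply jac_neq_0; unfold upper_half_plane in Hz; lra).
  (* A matrix with c = 0 has d = +-1, and the congruence modulo p excludes -1. *)
  assert (HA : mc A = 0%Z -> md A = 1%Z).
  { intros C0. pose proof (SL2Z_det A) as D. destruct A1 as [_ [_ [k Hk]]].
    rewrite C0 in D. assert (D1 : (ma A * md A = 1)%Z) by lia.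
    destruct (Z.eq_mul_1 _ _ D1) as [E|E]; [rewrite E in D1; lia|].
    rewrite E in D1. assert (md A = -1)%Z by lia. exfalso.
    assert (k * p = -2)%Z by lia. destruct (Z_le_gt_dec k (-1)); nia. }
  split; intros z Hz; unfold slash; cbv zeta; fold (jac A z); fold (mob A z).
  - rewrite Cpower_m1, HF by auto. field. auto.
  - destruct (eta_modular A HA) as [nu [Hnu HE]]. rewrite (nu_eta_spec A nu HE), Cpower_opp_half.
    pose proof (HF z Hz) as H. unfold F1 in H. rewrite (HE z Hz) in H.
    pose proof (eta_neq_0 z Hz) as He. specialize (HJ z Hz).
    set (al := Cpower (jac A z) (1 / 2)) in *.
    assert (Eal : (al * al)%C = jac A z) by (apply Cpower_half_sq, HJ).
    assert (Hal : al <> 0%C) by (intros Q; apply HJ; rewrite <- Eal, Q; ring).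
    rewrite <- Eal in H.
    transitivity (/ (al * al * nu * eta z) * (al * (nu * eta z) * G1 x (mob A z)))%C.
    + field. repeat split; assumption.
    + rewrite H. field. repeat split; assumption.
Qed.
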